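(* Let $0<r<R$ and $p,d\in\mathbb{N}$ (positive integers). Let $(w_j)_j$ be a countable family of functions $w_j\in\mathcal{H}_R^{d,p}$ and $(v_j)_j$ a countable family of analytic maps $v_j:\mathcal{E}_R^{d,p}\to\mathcal{E}_r^{d,p}$ (with the same index set), satisfying $\sum_j\|w_j\|_{\mathcal{H}_R^{d,p}}\le W$ for some $W<\infty$. Consider the transfer operator $$\mathcal{L}:\mathcal{H}_r^{d,p}\to\mathcal{H}_R^{d,p},\qquad \mathcal{L}\varphi=\sum_j w_j\cdot(\varphi\circ v_j).$$ Then for all integers $K\ge 1$ and all $\rho\in[0,R)$, $$\|\mathcal{P}_K\mathcal{L}-\mathcal{L}\|_{\mathcal{H}_r^{d,p}\to\mathcal{H}_\rho^{d,p}}\le W\cdot E_{d,K}(R-\rho).$$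
   Context: For $d\ge1$, $p\in[1,\infty]$, $r>0$ let $\mathrm{Ball}_r^{d,p}=\{x\in\mathbb{R}^d:\|x\|_p<r\}$ and let the $d$-dimensional Bernstein ellipse be $\mathcal{E}_r^{d,p}=\cos(\mathbb{R}^d+i\,\mathrm{Ball}_r^{d,p})\subset\mathbb{C}^d$, with $\cos$ applied componentwise. $\mathcal{H}_r^{d,p}$ is the Banach space of functions $\varphi$ that are holomorphic on $\mathcal{E}_r^{d,p}$, continuous on its closure, and satisfy $\varphi([-1,1]^d)\subseteq\mathbb{R}$, with norm $\|\varphi\|_{\mathcal{H}_r^{d,p}}=\sup_{z\in\mathcal{E}_r^{d,p}}|\varphi(z)|$. For $r=0$ the norm is the supremum norm on $[-1,1]^d$. Interpolation operator: for $K\ge1$ let $x_{k,K}=\cos\frac{\pi(2k+1)}{2K}$, $k=0,\dots,K-1$, be the Chebyshev nodes. Let $\ell_{k,K}(y)=\prod_{i\ne k}\frac{y-x_{i,K}}{x_{k,K}-x_{i,K}}$, and for a multi-index $\mathbf{k}\in\{0,\dots,K-1\}^d$ let $\mathbf{x}_{\mathbf{k},K}=(x_{k_1,K},\dots,x_{k_d,K})$ and $\ell_{\mathbf{k},K}(\mathbf{y})=\prod_{j=1}^d\ell_{k_j,K}(y_j)$. Then $(\mathcal{P}_K\phi)(\mathbf{y})=\sum_{\mathbf{k}\in\{0,\dots,K-1\}^d}\phi(\mathbf{x}_{\mathbf{k},K})\,\ell_{\mathbf{k},K}(\mathbf{y})$. Error function: for $x>0$, $$E_{d,K}(x)=\begin{cases}8e^{-(K-1)x}\frac1x,&d=1;\\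 16e^{-(K-1)x}\frac{1+Kx}{x^2},&d=2;\\ 48e^{-(K-1)x}\frac{2+2Kx+K^2x^2}{x^3},&d=3;\\ 2^d e^{1-(K-1)x}\frac{d^2K^{d-1}}{x},&d\ge4.\end{cases}$$ It is a standing assumption that the formula for $\mathcal{L}$ defines an operator from $\mathcal{H}_r^{d,p}$ to $\mathcal{H}_R^{d,p}$, that is, $\mathcal{L}\varphi\in\mathcal{H}_R^{d,p}$ for every $\varphi\in\mathcal{H}_r^{d,p}$. Functions in $\mathcal{H}_R^{d,p}$ are regarded as elements of $\mathcal{H}_\rho^{d,p}$ by restriction. *)

(* Defs.v *)
From HB Require Import structures.
From mathcomp Require Import all_boot all_order all_algebra.
From mathcomp Require Import finmap.
From mathcomp.real_closed Require Import complex.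
From mathcomp Require Import all_classical all_reals all_analysis.

Set Implicit Arguments.
Unset Strict Implicit.
Unset Printing Implicit Defensive.

Import Order.TTheory GRing.Theory Num.Theory.
Import numFieldNormedType.Exports.

Local Open Scope classical_set_scope.
Local Open Scope ring_scope.
Local Open Scope complex_scope.

(* MathComp-Analysis puts the norm topology on abstract numeric fields only;
   these instances transfer it to the concrete type R[i].  In particular
   [differentiable], for maps between normed modules over R[i], is complex
   (Frechet) differentiability. *)
HB.instance Definition _ (R : rcfType) :=
  GRing.ComAlgebra.copy R[i] (R[i] : numClosedFieldType)^o.
HB.instance Definition _ (R : rcfType) :=
  Vector.copy R[i] (R[i] : numClosedFieldType)^o.
HB.instance Definition _ (R : rcfType) :=
  NormedModule.copy R[i] (R[i] : numClosedFieldType)^o.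

Notation cabs := Normc.normc.

Section Definitions.
Variable R : realType.
Local Notation C := R[i].

Definition cexp (z : C) : C :=
  (expR (complex.Re z))%:C * (cos (complex.Im z) +i* sin (complex.Im z)).

Definition ccos (z : C) : C := (cexp ('i%C * z) + cexp (- ('i%C * z))) / 2.

Definition pnorm (d p : nat) (x : 'rV[R]_d) : R :=
  (\sum_j `|x ord0 j| ^+ p) `^ (p%:R^-1).

Definition pball (d p : nat) (r : R) : set 'rV[R]_d :=
  [set x | pnorm p x < r].

Definition bernstein (d p : nat) (r : R) : set 'rV[C]_d :=
  [set \row_j ccos (x ord0 j +i* y ord0 j)
    | x in [set: 'rV[R]_d] & y in pball p r].

Definition cube (d : nat) : set 'rV[C]_d :=
  [set \row_j (t ord0 j)%:C
    | t in [set t : 'rV[R]_d | forall j, -1 <= t ord0 j <= 1]].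

Definition holomorphic_on (d : nat) (V : normedModType C)
    (A : set 'rV[C]_d) (f : 'rV[C]_d -> V) : Prop :=
  forall z, A z -> differentiable f z.

(* Functions on the closed ellipse are represented by total functions whose
   values elsewhere are irrelevant. *)
Definition Hspace (d p : nat) (r : R) : set ('rV[C]_d -> C) :=
  [set phi : 'rV[C]_d -> C | [/\ holomorphic_on (bernstein p r) phi,
                 {within closure (bernstein p r), continuous phi} &
                 forall z, cube z -> phi z \is Num.real]].

(* The set over which the norm with radius r is computed; at r = 0 the open
   ball is empty and the real cube is used by convention. *)
Definition hdomain (d p : nat) (r : R) : set 'rV[C]_d :=
  if r == 0 then @cube d else bernstein p r.

Definition hnorm (d p : nat) (r : R) (phi : 'rV[C]_d -> C) : \bar R :=
  ereal_sup [set (cabs (phi z))%:E | z in hdomain p r].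

Definition opnorm (d p : nat) (r rho : R)
    (T : ('rV[C]_d -> C) -> ('rV[C]_d -> C)) : \bar R :=
  ereal_sup [set hnorm p rho (T phi)
    | phi in [set phi | Hspace p r phi /\ (hnorm p r phi <= 1)%E]].

Definition cheb_node (K k : nat) : R := cos (pi * (2 * k + 1)%:R / (2 * K)%:R).

Definition lagrange (K : nat) (k : 'I_K) (y : C) : C :=
  \prod_(i < K | i != k)
    ((y - (cheb_node K i)%:C) / ((cheb_node K k)%:C - (cheb_node K i)%:C)).

Definition interp (d K : nat) (phi : 'rV[C]_d -> C) (y : 'rV[C]_d) : C :=
  \sum_(k : {ffun 'I_d -> 'I_K})
    phi (\row_j (cheb_node K (k j))%:C) * \prod_j lagrange (k j) (y ord0 j).

(* s is the sum of the (unconditionally convergent) family x. *)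
Definition has_sum (J : choiceType) (x : J -> C) (s : C) : Prop :=
  forall eps : R, 0 < eps -> exists A : {fset J}, forall B : {fset J},
    fsubset A B -> cabs (\sum_(j <- B) x j - s) < eps.

(* L maps H_r to H_Rad by the formula sum_j w_j (phi o v_j), which makes sense
   on the open ellipse, where the v_j are defined; membership in H_Rad then
   determines L phi on the closure by continuity. *)
Definition is_transfer_operator (d p : nat) (r Rad : R) (J : choiceType)
    (w : J -> 'rV[C]_d -> C) (v : J -> 'rV[C]_d -> 'rV[C]_d)
    (L : ('rV[C]_d -> C) -> ('rV[C]_d -> C)) : Prop :=
  forall phi, Hspace p r phi ->
    Hspace p Rad (L phi) /\
    forall z, bernstein p Rad z ->
      has_sum (fun j => w j z * phi (v j z)) (L phi z).

Definition err (d K : nat) (x : R) : R :=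
  let e := expR (- ((K%:R - 1) * x)) in
  match d with
  | 1 => 8 * e * x^-1
  | 2 => 16 * e * ((1 + K%:R * x) / x ^+ 2)
  | 3 => 48 * e * ((2 + 2 * K%:R * x + K%:R ^+ 2 * x ^+ 2) / x ^+ 3)
  | _ => 2 ^+ d * expR (1 - (K%:R - 1) * x) * (d%:R ^+ 2 * K%:R ^+ d.-1 / x)
  end.

End Definitions.

(* Main.v *)
(* Put z = cos theta: the function becomes even and 2 pi-periodic in each angle,
   holomorphic on a strip.  Discrete contour sums (Goursat) show that
   trapezoidal means do not depend on the height of the line, so the cosine
   coefficients c_k of a function bounded by W on |Im| < Y satisfy
   |c_k| <= W e^(-kb) for all b < Y, and Fejer means turn this into dual bounds
   for finite combinations of point evaluations.  These bounds tensorize.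
   Interpolation at the K Chebyshev nodes replaces cos(l theta) by an aliased
   cosine of no larger modulus bound and fixes it for l < K; hence the error is
   at most twice the sum of the coefficient bounds over max l >= K.  Choosing
   for each multi-index the largest coordinate to absorb the gap a < R - rho
   gives 2^(d+1) sum_(m >= K) ((m+1)^d - m^d) e^(-ma), which is compared with an
   integral.  That suffices unless d >= 4 and K (R - rho) < d - 1, where E_(d,K)
   is at least 1 plus the norm of the interpolation operator, which is at
   most Q^(d/2) for an explicit Q linear in K (Cauchy-Schwarz or Bessel,
   according to the size of K |Im theta|). *)

Require Import Defs.
From HB Require Import structures.
From mathcomp Require Import all_boot all_order all_algebra.
From mathcomp.real_closed Require Import complex.
From mathcomp Require Import all_classical all_reals all_analysis.
From mathcomp Require Import ring lra zify.

Set Implicit Arguments.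
Unset Strict Implicit.
Unset Printing Implicit Defensive.

Import Order.TTheory GRing.Theory Num.Theory.
Import numFieldNormedType.Exports.

Local Open Scope classical_set_scope.
Local Open Scope ring_scope.

Local Notation Re := complex.Re.
Local Notation Im := complex.Im.
Local Notation "x %:C" := (real_complex _ x) (format "x %:C").
Local Notation "x +i* y" := (Complex x y).
Local Notation iC := (Complex 0 1).
Local Notation "x *i" := (Complex 0 x) (at level 8, format "x *i").

(** Aliasing is studied not on F itself but on [dft_sum], a cosine polynomial whose coefficients are
    trapezoidal means of F: no series in d variables has to converge, and the distance to F is a
    separate error that vanishes when first the degree n and then the number N of grid points grow.
    The factor 2^(d+1) consists of a 2 for each cosine coefficient and a 2 for comparing [alias]
    with [ck]. The p-norm enters through monotonicity and the triangle inequality along an axis: a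
    vector of norm at most rho, raised by a < R - rho in one coordinate, keeps norm below R. So for
    each coordinate there is a tube that is wider by a in that direction, and F is bounded by W on
    each of them. For d = 2, 3 the function E_(d,K) is exactly 2^(d+1) times the comparison
    integral, for d = 1 it is twice that. For d >= 4 it keeps only the leading power K^(d-1): the
    integral unfolds into d terms, each of which is at most the leading one once K (R - rho) >= d -
    1. This is the origin of the case distinction. *)

Section ComplexModulus.
Variable R : realType.
Local Notation C := R[i].
Implicit Types (z : C) (x : R).

Lemma cabsE z : `|z| = (cabs z)%:C.
Proof. by case: z. Qed.

Lemma cabs_ge0 z : 0 <= cabs z.
Proof. by rewrite -ler0c -cabsE normr_ge0. Qed.

Lemma cabs0 : cabs (0 : C) = 0.
Proof. exact: Normc.normc0. Qed.

Lemma cabs1 : cabs (1 : C) = 1.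
Proof. exact: Normc.normc1. Qed.

Lemma cabsM z1 z2 : cabs (z1 * z2) = cabs z1 * cabs z2.
Proof. exact: Normc.normcM. Qed.

Lemma cabsV z : cabs z^-1 = (cabs z)^-1.
Proof. exact: Normc.normcV. Qed.

Lemma cabsN z : cabs (- z) = cabs z.
Proof. exact: normcN. Qed.

Lemma cabsB z1 z2 : cabs (z1 - z2) = cabs (z2 - z1).
Proof. by rewrite -cabsN opprB. Qed.

Lemma le_cabsD z1 z2 : cabs (z1 + z2) <= cabs z1 + cabs z2.
Proof. exact: le_normcD. Qed.

Lemma le_cabsB z1 z2 : cabs (z1 - z2) <= cabs z1 + cabs z2.
Proof. by rewrite -(cabsN z2) le_cabsD. Qed.

Lemma cabsX z n : cabs (z ^+ n) = cabs z ^+ n.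
Proof.
elim: n => [|n IH]; first by rewrite !expr0 cabs1.
by rewrite !exprS cabsM IH.
Qed.

Lemma cabsR x : cabs (x%:C) = `|x|.
Proof. by rewrite /= expr0n /= addr0 sqrtr_sqr. Qed.

Lemma cabs_nat n : cabs (n%:R : C) = n%:R.
Proof. by rewrite -(rmorph_nat (real_complex R)) cabsR normr_nat. Qed.

Lemma cabs_eq0 z : (cabs z == 0) = (z == 0).
Proof.
by apply/eqP/eqP => [/Normc.eq0_normc //|->]; rewrite cabs0.
Qed.

Lemma cabs_sum (I : Type) (r : seq I) (P : pred I) (F : I -> C) :
  cabs (\sum_(i <- r | P i) F i) <= \sum_(i <- r | P i) cabs (F i).
Proof.
elim/big_rec2: _ => [|i y z _ h]; first by rewrite cabs0.
by apply: (le_trans (le_cabsD _ _)); rewrite lerD2l.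
Qed.

Lemma cabs_prod (I : Type) (r : seq I) (P : pred I) (F : I -> C) :
  cabs (\prod_(i <- r | P i) F i) = \prod_(i <- r | P i) cabs (F i).
Proof. by elim/big_rec2: _ => [|i y z _ <-]; rewrite ?cabs1 ?cabsM. Qed.

Lemma cabs_le_ReIm z : cabs z <= `|Re z| + `|Im z|.
Proof.
case: z => a b /=; rewrite -[X in _ <= X]ger0_norm ?addr_ge0 // -sqrtr_sqr.
rewrite ler_sqrt ?sqr_ge0 // -(real_normK (num_real a)) -(real_normK (num_real b)).
rewrite sqrrD lerD2r lerDl; apply: mulrn_wge0; exact: mulr_ge0.
Qed.

Lemma Re_le_cabs z : `|Re z| <= cabs z.
Proof. by rewrite -lecR -cabsE normc_ge_Re. Qed.

Lemma Im_le_cabs z : `|Im z| <= cabs z.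
Proof.
case: z => a b /=; rewrite -sqrtr_sqr ler_sqrt ?lerDr ?sqr_ge0 //.
by rewrite addr_ge0 ?sqr_ge0.
Qed.

Lemma sqr_cabsJ z : (cabs z ^+ 2)%:C = z * (z^*)%C.
Proof. by rewrite rmorphXn /= -cabsE sqr_normc. Qed.

End ComplexModulus.

(** * Contour sums and the Goursat lemma *)

Section Goursat.
Variable R : realType.
Local Notation C := R[i].
Implicit Types (G : C -> C) (z p q s : C).

(** Complex differentiability at s as an explicit linear remainder; [<=] rather than [<] admits h =
    0. *)
Definition cdiff G s := exists D : C, forall e : R, 0 < e ->
  exists2 d : R, 0 < d & forall h, cabs h < d ->
    cabs (G (s + h) - G s - D * h) <= e * cabs h.

(* Left Riemann sums of contour integrals, with 2^n points per edge: they
   satisfy the subdivision identity exactly ([rect_sumS]), so that the bisection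
   proof of the Goursat lemma needs no integral. *)
Definition edge_sum G (n : nat) z p : C :=
  \sum_(0 <= j < 2 ^ n) G (z + j%:R / 2 ^+ n * p) * (p / 2 ^+ n).

Definition rect_sum G n z p q : C :=
  edge_sum G n z p + edge_sum G n (z + p) q
  - edge_sum G n (z + q) p - edge_sum G n z q.

Let two_neq0 n : (2 ^+ n : C) != 0.
Proof. by rewrite expf_neq0 // pnatr_eq0. Qed.

Lemma sum_natDD (F : nat -> C) m :
  \sum_(0 <= j < m + m) F j = \sum_(0 <= j < m) F j + \sum_(0 <= j < m) F (j + m)%N.
Proof.
rewrite (big_cat_nat (n := m)) ?leq_addr //=; congr (_ + _).
by rewrite -{1}[m]add0n big_addn addnK.
Qed.

Lemma edge_sumS G n z p :
  edge_sum G n.+1 z p = edge_sum G n z (p / 2) + edge_sum G n (z + p / 2) (p / 2).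
Proof.
have n0 := two_neq0 n; have t0 : (2 : C) != 0 by rewrite pnatr_eq0.
rewrite /edge_sum expnS mul2n -addnn sum_natDD; congr (_ + _); apply: eq_big_nat => j _.
  by rewrite exprS; congr (G _ * _); field; rewrite ?n0 ?t0.
by rewrite exprS natrD natrX; congr (G _ * _); field; rewrite ?n0 ?t0.
Qed.

(** Opposite edges are summed in the same direction from corresponding corners, so the two copies of
    each inner edge cancel exactly, left end points included. *)
Lemma rect_sumS G n z p q : rect_sum G n.+1 z p q =
  rect_sum G n z (p / 2) (q / 2) + rect_sum G n (z + p / 2) (p / 2) (q / 2)
  + rect_sum G n (z + q / 2) (p / 2) (q / 2)
  + rect_sum G n (z + p / 2 + q / 2) (p / 2) (q / 2).
Proof.
have half x y : x + y / 2 + y / 2 = x + y :> C by field; rewrite ?pnatr_eq0.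
rewrite /rect_sum !edge_sumS.
rewrite (_ : z + p + q / 2 = z + p / 2 + q / 2 + p / 2); last by field; rewrite ?pnatr_eq0.
rewrite (_ : z + q + p / 2 = z + p / 2 + q / 2 + q / 2); last by field; rewrite ?pnatr_eq0.
rewrite (_ : z + q / 2 + p / 2 = z + p / 2 + q / 2); last by rewrite addrAC.
rewrite (half z p) (half z q).
set a := z + p / 2; set b := z + q / 2; set c := _ + q / 2.
ring.
Qed.

Lemma sum_nat_half (m : nat) :
  \sum_(0 <= j < m) (j%:R : C) = m%:R * (m%:R - 1) / 2.
Proof.
elim: m => [|m IH]; first by rewrite big_nil !mul0r.
by rewrite big_nat_recr //= IH -natr1; field; rewrite ?pnatr_eq0.
Qed.

Lemma edge_sum_affine (A D : C) n z p :
  edge_sum (fun s => A + D * s) n z p =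
  (A + D * z) * p + D * p ^+ 2 * (1 - (2 ^+ n)^-1) / 2.
Proof.
have n0 := two_neq0 n; have t0 : (2 : C) != 0 by rewrite pnatr_eq0.
rewrite /edge_sum -mulr_suml.
under eq_bigr do rewrite mulrDr addrA mulrCA mulrA -mulrA.
rewrite big_split /= sumr_const_nat subn0 -[X in X + _]mulr_natl natrX.
under [X in _ + X]eq_bigr do rewrite -mulrA.
by rewrite -mulr_suml sum_nat_half natrX; field; rewrite ?n0 ?t0.
Qed.

(** The left-endpoint error in [edge_sum_affine] depends on the edge vector only, not on the base
    point, so it cancels between opposite edges at every level n. *)
Lemma rect_sum_affine (A D : C) n z p q :
  rect_sum (fun s => A + D * s) n z p q = 0.
Proof.
rewrite /rect_sum !edge_sum_affine; ring.
Qed.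

Lemma edge_sumD G1 G2 n z p :
  edge_sum (fun s => G1 s + G2 s) n z p = edge_sum G1 n z p + edge_sum G2 n z p.
Proof. by rewrite /edge_sum -big_split; apply: eq_bigr => j _; rewrite mulrDl. Qed.

Lemma rect_sumD G1 G2 n z p q :
  rect_sum (fun s => G1 s + G2 s) n z p q = rect_sum G1 n z p q + rect_sum G2 n z p q.
Proof. by rewrite /rect_sum !edge_sumD; ring. Qed.

Definition in_rect z p q s := exists a b : R,
  [/\ 0 <= a <= 1, 0 <= b <= 1 & s = z + a%:C * p + b%:C * q].

Lemma frac_itv n j : (j < 2 ^ n)%N -> 0 <= (j%:R / 2 ^+ n : R) <= 1.
Proof.
move=> h; rewrite divr_ge0 ?exprn_ge0 // ler_pdivrMr ?exprn_gt0 // mul1r.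
by rewrite -natrX ler_nat ltnW.
Qed.

Lemma natfracC n j : j%:R / 2 ^+ n = (j%:R / 2 ^+ n : R)%:C :> C.
Proof. by rewrite fmorph_div rmorphXn !rmorph_nat. Qed.

Lemma cabs_edge_sum G n z p (e : R) :
  (forall a : R, 0 <= a <= 1 -> cabs (G (z + a%:C * p)) <= e) ->
  cabs (edge_sum G n z p) <= e * cabs p.
Proof.
move=> h; apply: (le_trans (cabs_sum _ _ _)).
have -> : e * cabs p = \sum_(0 <= j < 2 ^ n) (e * (cabs p / 2 ^+ n)).
  by rewrite sumr_const_nat subn0 -[_ *+ (2 ^ n)]mulr_natr natrX; field; rewrite expf_neq0 // pnatr_eq0.
rewrite big_nat [X in _ <= X]big_nat; apply: ler_sum => j /andP[_ lej].
rewrite !cabsM cabsV cabsX cabs_nat natfracC; apply: ler_wpM2r.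
  by rewrite divr_ge0 ?cabs_ge0 ?exprn_ge0.
exact/h/frac_itv.
Qed.

Lemma cabs_rect_sum G n z p q (e : R) :
  (forall s, in_rect z p q s -> cabs (G s) <= e) ->
  cabs (rect_sum G n z p q) <= e * 2 * (cabs p + cabs q).
Proof.
move=> h; rewrite /rect_sum.
have i0 : 0 <= (0 : R) <= 1 by rewrite lexx ler01.
have i1 : 0 <= (1 : R) <= 1 by rewrite lexx ler01.
have h1 : cabs (edge_sum G n z p) <= e * cabs p.
  by apply: cabs_edge_sum => a a01; apply: h; exists a, 0; split => //; rewrite mul0r addr0.
have h2 : cabs (edge_sum G n (z + p) q) <= e * cabs q.
  by apply: cabs_edge_sum => a a01; apply: h; exists 1, a; split => //; rewrite mul1r.
have h3 : cabs (edge_sum G n (z + q) p) <= e * cabs p.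
  apply: cabs_edge_sum => a a01; apply: h; exists a, 1; split => //.
  by rewrite mul1r addrAC.
have h4 : cabs (edge_sum G n z q) <= e * cabs q.
  by apply: cabs_edge_sum => a a01; apply: h; exists 0, a; split => //; rewrite mul0r addr0.
have := le_cabsB (edge_sum G n z p + edge_sum G n (z + p) q - edge_sum G n (z + q) p)
  (edge_sum G n z q).
have := le_cabsB (edge_sum G n z p + edge_sum G n (z + p) q) (edge_sum G n (z + q) p).
have := le_cabsD (edge_sum G n z p) (edge_sum G n (z + p) q).
lra.
Qed.

(** The tangent affine map at s contributes nothing; the remainder is at most e times the size of
    the rectangle. The resulting square decays like 4^-m under bisection, as fast as the threshold
    does. *)
Lemma cabs_rect_sum_cdiff G s D (e d : R) :
  (forall h, cabs h < d -> cabs (G (s + h) - G s - D * h) <= e * cabs h) ->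
  0 <= e -> forall n z p q,
  (forall t, in_rect z p q t -> cabs (t - s) <= cabs p + cabs q) ->
  cabs p + cabs q < d ->
  cabs (rect_sum G n z p q) <= e * 2 * (cabs p + cabs q) ^+ 2.
Proof.
move=> hD e0 n z p q hs hd.
have -> : rect_sum G n z p q =
    rect_sum (fun t => (G s - D * s + D * t) + (G t - G s - D * (t - s))) n z p q.
  by congr (rect_sum _ n z p q); apply/funext => t; ring.
rewrite rect_sumD rect_sum_affine add0r expr2 mulrA [e * 2 * _]mulrAC.
apply: cabs_rect_sum => t /hs ht.
have := hD (t - s) (le_lt_trans ht hd); rewrite (_ : s + (t - s) = t); last by ring.
move=> /le_trans; apply.
exact: ler_wpM2l.
Qed.

Let bad G z p q (c : R) := forall n0, exists2 n, (n0 <= n)%N & c < cabs (rect_sum G n z p q).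

(** If all four quarters were eventually at most c / 4, [rect_sumS] would bound the whole by c
    eventually. This is why [bad] asks for arbitrarily large n and not for all n. *)
Lemma bad_quarter G z p q c : bad G z p q c ->
  exists ab : bool * bool,
    bad G (z + ab.1%:R%:C * (p / 2) + ab.2%:R%:C * (q / 2)) (p / 2) (q / 2) (c / 4).
Proof.
move=> hbad; apply: contrapT => hno.
have hn (ab : bool * bool) : exists n0, forall n, (n0 <= n)%N ->
    cabs (rect_sum G n (z + ab.1%:R%:C * (p / 2) + ab.2%:R%:C * (q / 2)) (p / 2) (q / 2))
      <= c / 4.
  apply: contrapT => hno'; apply: hno; exists ab => n0; apply: contrapT => hno2.
  apply: hno'; exists n0 => n hn; rewrite leNgt; apply/negP => hlt; apply: hno2.
  by exists n.
have [n1 h1] := hn (false, false); have [n2 h2] := hn (true, false).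
have [n3 h3] := hn (false, true); have [n4 h4] := hn (true, true).
(* The sum exceeds all four thresholds; the successor pays for the level that [rect_sumS]
   consumes. *)
have [n] := hbad (n1 + n2 + n3 + n4).+1.
case: n => // n; rewrite ltnS => hle; rewrite ltNge => /negP; apply.
have := h1 n ltac:(lia); have := h2 n ltac:(lia); have := h3 n ltac:(lia).
have := h4 n ltac:(lia).
rewrite /= !mul0r !addr0 !mul1r rect_sumS.
have tri (x y t w : C) : cabs (x + y + t + w) <= cabs x + cabs y + cabs t + cabs w.
  by do 2![apply: le_trans (le_cabsD _ _) _; rewrite lerD2r]; exact: le_cabsD.
move=> h1' h2' h3' h4'; apply: (le_trans (tri _ _ _ _)); lra.
Qed.

(** The intervals [a m, a m + 2^-m] are nested, and the supremum of their left end points lies in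
    all of them. *)
Lemma dyadic_limit (a : nat -> R) :
  (forall m, a m <= a m.+1 <= a m + (2 ^+ m.+1)^-1) ->
  exists l, forall m, a m <= l <= a m + (2 ^+ m)^-1.
Proof.
move=> ha.
have mono m k : a m <= a (m + k)%N.
  elim: k => [|k IH]; first by rewrite addn0.
  by rewrite addnS (le_trans IH) //; case/andP: (ha (m + k)%N).
have anti m k : a (m + k)%N + (2 ^+ (m + k))^-1 <= a m + (2 ^+ m)^-1.
  elim: k => [|k IH]; first by rewrite addn0.
  apply: le_trans IH; rewrite addnS; have /andP[_] := ha (m + k)%N.
  rewrite -(lerD2r (2 ^+ (m + k).+1)^-1) => /le_trans; apply.
  by rewrite -addrA lerD2l exprS invfM; lra.
have ub m k : a k <= a m + (2 ^+ m)^-1.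
  have [/subnKC h|/ltnW /subnKC h] := leqP m k.
    have := anti m (k - m)%N; rewrite h; apply: le_trans.
    by rewrite lerDl invr_ge0 exprn_ge0.
  have := mono k (m - k)%N; rewrite h => /le_trans; apply.
  by rewrite lerDl invr_ge0 exprn_ge0.
have hs : has_sup (range a).
  by split; [exists (a 0%N), 0%N|exists (a 0%N + (2 ^+ 0)^-1) => _ [k _ <-]].
exists (sup (range a)) => m; apply/andP; split.
  by apply: (ub_le_sup hs.2); exists m.
by apply: ge_sup => [|_ [k _ <-]]; first by exists (a 0%N), 0%N.
Qed.

(** Bisection produces nested rectangles with sums above e / 4^m for suitable n. At their common
    point G has a linear approximation, which forces the sums below that threshold once m is
    large. *)
Lemma goursat G z p q : (forall s, in_rect z p q s -> cdiff G s) ->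
  forall e : R, 0 < e -> exists n0, forall n, (n0 <= n)%N -> cabs (rect_sum G n z p q) <= e.
Proof.
move=> hG e e0; apply: contrapT => hno.
have bad0 : bad G z p q e.
  move=> n0; apply: contrapT => h; apply: hno; exists n0 => n hn; rewrite leNgt.
  by apply/negP => hlt; apply: h; exists n.
pose corner (ab : R * R) := z + ab.1%:C * p + ab.2%:C * q.
pose P (m : nat) (ab : R * R) := bad G (corner ab) (p / 2 ^+ m) (q / 2 ^+ m) (e / 4 ^+ m).
pose next (m : nat) (ab : R * R) (xy : bool * bool) : R * R :=
  (ab.1 + xy.1%:R / 2 ^+ m.+1, ab.2 + xy.2%:R / 2 ^+ m.+1).
(* The implication is put under the existential, with an arbitrary quarter where [P] fails, so that
   [choice] yields a total selection. *)
have step (mab : nat * (R * R)) : exists xy : bool * bool,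
    P mab.1 mab.2 -> P mab.1.+1 (next mab.1 mab.2 xy).
  case: mab => m ab /=; have [/bad_quarter[xy hxy]|] := pselect (P m ab); last first.
    by exists (false, false).
  exists xy => _; rewrite /P.
  have n0 := two_neq0 m; have t0 : (2 : C) != 0 by rewrite pnatr_eq0.
  have -> : corner (next m ab xy) = corner ab + (xy.1%:R)%:C * (p / 2 ^+ m / 2)
      + (xy.2%:R)%:C * (q / 2 ^+ m / 2).
    rewrite /corner /next /= !rmorphD !fmorph_div !rmorphXn !rmorph_nat exprS.
    by field; rewrite ?n0 ?t0.
  by move: hxy; rewrite !exprSr !invfM !mulrA.
have [f hf] := choice step.
pose u := fix u m : R * R := if m is k.+1 then next k (u k) (f (k, u k)) else (0, 0).
have Pu m : P m (u m).
  elim: m => [|m IH]; last exact: (hf (m, u m)).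
  by rewrite /P /corner /= !mul0r !addr0 !expr0 !divr1.
have bit (b : bool) m : 0 <= (b%:R : R) / 2 ^+ m.+1 <= (2 ^+ m.+1)^-1.
  by case: b; rewrite ?mul1r ?mul0r ?lexx ?invr_ge0 exprn_ge0.
have [al hal] : exists l, forall m, (u m).1 <= l <= (u m).1 + (2 ^+ m)^-1.
  by apply: dyadic_limit => m /=; rewrite lerDl lerD2l; exact: bit.
have [be hbe] : exists l, forall m, (u m).2 <= l <= (u m).2 + (2 ^+ m)^-1.
  by apply: dyadic_limit => m /=; rewrite lerDl lerD2l; exact: bit.
have [D hD] : cdiff G (corner (al, be)).
  apply: hG; exists al, be; split => //.
    by have := hal 0%N; rewrite /= expr0 invr1 add0r.
  by have := hbe 0%N; rewrite /= expr0 invr1 add0r.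
pose S := cabs p + cabs q.
have S0 : 0 <= S by rewrite addr_ge0 ?cabs_ge0.
(* The 2 cancels that of [cabs_rect_sum_cdiff]; S + 1 replaces S because S vanishes for a degenerate
   rectangle. *)
have [|d d0 hd] := hD (e / (2 * (S + 1) ^+ 2)).
  by rewrite divr_gt0 // mulr_gt0 // exprn_gt0 // ltr_wpDl.
have S1 : 0 < S + 1 by rewrite ltr_wpDl.
have [m hm] : exists m, S / 2 ^+ m < d.
  have [m hm] : exists m : nat, S / d < m%:R.
    by exists (Num.bound (S / d)); rewrite archi_boundP ?divr_ge0 ?(ltW d0).
  exists m; rewrite ltr_pdivrMr ?exprn_gt0 // mulrC -ltr_pdivrMr //.
  by rewrite (lt_trans hm) // -natrX ltr_nat ltn_expl.
have cp (t : C) : cabs (t / 2 ^+ m) = cabs t / 2 ^+ m.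
  by rewrite cabsM cabsV cabsX cabs_nat.
have [n _] := Pu m 0%N; rewrite ltNge => /negP; apply.
have -> : e / 4 ^+ m = e / (S + 1) ^+ 2 * ((S + 1) / 2 ^+ m) ^+ 2.
  rewrite expr_div_n -exprM mulnC exprM -[2 ^+ 2]natrX; field.
  by rewrite expf_neq0 ?pnatr_eq0 // gt_eqF.
apply: (le_trans (@cabs_rect_sum_cdiff _ _ _ _ _ hd _ n _ _ _ _ _)).
- by rewrite divr_ge0 ?ltW // mulr_gt0 // exprn_gt0.
- move=> t [a [b [/andP[a0 a1] /andP[b0 b1] ->]]].
  rewrite (_ : _ - _ = ((u m).1 - al + a / 2 ^+ m)%:C * p + ((u m).2 - be + b / 2 ^+ m)%:C * q).
    apply: (le_trans (le_cabsD _ _)); rewrite !cp !cabsM !cabsR.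
    have t0 : 0 < (2 ^+ m : R)^-1 by rewrite invr_gt0 exprn_gt0.
    have hh (x y w : R) : x <= y <= x + (2 ^+ m)^-1 -> 0 <= w -> w <= 1 ->
        `|x - y + w / 2 ^+ m| <= (2 ^+ m)^-1.
      move=> /andP[xy yx] w0 w1; rewrite ler_norml.
      have : w / 2 ^+ m <= (2 ^+ m)^-1 by rewrite ger_pMl.
      have : 0 <= w / 2 ^+ m by rewrite mulr_ge0 // ltW.
      by move=> *; apply/andP; split; lra.
    by apply: lerD; rewrite mulrC; apply: ler_wpM2l; rewrite ?cabs_ge0 //; apply: hh.
  rewrite /corner /= !rmorphD !rmorphN !fmorph_div !rmorphXn !rmorph_nat.
  by field; rewrite two_neq0.
- by rewrite !cp -mulrDl.
rewrite !cp -mulrDl -/S.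
have -> : e / (2 * (S + 1) ^+ 2) * 2 = e / (S + 1) ^+ 2.
  by field; rewrite gt_eqF.
apply: ler_wpM2l; first by rewrite divr_ge0 ?ltW // exprn_gt0.
by rewrite lerXn2r ?nnegrE ?divr_ge0 ?exprn_ge0 ?(ltW S1) // ler_wpM2r ?invr_ge0 ?exprn_ge0 // lerDl.
Qed.

End Goursat.

(** * The complex exponential and its derivative *)

Lemma derivable_approx (K : numFieldType) (V W : normedModType K) (f : V -> W) (a v : V) :
  derivable f a v -> forall e : K, 0 < e ->
  \forall h \near (0 : K), `|f (h *: v + a) - f a - h *: 'D_v f a| <= e * `|h|.
Proof.
move=> /derivable_nbhs /eqaddoP df e e0; have := df e e0.
apply: filterS => h /=; rewrite !fctE /= opprD addrA; exact.
Qed.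

Section Cexp.
Variable R : realType.
Local Notation C := R[i].
Implicit Types (z s : C) (x : R).

Lemma real_derive_approx (f : R -> R) (x D : R) : is_derive x 1 f D ->
  forall e, 0 < e -> exists2 d, 0 < d &
  forall h, `|h| < d -> `|f (x + h) - f x - D * h| <= e * `|h|.
Proof.
move=> [df <-] e e0; have /nbhs_ballP[d /= d0 hd] := derivable_approx df e0.
exists d => // h hh; have := hd h; rewrite /ball /= sub0r normrN => /(_ hh).
by rewrite [h *: 1]mulr1 [h + x]addrC [h *: _]mulrC.
Qed.

Lemma cexp0 : cexp (0 : C) = 1.
Proof. by rewrite /cexp /= expR0 cos0 sin0 mul1r. Qed.

Lemma cexpD z1 z2 : cexp (z1 + z2) = cexp z1 * cexp z2.
Proof.
case: z1 z2 => [a b] [c d]; rewrite /cexp /= expRD cosD sinD.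
by apply/eqP; rewrite eq_complex /=; apply/andP; split; apply/eqP; ring.
Qed.

Lemma cabs_cexp z : cabs (cexp z) = expR (Re z).
Proof.
by rewrite /cexp cabsM cabsR ger0_norm ?expR_ge0 //= cos2Dsin2 sqrtr1 mulr1.
Qed.

Lemma cexp_neq0 z : cexp z != 0.
Proof. by rewrite -cabs_eq0 cabs_cexp expR_eq0. Qed.

Lemma cexpN z : cexp (- z) = (cexp z)^-1.
Proof. by apply: (mulfI (cexp_neq0 z)); rewrite -cexpD subrr cexp0 divff ?cexp_neq0. Qed.

Lemma cexpMn z n : cexp (n%:R * z) = cexp z ^+ n.
Proof.
elim: n => [|n IH]; first by rewrite mul0r cexp0.
by rewrite -natr1 mulrDl mul1r cexpD IH exprSr.
Qed.

Lemma cexp_near0 (e : R) : 0 < e -> exists2 d, 0 < d &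
  forall h : C, cabs h < d -> cabs (cexp h - 1 - h) <= e * cabs h.
Proof.
(* The real and imaginary parts of the remainder cost 3 and 4 times e1 |h|, within the 10 available;
   the minimum with 1 keeps e1 <= 1 / 10, which is used for |exp a| <= 2. *)
move=> e0; pose e1 := Num.min e 1 / 10.
have e10 : 0 < e1 by rewrite divr_gt0 // lt_min e0 ltr01.
have e1e : 10 * e1 <= e by rewrite /e1 mulrC divfK // ge_min lexx.
have e11 : 10 * e1 <= 1 by rewrite /e1 mulrC divfK // ge_min lexx orbT.
have [d1 d10 h1] := real_derive_approx (is_derive_expR (0 : R)) e10.
have [d2 d20 h2] := real_derive_approx (is_derive_cos (0 : R)) e10.
have [d3 d30 h3] := real_derive_approx (is_derive_sin (0 : R)) e10.
exists (Num.min (Num.min d1 d2) (Num.min d3 e1)); first by rewrite !lt_min d10 d20 d30 e10.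
move=> [a b]; rewrite !lt_min => /andP[/andP[ha hb] /andP[hc hd]].
apply: (le_trans (cabs_le_ReIm _)).
have [hRe hIm] := (Re_le_cabs (a +i* b), Im_le_cabs (a +i* b)); move: hRe hIm.
set n := cabs _ in ha hb hc hd * => /= hRe hIm.
have := h1 a (le_lt_trans hRe ha); have := h2 b (le_lt_trans hIm hb).
have := h3 b (le_lt_trans hIm hc).
rewrite !add0r cos0 sin0 oppr0 expR0 !mul0r !mul1r !subr0 addr0 => hs hco hex.
set E := expR a in hex *; set c := cos b in hco *; set s := sin b in hs *.
have {}hs : `|s - b| <= e1 * n by apply: (le_trans hs); rewrite ler_pM2l.
have {}hco : `|c - 1| <= e1 * n by apply: (le_trans hco); rewrite ler_pM2l.
have {}hex : `|E - 1 - a| <= e1 * n by apply: (le_trans hex); rewrite ler_pM2l.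
have n0 : 0 <= n by exact: cabs_ge0.
have c1 : `|c| <= 1 by exact: cos_max.
have E1 : `|E - 1| <= 2 * e1.
  have := ler_normD (E - 1 - a) a; rewrite subrK => /le_trans; apply.
  have : e1 * n <= e1 * 1 by rewrite ler_pM2l //; lra.
  lra.
have E2 : `|E| <= 2.
  have := ler_normD (E - 1) 1; rewrite subrK normr1 => /le_trans; apply; lra.
rewrite (_ : `|_ - 1 - a| = `|(E - 1 - a) + E * (c - 1)|); last by congr (`|_|); ring.
rewrite (_ : `|_ - b| = `|E * (s - b) + (E - 1) * b|); last by congr (`|_|); ring.
have k1 : `|E * (c - 1)| <= 2 * (e1 * n) by rewrite normrM ler_pM.
have k2 : `|E * (s - b)| <= 2 * (e1 * n) by rewrite normrM ler_pM.
have k3 : `|(E - 1) * b| <= 2 * e1 * n by rewrite normrM ler_pM.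
have := ler_normD (E - 1 - a) (E * (c - 1)).
have := ler_normD (E * (s - b)) ((E - 1) * b).
have : 10 * (e1 * n) <= e * n by rewrite mulrA ler_wpM2r.
have : 0 <= e1 * n by rewrite mulr_ge0 // ltW.
lra.
Qed.

Lemma cdiff_cexp z : cdiff (@cexp R) z.
Proof.
exists (cexp z) => e e0.
have nz : 0 < cabs (cexp z) by rewrite cabs_cexp expR_gt0.
have [|d d0 hd] := @cexp_near0 (e / cabs (cexp z)); first by rewrite divr_gt0.
exists d => // h /hd hh; rewrite cexpD.
rewrite (_ : _ - _ - _ = cexp z * (cexp h - 1 - h)); last by ring.
by rewrite cabsM mulrC -ler_pdivlMr // mulrAC.
Qed.

End Cexp.

(** * Calculus rules for complex differentiability *)

Section Cdiff.
Variable R : realType.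
Local Notation C := R[i].
Implicit Types (G F : C -> C) (s : C).

Lemma cdiff_cont G s : cdiff G s -> forall e : R, 0 < e ->
  exists2 d : R, 0 < d & forall h, cabs h < d -> cabs (G (s + h) - G s) <= e.
Proof.
move=> [D hD] e e0; have [d d0 hd] := hD 1 ltr01.
have c0 : 0 < 1 + cabs D by rewrite ltr_wpDr ?cabs_ge0.
exists (Num.min d (e / (1 + cabs D))); first by rewrite lt_min d0 divr_gt0.
move=> h; rewrite lt_min => /andP[/hd h1 h2].
have := le_cabsD (G (s + h) - G s - D * h) (D * h); rewrite subrK => /le_trans; apply.
move: h2; rewrite ltr_pdivlMr // => /ltW h2; rewrite cabsM.
have := cabs_ge0 h; nra.
Qed.

Lemma cdiff_comp F G s : cdiff G s -> cdiff F (G s) -> cdiff (fun t => F (G t)) s.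
Proof.
move=> hG hF; have [D hD] := hG; have [E hE] := hF; exists (E * D) => e e0.
have [eD eE] := (cabs_ge0 D, cabs_ge0 E).
have E1 : 0 < 2 * (cabs E + 1) by rewrite mulr_gt0 // ltr_wpDl.
have D1 : 0 < 2 * (cabs D + 1) by rewrite mulr_gt0 // ltr_wpDl.
(* The remainder of F costs e3 (|D| + 1) |h|, and E times the remainder of G costs at most (|E| + 1)
   e1 |h|; each is e / 2 |h|. *)
pose e1 := e / (2 * (cabs E + 1)); pose e3 := e / (2 * (cabs D + 1)).
have e10 : 0 < e1 by rewrite divr_gt0.
have e30 : 0 < e3 by rewrite divr_gt0.
have e1E : 2 * (e1 * (cabs E + 1)) = e by rewrite mulrCA divfK // gt_eqF.
have e3E : 2 * (e3 * (cabs D + 1)) = e by rewrite mulrCA divfK // gt_eqF.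
have [d1 d10 h1] := hD _ e10.
have [d2 d20 h2] := hD 1 ltr01.
have [d3 d30 h3] := hE _ e30.
have [d4 d40 h4] := cdiff_cont hG (divr_gt0 d30 (ltr0Sn R 1)).
exists (Num.min (Num.min d1 d2) d4); first by rewrite !lt_min d10 d20.
move=> h; rewrite !lt_min => /andP[/andP[/h1 k1 /h2 k2] /h4 k4].
set g := G (s + h) - G s in k1 k2 k4.
have /h3 : cabs g < d3 by apply: (le_lt_trans k4); lra.
rewrite /g [G s + _]addrC subrK -/g => k3.
rewrite (_ : _ - _ - _ = (F (G (s + h)) - F (G s) - E * g) + E * (g - D * h)); last by ring.
apply: (le_trans (le_cabsD _ _)).
have g1 : cabs g <= (cabs D + 1) * cabs h.
  have := le_cabsD (g - D * h) (D * h); rewrite subrK cabsM => /le_trans; apply.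
  by rewrite mulrDl addrC lerD2l.
have h0 := cabs_ge0 h.
have k5 : cabs (F (G (s + h)) - F (G s) - E * g) <= e3 * ((cabs D + 1) * cabs h).
  by apply: (le_trans k3); rewrite ler_pM2l.
have k6 : cabs (E * (g - D * h)) <= (cabs E + 1) * (e1 * cabs h).
  by rewrite cabsM ler_pM ?cabs_ge0 // lerDl.
apply: (le_trans (lerD k5 k6)).
have -> : e3 * ((cabs D + 1) * cabs h) = e / 2 * cabs h by rewrite mulrA -e3E; field.
have -> : (cabs E + 1) * (e1 * cabs h) = e / 2 * cabs h by rewrite -e1E; field.
lra.
Qed.

Lemma cdiffD F G s : cdiff F s -> cdiff G s -> cdiff (fun t => F t + G t) s.
Proof.
move=> [D hD] [E hE]; exists (D + E) => e e0.
have e20 : 0 < e / 2 by rewrite divr_gt0.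
have [d1 d10 h1] := hD _ e20; have [d2 d20 h2] := hE _ e20.
exists (Num.min d1 d2); first by rewrite lt_min d10.
move=> h; rewrite lt_min => /andP[/h1 k1 /h2 k2].
rewrite (_ : _ - _ - _ = (F (s + h) - F s - D * h) + (G (s + h) - G s - E * h)); last by ring.
apply: (le_trans (le_cabsD _ _)); lra.
Qed.

Lemma cdiff_cst (c : C) s : cdiff (fun=> c) s.
Proof.
exists 0 => e e0; exists 1 => // h _; rewrite subrr mul0r subr0 cabs0.
by rewrite mulr_ge0 ?cabs_ge0 // ltW.
Qed.

Lemma cdiff_mulid (c : C) s : cdiff (fun t => c * t) s.
Proof.
exists c => e e0; exists 1 => // h _; rewrite (_ : _ - _ - _ = 0) ?cabs0; last by ring.
by rewrite mulr_ge0 ?cabs_ge0 // ltW.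
Qed.

Lemma cdiffM F G s : cdiff F s -> cdiff G s -> cdiff (fun t => F t * G t) s.
Proof.
move=> hF hG; have [D hD] := hF; have [E hE] := hG.
exists (D * G s + F s * E) => e e0.
(* M dominates the cofactors |G (s + h)| <= |G s| + 1, |D| and |F s| of the three terms below, so
   each term takes a third of e. *)
pose M := cabs (G s) + cabs (F s) + cabs D + 2.
have M0 : 0 < M by rewrite /M ltr_wpDl // !addr_ge0 ?cabs_ge0.
have e20 : 0 < e / M / 3 by rewrite !divr_gt0.
have [d1 d10 h1] := hD _ e20; have [d2 d20 h2] := hE _ e20.
have [d3 d30 h3] := cdiff_cont hG e20.
have [d4 d40 h4] := cdiff_cont hG ltr01.
exists (Num.min (Num.min d1 d2) (Num.min d3 d4)); first by rewrite !lt_min d10 d20 d30.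
move=> h; rewrite !lt_min => /andP[/andP[/h1 k1 /h2 k2] /andP[/h3 k3 /h4 k4]].
have h0 := cabs_ge0 h.
set e2 := e / M / 3 in k1 k2 k3.
rewrite (_ : _ - _ - _ = (F (s + h) - F s - D * h) * G (s + h)
  + D * h * (G (s + h) - G s) + F s * (G (s + h) - G s - E * h)); last by ring.
have k5 : cabs (G (s + h)) <= cabs (G s) + 1.
  by have := le_cabsD (G (s + h) - G s) (G s); rewrite subrK => /le_trans; apply; lra.
apply: (le_trans (le_cabsD _ _)).
have -> : e * cabs h = e2 * cabs h * M + e2 * cabs h * M + e2 * cabs h * M.
  by rewrite /e2; field; rewrite gt_eqF.
have e2h : 0 <= e2 * cabs h by rewrite mulr_ge0 // ltW.
have [[gs fs] ds] := (cabs_ge0 (G s), cabs_ge0 (F s), cabs_ge0 D).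
apply: lerD; [apply: (le_trans (le_cabsD _ _)); apply: lerD|]; rewrite !cabsM.
- by apply: ler_pM; rewrite ?cabs_ge0 // /M; lra.
- rewrite (_ : e2 * cabs h * M = M * cabs h * e2); last by ring.
  apply: ler_pM; rewrite ?mulr_ge0 ?cabs_ge0 //; apply: ler_wpM2r => //; rewrite /M; lra.
- rewrite mulrC; apply: ler_pM; rewrite ?cabs_ge0 // /M; lra.
Qed.

End Cdiff.

(** * Cosines and trapezoidal means *)

Section Cis.
Variable R : realType.
Local Notation C := R[i].
Implicit Types (G : C -> C) (s : C) (x : R).

Definition cis s : C := cexp (iC * s).

(** This is cos (k s), written in powers of [cis] so that its identities become identities between
    powers. *)
Definition ck (k : nat) s : C := (cis s ^+ k + cis (- s) ^+ k) / 2.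

Lemma cis0 : cis 0 = 1.
Proof. by rewrite /cis mulr0 cexp0. Qed.

Lemma cisD s t : cis (s + t) = cis s * cis t.
Proof. by rewrite /cis mulrDr cexpD. Qed.

Lemma cisN s : cis (- s) = (cis s)^-1.
Proof. by rewrite /cis mulrN cexpN. Qed.

Lemma cis_neq0 s : cis s != 0.
Proof. exact: cexp_neq0. Qed.

Lemma cisM s n : cis (n%:R * s) = cis s ^+ n.
Proof. by rewrite /cis mulrCA cexpMn. Qed.

Lemma cabs_cis s : cabs (cis s) = expR (- Im s).
Proof. by rewrite /cis cabs_cexp; case: s => a b /=; rewrite mul0r mul1r sub0r. Qed.

Lemma cabs_cisX s k : cabs (cis s ^+ k) = expR (- (k%:R * Im s)).
Proof. by rewrite cabsX cabs_cis -expRM_natl mulrN. Qed.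

Lemma cisR x : cis x%:C = cos x +i* sin x.
Proof. by rewrite /cis /cexp /= !mul0r !mul1r subr0 add0r expR0 mul1r. Qed.

Lemma cis_2pi : cis (2 * pi : R)%:C = 1.
Proof. by rewrite cisR mulr_natl cos2pi sin2pi. Qed.

Lemma cdiff_cis s : cdiff cis s.
Proof. by apply: cdiff_comp; [exact: cdiff_mulid|exact: cdiff_cexp]. Qed.

Lemma cdiff_cisN s : cdiff (fun t => cis (- t)) s.
Proof.
apply: (@cdiff_comp _ cis (fun t => - t)); last exact: cdiff_cis.
rewrite (_ : (fun t => - t) = (fun t => -1 * t)); first exact: cdiff_mulid.
by apply/funext => t; rewrite mulN1r.
Qed.

Lemma cdiffX G s k : cdiff G s -> cdiff (fun t => G t ^+ k) s.
Proof.
move=> hG; elim: k => [|k IH]; first by under eq_fun do rewrite expr0; exact: cdiff_cst.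
by under eq_fun do rewrite exprS; exact: cdiffM.
Qed.

Lemma ccosE s : ccos s = (cis s + cis (- s)) / 2.
Proof. by rewrite /ccos /cis mulrN. Qed.

Lemma ccosN s : ccos (- s) = ccos s.
Proof. by rewrite !ccosE opprK addrC. Qed.

Lemma ccosD2pi s : ccos (s + (2 * pi)%:C) = ccos s.
Proof.
by rewrite !ccosE opprD !cisD [cis (- _%:C)]cisN cis_2pi invr1 !mulr1.
Qed.

Lemma cdiff_ccos s : cdiff (@ccos R) s.
Proof.
rewrite (_ : @ccos R = fun t => (cis t + cis (- t)) * (2^-1)).
  by apply: cdiffM; [apply: cdiffD; [exact: cdiff_cis|exact: cdiff_cisN]|exact: cdiff_cst].
by apply/funext => t; rewrite ccosE.
Qed.

Lemma ckN k s : ck k (- s) = ck k s.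
Proof. by rewrite /ck opprK addrC. Qed.

Lemma ck0 s : ck 0 s = 1.
Proof. by rewrite /ck !expr0 divff ?pnatr_eq0. Qed.

(** The right side is cosh (k |Im s|). This precision, compared with [cabs_ck], is what the norm of
    the interpolation operator requires. *)
Lemma cabs_ck_le k s : cabs (ck k s) <= (expR (k%:R * `|Im s|) + expR (- (k%:R * `|Im s|))) / 2.
Proof.
rewrite /ck cabsM cabsV cabs_nat; apply: ler_wpM2r; first by rewrite invr_ge0.
apply: (le_trans (le_cabsD _ _)); rewrite !cabs_cisX.
have -> : Im (- s) = - Im s by case: s.
by case: (ger0P (Im s)) => _; rewrite !mulrN opprK addrC.
Qed.

Lemma cabs_ck k s : cabs (ck k s) <= expR (k%:R * `|Im s|).
Proof.
apply: (le_trans (cabs_ck_le k s)); rewrite ler_pdivrMr // mulr_natr mulr2n lerD2l ler_expR.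
have : 0 <= k%:R * `|Im s| by rewrite mulr_ge0.
lra.
Qed.

(** cos x = 1 would force sin (x / 2) = 0 by the double angle formula, while x / 2 lies strictly
    between 0 and pi. *)
Lemma cis_neq1 x : 0 < x < 2 * pi -> cis x%:C != 1.
Proof.
move=> /andP[x0 x1]; rewrite cisR; apply/eqP => -[hc hs].
have := cos_mulr2n (x / 2); rewrite -[x / 2 *+ 2]mulr_natr divfK ?pnatr_eq0 // hc => h.
have : sin (x / 2) ^+ 2 = 0.
  by rewrite sin2cos2; move: h; rewrite -mulr_natl; lra.
move/eqP; rewrite expf_eq0 /= => /eqP h0.
have : 0 < sin (x / 2) by apply: sin_gt0_pi; apply/andP; split; lra.
by rewrite h0 ltxx.
Qed.

Lemma geometric_root (z : C) N : z ^+ N = 1 -> z != 1 -> \sum_(0 <= j < N) z ^+ j = 0.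
Proof.
move=> zN z1; have /eqP := subrX1 z N.
by rewrite zN subrr eq_sym mulf_eq0 subr_eq0 (negbTE z1) big_mkord => /eqP.
Qed.

Definition grid (N j : nat) : R := 2 * pi * j%:R / N%:R.

(** The trapezoidal rule with N points for the mean of G over one period of the horizontal line
    through s. *)
Definition gmean (N : nat) G s : C := (\sum_(0 <= j < N) G (s + (grid N j)%:C)) / N%:R.

Lemma cis_grid N j : cis (grid N j)%:C = cis (grid N 1)%:C ^+ j.
Proof.
rewrite -cisM; congr cis; rewrite /grid -[j%:R in RHS](rmorph_nat (real_complex R)).
by rewrite -rmorphM; congr (_%:C); rewrite mulr1; ring.
Qed.

Lemma cis_gridN N : (0 < N)%N -> cis (grid N 1)%:C ^+ N = 1.
Proof.
by move=> N0; rewrite -cis_grid /grid mulfK ?pnatr_eq0 -?lt0n // cis_2pi.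
Qed.

Lemma cis_grid_eq1 N j : (0 < N)%N -> (cis (grid N 1)%:C ^+ j == 1) = (N %| j)%N.
Proof.
move=> N0; rewrite {1}(divn_eq j N) exprD mulnC exprM cis_gridN // expr1n mul1r /dvdn.
have [->|r0] := posnP (j %% N)%N; first by rewrite expr0 !eqxx.
rewrite -cis_grid; apply/negbTE/cis_neq1; apply/andP; split.
  by rewrite /grid divr_gt0 ?ltr0n // !mulr_gt0 ?ltr0n ?pi_gt0.
rewrite /grid ltr_pdivrMr ?ltr0n // ltr_pM2l ?ltr_nat ?ltn_mod //.
by rewrite mulr_gt0 // pi_gt0.
Qed.

Lemma grid_sum N j : (0 < N)%N ->
  \sum_(0 <= m < N) cis (grid N m)%:C ^+ j = if (N %| j)%N then N%:R else 0.
Proof.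
move=> N0; under eq_bigr do rewrite cis_grid exprAC.
rewrite -cis_grid_eq1 //; case: ifP => [/eqP ->|/negbT h].
  under eq_bigr do rewrite expr1n; by rewrite sumr_const_nat subn0.
by apply: geometric_root; rewrite // exprAC cis_gridN // expr1n.
Qed.

Lemma cabs_gmean N G s (e : R) : (0 < N)%N ->
  (forall x, cabs (G (s + x%:C)) <= e) -> cabs (gmean N G s) <= e.
Proof.
move=> N0 h; rewrite /gmean cabsM cabsV cabs_nat ler_pdivrMr ?ltr0n //.
apply: (le_trans (cabs_sum _ _ _)); rewrite mulr_natr.
by rewrite -[X in _ *+ X]subn0 -sumr_const_nat; apply: ler_sum => j _; exact: h.
Qed.

End Cis.

(** * Periodic functions and change of height *)

Section Strip.
Variable R : realType.
Local Notation C := R[i].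
Implicit Types (G : C -> C) (s : C) (x : R).

Definition per_even G := (forall s, G (s + (2 * pi)%:C) = G s) /\ (forall s, G (- s) = G s).

Lemma periodic_int G : (forall s, G (s + (2 * pi)%:C) = G s) ->
  forall (j : int) s, G (s + (2 * pi * j%:~R)%:C) = G s.
Proof.
move=> hG.
have hn (n : nat) s : G (s + (2 * pi * n%:R)%:C) = G s.
  elim: n s => [|n IH] s; first by rewrite mulr0 addr0.
  by rewrite -[n.+1%:R]natr1 mulrDr mulr1 rmorphD addrA hG.
case=> n s; first exact: hn.
rewrite NegzE -[LHS](hn n.+1); congr G.
by rewrite -addrA -rmorphD -mulrDr mulrNz addNr mulr0 addr0.
Qed.

(** Reflection sends grid index j to N - j modulo the period, and periodicity identifies the points
    with index 0 and N. *)
Lemma gmean_opp N G s : (0 < N)%N -> (forall s, G (s + (2 * pi)%:C) = G s) ->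
  gmean N (fun t => G (- t)) s = gmean N G (- s).
Proof.
move=> N0 hG; rewrite /gmean; congr (_ / _).
pose f j := G (- s + (grid R N j)%:C).
have fN : f N = f 0%N.
  rewrite /f /grid mulfK ?pnatr_eq0 -?lt0n // mulr0 mul0r addr0; exact: hG.
rewrite -/(f _).
transitivity (\sum_(0 <= j < N) f (N - j)%N).
  rewrite big_nat [RHS]big_nat; apply: eq_bigr => j /andP[_ jN].
  rewrite -(hG (- _)) /f; congr G; rewrite opprD -addrA; congr (_ + _).
  rewrite -rmorphN -rmorphD; congr (_%:C); rewrite /grid natrB ?(ltnW jN) //.
  by field; rewrite pnatr_eq0 -lt0n.
case: N N0 @f fN => // N _ f fN.
rewrite [RHS](_ : _ = \sum_(0 <= j < N.+1) f j) // -[RHS]/(\sum_(0 <= j < N.+1) f j).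
rewrite big_nat_recl // subn0 fN [RHS]big_nat_recl //; congr (_ + _).
rewrite big_nat_rev /=; apply: eq_big_nat => j /andP[_ jN].
by congr f; lia.
Qed.

(* Vanishing of contour sums over periodic rectangles makes the grid means of
   a holomorphic function asymptotically independent of the height. *)
Lemma gmean_shift G (y1 y2 B : R) : (forall s, G (s + (2 * pi)%:C) = G s) ->
  (forall s, `|Im s| <= B -> cdiff G s) -> `|y1| <= B -> `|y2| <= B ->
  forall e : R, 0 < e -> exists n0, forall n, (n0 <= n)%N ->
    cabs (gmean (2 ^ n) G (y1 *i) - gmean (2 ^ n) G (y2 *i)) <= e.
Proof.
move=> hG hd h1 h2 e e0.
have p0 : 0 < 2 * pi :> R by rewrite mulr_gt0 // pi_gt0.
have [|n0 hn] := @goursat R G (y1 *i) (2 * pi)%:C ((y2 - y1) *i) _ (2 * pi * e) (mulr_gt0 p0 e0).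
  move=> s [a [b [_ /andP[b0 b1] ->]]]; apply: hd => /=.
  rewrite (_ : y1 + _ + _ = (1 - b) * y1 + b * y2); last by ring.
  apply: (le_trans (ler_normD _ _)); rewrite !normrM [`|b|]ger0_norm // ger0_norm ?subr_ge0 //.
  have k1 : (1 - b) * `|y1| <= (1 - b) * B by rewrite ler_wpM2l // subr_ge0.
  have k2 : b * `|y2| <= b * B by rewrite ler_wpM2l.
  by have := lerD k1 k2; lra.
exists n0 => n /hn; rewrite /rect_sum.
have es z : edge_sum G n z (2 * pi)%:C = (2 * pi)%:C * gmean (2 ^ n) G z.
  rewrite /edge_sum /gmean -mulr_suml natrX mulrC mulrAC [RHS]mulrA; congr (_ / _).
  congr (_ * _); apply: eq_bigr => j _; congr (G (_ + _)).
  by rewrite /grid natfracC -rmorphM natrX; congr (_%:C); ring.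
have -> : edge_sum G n (y1 *i + (2 * pi)%:C) ((y2 - y1) *i) = edge_sum G n (y1 *i) ((y2 - y1) *i).
  by apply: eq_bigr => j _; rewrite addrAC hG.
have -> : y1 *i + (y2 - y1) *i = y2 *i.
  by apply/eqP; rewrite eq_complex /= addr0 eqxx addrC subrK eqxx.
rewrite !es (_ : _ - _ - _ = (2 * pi)%:C * (gmean (2 ^ n) G (y1 *i) - gmean (2 ^ n) G (y2 *i))).
  by rewrite cabsM cabsR ger0_norm ?(ltW p0) // ler_pM2l.
by ring.
Qed.

End Strip.

(** * Fejer kernels and the discrete Bessel inequality *)

Section Fejer.
Variable R : realType.
Local Notation C := R[i].
Implicit Types (G : C -> C) (s : C) (x : R).

(** The Fejer kernel when v = 1 / w. The product form shows that it is nonnegative for w on the unit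
    circle ([fejer_real]); [fejerE] gives its Fourier coefficients. *)
Definition fejer (n : nat) (w v : C) : C :=
  (\sum_(0 <= k < n) w ^+ k) * (\sum_(0 <= k < n) v ^+ k) / n%:R.

(** The constant term is counted twice by w^0 + v^0, which the final - 1 corrects. *)
Lemma fejerE n w v : w * v = 1 -> (0 < n)%N ->
  fejer n w v = (\sum_(0 <= j < n) (1 - j%:R / n%:R) * (w ^+ j + v ^+ j)) - 1.
Proof.
move=> wv n0; have nn : (n%:R : C) != 0 by rewrite pnatr_eq0 -lt0n.
suff key m : (\sum_(0 <= k < m) w ^+ k) * (\sum_(0 <= k < m) v ^+ k) =
    \sum_(0 <= j < m) (m%:R - j%:R) * (w ^+ j + v ^+ j) - m%:R.
  rewrite /fejer key mulrBl divff // mulr_suml; congr (_ - _).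
  by apply: eq_bigr => j _; rewrite mulrAC mulrBl divff.
elim: m => [|m IH]; first by rewrite !big_nil mul0r subr0.
rewrite big_nat_recr //= [X in _ * X]big_nat_recr //= mulrDl !mulrDr IH.
have h1 : \sum_(0 <= j < m.+1) (m.+1%:R - j%:R) * (w ^+ j + v ^+ j) =
  \sum_(0 <= j < m) (m%:R - j%:R) * (w ^+ j + v ^+ j) + \sum_(0 <= j < m.+1) (w ^+ j + v ^+ j).
  rewrite big_nat_recr //= [X in _ = _ + X]big_nat_recr //= addrA -big_split /=.
  congr (_ + _); last by rewrite -natr1; ring.
  by apply: eq_bigr => j _; rewrite -natr1; ring.
have mirror (a b : C) : a * b = 1 -> (\sum_(0 <= k < m) a ^+ k) * b ^+ m =
    \sum_(0 <= j < m.+1) b ^+ j - 1.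
  move=> ab; rewrite big_nat_recl // expr0 addrAC subrr add0r mulr_suml big_nat_rev /=.
  apply: eq_big_nat => k /andP[_ km]; rewrite add0n.
  have -> : b ^+ m = b ^+ (m - k.+1) * b ^+ k.+1 by rewrite -exprD subnK.
  by rewrite mulrA -exprMn ab expr1n mul1r.
rewrite h1 mirror // [w ^+ m * \sum_(_ <= _ < _) _]mulrC mirror 1?mulrC //.
by rewrite -exprMn [v * w]mulrC wv expr1n big_split /= -natr1; ring.
Qed.

Lemma cis_conj x : ((cis x%:C)^*)%C = cis (- x%:C).
Proof. by rewrite -rmorphN !cisR /= cosN sinN. Qed.

Lemma fejer_real n x : fejer n (cis x%:C) (cis (- x%:C)) =
  (cabs (\sum_(0 <= k < n) cis x%:C ^+ k) ^+ 2 / n%:R)%:C.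
Proof.
set S := \sum_(0 <= k < n) _.
have -> : (cabs S ^+ 2 / n%:R)%:C = (cabs S ^+ 2)%:C / n%:R by rewrite fmorph_div rmorph_nat.
rewrite sqr_cabsJ /fejer rmorph_sum; congr (_ * _ / _).
by apply: eq_bigr => k _; rewrite rmorphXn -cis_conj.
Qed.

(** Rounding x / (2 pi) leaves some y with |y| <= pi. The real part of [cis] is then cos |y|, which
    decreases on [0, pi]; hence the value d' = 1 - cos d1 with d1 <= pi. *)
Lemma near_period (d : R) : 0 < d -> exists2 d', 0 < d' & forall x,
  cabs (cis x%:C - 1) < d' -> exists j : int, `|x - 2 * pi * j%:~R| < d.
Proof.
move=> d0; have p0 := pi_gt0 R.
pose d1 := Num.min d pi.
have d10 : 0 < d1 by rewrite lt_min d0.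
have d1p : d1 <= pi by rewrite ge_min lexx orbT.
exists (1 - cos d1).
  rewrite subr_gt0 -cos0 ltr_cos ?in_itv /= ?lexx ?(ltW p0) ?(ltW d10) //.
move=> x hx.
pose j := Num.floor ((x + pi) / (2 * pi)); exists j.
have pp : 0 < 2 * pi :> R by rewrite mulr_gt0.
have /andP[j1 j2] := mem_rg1_floor ((x + pi) / (2 * pi)).
have {}j1 : j%:~R * (2 * pi) <= x + pi by rewrite -ler_pdivlMr.
have {}j2 : x + pi < (j%:~R + 1) * (2 * pi) by rewrite -ltr_pdivrMr.
set y := x - _.
have hy : `|y| <= pi by rewrite ler_norml /y; apply/andP; split; nra.
apply: (@lt_le_trans _ _ d1); last by rewrite ge_min lexx.
rewrite ltNge; apply/negP => dy.
have : cos y <= cos d1.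
  rewrite -(cos_norm y); move: dy; rewrite le_eqVlt => /predU1P[-> //|dy].
  by apply: ltW; rewrite ltr_cos ?in_itv /= ?normr_ge0 ?hy ?d1p ?(ltW d10).
have hc : cis x%:C = cis y%:C.
  rewrite (_ : y%:C = x%:C + (2 * pi * (- j)%:~R)%:C); last first.
    by rewrite -rmorphD mulrNz mulrN.
  by rewrite periodic_int // => s; rewrite cisD cis_2pi mulr1.
move: hx; rewrite hc => hx hcos.
have := Re_le_cabs (cis y%:C - 1); rewrite cisR /= => hre.
have : 1 - cos d1 < 1 - cos d1; last by rewrite ltxx.
apply: le_lt_trans hx; rewrite cisR /=; apply: le_trans hre.
by rewrite distrC; apply: le_trans (ler_norm _); rewrite lerD2l lerN2.
Qed.

Lemma gmean_cisN N j s : (0 < N)%N -> (0 < j < N)%N -> gmean N (fun t => cis (- t) ^+ j) s = 0.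
Proof.
move=> N0 /andP[j0 jN]; rewrite (@gmean_opp _ N (fun t => cis t ^+ j)) //; last first.
  by move=> t; rewrite cisD cis_2pi mulr1.
rewrite /gmean; under eq_bigr do rewrite cisD exprMn.
by rewrite -mulr_sumr grid_sum // gtnNdvd // mulr0 mul0r.
Qed.

Lemma gmean_cis N j s : (0 < N)%N -> (0 < j < N)%N -> gmean N (fun t => cis t ^+ j) s = 0.
Proof.
move=> N0 jN; rewrite -[s]opprK -gmean_opp //; last by move=> t; rewrite cisD cis_2pi mulr1.
exact: gmean_cisN.
Qed.

Lemma gmeanD N F G s : gmean N (fun t => F t + G t) s = gmean N F s + gmean N G s.
Proof. by rewrite /gmean big_split mulrDl. Qed.

Lemma gmeanZ N c G s : gmean N (fun t => c * G t) s = c * gmean N G s.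
Proof. by rewrite /gmean -mulr_sumr mulrA. Qed.

Lemma gmeanB N F G s : gmean N (fun t => F t - G t) s = gmean N F s - gmean N G s.
Proof. by rewrite /gmean sumrB mulrBl. Qed.

Lemma gmean_sum N (I : Type) (r : seq I) (F : I -> C -> C) s :
  gmean N (fun t => \sum_(i <- r) F i t) s = \sum_(i <- r) gmean N (F i) s.
Proof. by rewrite /gmean exchange_big /= mulr_suml. Qed.

Lemma gmean_cst N c s : (0 < N)%N -> gmean N (fun=> c) s = c.
Proof.
by move=> N0; rewrite /gmean sumr_const_nat subn0 -[_ *+ N]mulr_natr mulfK // pnatr_eq0 -lt0n.
Qed.

Lemma gmean_fejer n N G s0 s : (0 < n)%N ->
  gmean N (fun t => G t * fejer n (cis (s0 - t)) (cis (t - s0))) s =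
  \sum_(0 <= j < n) (1 - j%:R / n%:R) *
    (cis s0 ^+ j * gmean N (fun t => G t * cis (- t) ^+ j) s
     + cis (- s0) ^+ j * gmean N (fun t => G t * cis t ^+ j) s) - gmean N G s.
Proof.
move=> n0.
have -> : (fun t => G t * fejer n (cis (s0 - t)) (cis (t - s0))) = fun t =>
    \sum_(0 <= j < n) (1 - j%:R / n%:R) * (cis s0 ^+ j * (G t * cis (- t) ^+ j)
      + cis (- s0) ^+ j * (G t * cis t ^+ j)) + (-1) * G t.
  apply/funext => t; rewrite fejerE //; last by rewrite -cisD addrA subrK subrr cis0.
  rewrite mulrBr mulr1 mulN1r mulr_sumr; congr (_ - _); apply: eq_bigr => j _.
  by rewrite !cisD !exprMn; ring.
rewrite gmeanD gmeanZ mulN1r gmean_sum; congr (_ - _); apply: eq_bigr => j _.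
by rewrite gmeanZ gmeanD !gmeanZ.
Qed.

(** The frequencies of the kernel are below n <= N, so the grid averages all of them to 0 except the
    constant term. *)
Lemma gmean_fejer1 n N s0 s : (0 < n)%N -> (n <= N)%N ->
  gmean N (fun t => fejer n (cis (s0 - t)) (cis (t - s0))) s = 1.
Proof.
move=> n0 nN; have N0 := leq_trans n0 nN.
have m1 (f : C -> C) : (fun t => 1 * f t) = f by apply/funext => t; rewrite mul1r.
have c1 (f : C -> C) : (fun t => f t ^+ 0) = fun=> 1 by [].
have := gmean_fejer N (fun=> 1) s0 s n0; rewrite m1 => ->; rewrite gmean_cst //.
rewrite big_ltn //= big1_seq; last first.
  move=> j /andP[_]; rewrite mem_index_iota => /andP[j0 jn].
  rewrite !m1 gmean_cisN ?gmean_cis ?j0 ?(leq_trans jn) //.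
  by rewrite !mulr0 addr0 mulr0.
rewrite !m1 (c1 (fun t => cis (- t))) gmean_cst // !expr0 mul0r subr0; ring.
Qed.

(** The geometric sum S satisfies |S| |z - 1| = |z^n - 1| <= 2 for z on the unit circle. *)
Lemma fejer_far n x (d : R) : (0 < n)%N -> 0 < d -> d <= cabs (cis x%:C - 1) ->
  cabs (\sum_(0 <= k < n) cis x%:C ^+ k) ^+ 2 / n%:R <= 4 / (n%:R * d ^+ 2).
Proof.
move=> n0 d0 hd; set S := \sum_(_ <= _ < _) _.
have h : cabs S * d <= 2.
  apply: (@le_trans _ _ (cabs (cis x%:C - 1) * cabs S)).
    by rewrite mulrC ler_wpM2r ?cabs_ge0.
  rewrite -cabsM /S big_mkord -subrX1; apply: (le_trans (le_cabsB _ _)).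
  by rewrite cabs1 cabsX cabs_cis /= oppr0 expR0 expr1n.
rewrite invfM mulrCA mulrC; apply: ler_wpM2l; first by rewrite invr_ge0.
rewrite ler_pdivlMr ?exprn_gt0 // -exprMn.
have -> : 4 = 2 ^+ 2 :> R by rewrite -natrX.
by apply: lerXn2r; rewrite ?nnegrE //; apply: mulr_ge0; rewrite ?cabs_ge0 ?(ltW d0).
Qed.

(** Fejer's argument with grid means for integrals: the weights [phi m] are nonnegative with mean 1;
    near a period G is within e / 2 of G s0, elsewhere the weights are O(1/n). The estimate is
    uniform in N >= n, so n can be fixed before N. *)
Lemma fejer_approx G s0 (W e : R) : (forall s, G (s + (2 * pi)%:C) = G s) ->
  cdiff G s0 -> (forall x, cabs (G (s0 + x%:C)) <= W) -> 0 < e ->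
  exists n0, forall n N, (n0 < n)%N -> (n <= N)%N ->
    cabs (gmean N (fun t => G t * fejer n (cis (s0 - t)) (cis (t - s0))) ((Im s0) *i) - G s0) <= e.
Proof.
move=> hG hd hW e0.
have W0 : 0 <= W by apply: le_trans (cabs_ge0 _) (hW 0).
have [d d0 hdd] := cdiff_cont hd (divr_gt0 e0 (ltr0Sn R 1)).
have [d' d'0 hd'] := near_period d0.
(* The oscillation 2 W of G times the constant 4 / d'^2 of [fejer_far]. *)
pose B := 8 * W / d' ^+ 2.
have B0 : 0 <= B by rewrite divr_ge0 ?exprn_ge0 ?mulr_ge0 // ltW.
exists (Num.bound (B / (e / 2))) => n N n0n nN.
have n0 : (0 < n)%N by exact: leq_trans n0n.
have nB : B / n%:R <= e / 2.
  rewrite ler_pdivrMr ?ltr0n // mulrC -ler_pdivrMr ?divr_gt0 //; apply: ltW.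
  apply: lt_trans (archi_boundP _) _; first by rewrite mulr_ge0 ?invr_ge0 // divr_ge0 ?(ltW e0).
  by rewrite ltr_nat.
have N0 : (0 < N)%N by exact: leq_trans nN.
rewrite [X in _ - X](_ : _ = gmean N
    (fun t => G s0 * fejer n (cis (s0 - t)) (cis (t - s0))) ((Im s0) *i)); last first.
  by rewrite gmeanZ gmean_fejer1 // mulr1.
rewrite -gmeanB /gmean cabsM cabsV cabs_nat ler_pdivrMr ?ltr0n //.
apply: (le_trans (cabs_sum _ _ _)).
pose phi m : R := let x := Re s0 - grid R N m in
  cabs (\sum_(0 <= k < n) cis x%:C ^+ k) ^+ 2 / n%:R.
have sm m : s0 - ((Im s0) *i + (grid R N m)%:C) = (Re s0 - grid R N m)%:C.
  by case: (s0) => a b; apply/eqP; rewrite eq_complex /=; apply/andP; split; apply/eqP; ring.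
have phiE m : fejer n (cis (s0 - ((Im s0) *i + (grid R N m)%:C)))
    (cis ((Im s0) *i + (grid R N m)%:C - s0)) = (phi m)%:C.
  by rewrite -[_ + _ - s0]opprB !sm fejer_real.
have phi0 m : 0 <= phi m by rewrite /phi divr_ge0 ?exprn_ge0 ?cabs_ge0.
have sphi : \sum_(0 <= m < N) phi m = N%:R.
  apply: complexI; rewrite rmorph_sum rmorph_nat /=.
  have := gmean_fejer1 s0 ((Im s0) *i) n0 nN.
  rewrite /gmean => /(congr1 (fun z => z * N%:R)); rewrite divfK ?pnatr_eq0 -?lt0n // mul1r => <-.
  by apply: eq_bigr => m _; rewrite phiE.
apply: (@le_trans _ _ (\sum_(0 <= m < N) (e / 2 * phi m + B / n%:R))); last first.
  rewrite big_split /= -mulr_sumr sphi sumr_const_nat subn0 -[B / _ *+ N]mulr_natr -mulrDl.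
  by rewrite ler_wpM2r //; lra.
apply: ler_sum => m _; rewrite phiE -mulrBl cabsM cabsR ger0_norm //.
have hGs : (Im s0) *i + (grid R N m)%:C = s0 + (- (Re s0 - grid R N m))%:C.
  by case: (s0) => a b; apply/eqP; rewrite eq_complex /=; apply/andP; split; apply/eqP; ring.
have [near|far] := ltP (cabs (cis (Re s0 - grid R N m)%:C - 1)) d'.
  have [j hj] := hd' _ near.
  apply: ler_wpDr; first by rewrite divr_ge0.
  apply: ler_wpM2r => //.
  rewrite hGs -(periodic_int hG j) -addrA -rmorphD; apply: hdd; rewrite cabsR.
  by rewrite -normrN opprD opprK.
apply: ler_wpDl; first by rewrite mulr_ge0 // divr_ge0 // ltW.
have := fejer_far n0 d'0 far; rewrite -/(phi m) => hphi.
have hGG : cabs (G ((Im s0) *i + (grid R N m)%:C) - G s0) <= 2 * W.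
  apply: (le_trans (le_cabsB _ _)); rewrite mulr2n mulrDl !mul1r lerD ?hGs ?hW //.
  by have := hW 0; rewrite addr0.
have -> : B / n%:R = (2 * W) * (4 / (n%:R * d' ^+ 2)).
  by rewrite /B; field; rewrite pnatr_eq0 -lt0n n0 /= gt_eqF.
by apply: ler_pM; rewrite ?cabs_ge0.
Qed.

End Fejer.

Section Bessel.
Variable R : realType.
Local Notation C := R[i].

(** Lagrange's identity: the double sum of squares is twice the defect. *)
Lemma cauchy_schwarz (n : nat) (x y : 'I_n -> R) :
  (\sum_i x i * y i) ^+ 2 <= (\sum_i x i ^+ 2) * (\sum_i y i ^+ 2).
Proof.
have : 0 <= \sum_i \sum_j (x i * y j - x j * y i) ^+ 2.
  by apply: sumr_ge0 => i _; apply: sumr_ge0 => j _; exact: sqr_ge0.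
have -> : \sum_i \sum_j (x i * y j - x j * y i) ^+ 2 =
    \sum_i \sum_j (x i ^+ 2 * y j ^+ 2) + \sum_i \sum_j (y i ^+ 2 * x j ^+ 2)
    - 2 * \sum_i \sum_j (x i * y i) * (x j * y j).
  rewrite mulr_sumr -sumrN -!big_split; apply: eq_bigr => i _ /=.
  rewrite mulr_sumr -sumrN -!big_split; apply: eq_bigr => j _ /=; ring.
rewrite -!big_distrlr /= expr2 [(\sum_i y i ^+ 2) * _]mulrC; lra.
Qed.

Lemma conj_cisX x j : ((cis x%:C ^+ j)^*)%C = cis (- x%:C) ^+ j :> C.
Proof. by rewrite -cis_conj rmorphXn. Qed.

Lemma conj_mul_cisX (c : C) x j : ((c * cis x%:C ^+ j)^*)%C = (c^*)%C * cis (- x%:C) ^+ j.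
Proof. by rewrite -conj_cisX rmorphM. Qed.

Lemma grid_sumN N j : (0 < N)%N ->
  \sum_(0 <= m < N) cis (- (grid R N m)%:C) ^+ j = if (N %| j)%N then N%:R else 0.
Proof.
move=> N0; transitivity ((\sum_(0 <= m < N) cis (grid R N m)%:C ^+ j)^*)%C.
  by rewrite rmorph_sum; apply: eq_bigr => m _; symmetry; exact: conj_cisX.
by rewrite grid_sum //; case: ifP => _; rewrite ?conjc_nat ?conjc0.
Qed.

Lemma grid_orth N j k : (0 < N)%N -> (j < N)%N -> (k < N)%N ->
  \sum_(0 <= m < N) (cis (grid R N m)%:C ^+ j * cis (- (grid R N m)%:C) ^+ k)
  = if j == k then N%:R else 0.
Proof.
move=> N0; wlog : j k / (k <= j)%N => [hw|kj jN kN].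
  move=> jN kN; have [kj|/ltnW jk] := leqP k j; first exact: hw.
  have := congr1 (@conjc R) (hw k j jk kN jN); rewrite eq_sym.
  rewrite [X in _ = X](_ : _ = if j == k then N%:R else 0); last first.
    by case: ifP => _; rewrite ?conjc_nat ?conjc0.
  move=> <-; rewrite rmorph_sum; apply: eq_bigr => m _.
  set gm := grid R N m.
  symmetry; transitivity (((cis gm%:C ^+ k)^*)%C * ((cis (- gm%:C) ^+ j)^*)%C); first exact: rmorphM.
  by rewrite conj_cisX -(conj_cisX gm j) conjcK mulrC.
have -> : \sum_(0 <= m < N) (cis (grid R N m)%:C ^+ j * cis (- (grid R N m)%:C) ^+ k) =
    \sum_(0 <= m < N) cis (grid R N m)%:C ^+ (j - k).
  apply: eq_bigr => m _; rewrite -[in LHS](subnK kj) exprD -mulrA -exprMn -cisD subrr cis0.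
  by rewrite expr1n mulr1.
rewrite grid_sum //; have [->|jk] := eqVneq j k; first by rewrite subnn dvdn0.
have kj' : (k < j)%N by rewrite ltn_neqAle eq_sym jk.
rewrite gtnNdvd ?subn_gt0 //; exact: leq_ltn_trans (leq_subr _ _) jN.
Qed.

(** h is the orthogonal projection of g onto the first n <= N characters of the grid. The inner
    products of g with h and of h with itself are all N S, so expanding the squared norm of g - h
    gives the inequality. *)
Lemma grid_bessel N n (g : nat -> C) (W : R) : (0 < N)%N -> (n <= N)%N ->
  (forall m, cabs (g m) <= W) ->
  \sum_(0 <= j < n) cabs ((\sum_(0 <= m < N) g m * cis (- (grid R N m)%:C) ^+ j) / N%:R) ^+ 2
    <= W ^+ 2.
Proof.
move=> N0 nN hW; have NR : (N%:R : R) != 0 by rewrite pnatr_eq0 -lt0n.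
have NC : (N%:R : C) != 0 by rewrite pnatr_eq0 -lt0n.
pose gh j := (\sum_(0 <= m < N) g m * cis (- (grid R N m)%:C) ^+ j) / N%:R.
pose h m := \sum_(0 <= j < n) gh j * cis (grid R N m)%:C ^+ j.
set S := \sum_(0 <= j < n) _.
have hconj m : ((h m)^*)%C = \sum_(0 <= j < n) ((gh j)^*)%C * cis (- (grid R N m)%:C) ^+ j.
  by rewrite rmorph_sum; apply: eq_bigr => j _; exact: conj_mul_cisX.
have ghN j : \sum_(0 <= m < N) g m * cis (- (grid R N m)%:C) ^+ j = N%:R * gh j.
  by rewrite /gh mulrC divfK.
have SE : (N%:R * S)%:C = \sum_(0 <= j < n) N%:R * (gh j * ((gh j)^*)%C).
  rewrite rmorphM rmorph_nat /S rmorph_sum mulr_sumr; apply: eq_bigr => j _.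
  by rewrite -sqr_cabsJ.
have gS : \sum_(0 <= m < N) g m * ((h m)^*)%C = (N%:R * S)%:C.
  rewrite SE; under eq_bigr do rewrite hconj mulr_sumr.
  rewrite exchange_big; apply: eq_bigr => j _ /=.
  under eq_bigr do rewrite mulrCA.
  by rewrite -mulr_sumr ghN; ring.
have hghN j : (j < n)%N ->
    \sum_(0 <= m < N) h m * cis (- (grid R N m)%:C) ^+ j = N%:R * gh j.
  move=> jn; under eq_bigr do rewrite /h mulr_suml.
  rewrite exchange_big /=.
  transitivity (\sum_(0 <= k < n) (if k == j then N%:R * gh j else 0)).
    apply: eq_big_nat => k /andP[_ kn].
    under eq_bigr do rewrite -mulrA.
    rewrite -mulr_sumr grid_orth //; try exact: leq_trans nN.
    by case: eqP => [->|_]; rewrite ?mulr0 // mulrC.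
  rewrite big_mkord (bigD1 (Ordinal jn)) //= eqxx big1 ?addr0 // => k.
  by rewrite -val_eqE /= => /negbTE ->.
have hS : \sum_(0 <= m < N) h m * ((h m)^*)%C = (N%:R * S)%:C.
  rewrite SE; under eq_bigr do rewrite hconj mulr_sumr.
  rewrite exchange_big; apply: eq_big_nat => j /andP[_ jn] /=.
  under eq_bigr do rewrite mulrCA.
  by rewrite -mulr_sumr hghN //; ring.
have gS' : \sum_(0 <= m < N) h m * ((g m)^*)%C = (N%:R * S)%:C.
  rewrite -[RHS](conjc_real (N%:R * S)) -gS rmorph_sum; apply: eq_bigr => m _.
  by rewrite rmorphM; rewrite [X in _ = _ * X]conjcK mulrC.
have : 0 <= \sum_(0 <= m < N) cabs (g m - h m) ^+ 2.
  by apply: sumr_ge0 => m _; rewrite exprn_ge0 ?cabs_ge0.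
have -> : \sum_(0 <= m < N) cabs (g m - h m) ^+ 2 = \sum_(0 <= m < N) cabs (g m) ^+ 2 - N%:R * S.
  apply: complexI; rewrite rmorphB rmorph_sum rmorph_sum.
  rewrite [RHS](_ : _ = \sum_(0 <= m < N) (g m * ((g m)^*)%C) - (N%:R * S)%:C); last first.
    by congr (_ - _); apply: eq_bigr => m _; exact: sqr_cabsJ.
  transitivity (\sum_(0 <= m < N) (g m * ((g m)^*)%C - g m * ((h m)^*)%C
      - h m * ((g m)^*)%C + h m * ((h m)^*)%C)).
    apply: eq_bigr => m _; rewrite [LHS]sqr_cabsJ rmorphB /=; ring.
  by rewrite big_split /= !sumrB gS gS' hS subrK.
rewrite subr_ge0 => hle.
have : N%:R * S <= N%:R * W ^+ 2.
  apply: (le_trans hle); rewrite mulr_natl -[X in _ *+ X]subn0 -sumr_const_nat.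
  by apply: ler_sum => m _; rewrite lerXn2r ?nnegrE ?cabs_ge0 // (le_trans (cabs_ge0 _) (hW m)).
by rewrite ler_pM2l ?ltr0n.
Qed.

End Bessel.

(** * Functionals on periodic even functions in a strip *)

Section StripApprox.
Variable R : realType.
Local Notation C := R[i].
Implicit Types (G : C -> C) (s : C) (x : R).

(** 1 for k = 0 and 2 otherwise: the factor between the mean of G cos (k s) and the coefficient of
    cos (k s) in G. *)
Definition wgt (k : nat) : nat := (0 < k)%N.+1.

Definition strip_fun (Y W : R) G := [/\ forall s, `|Im s| < Y -> cdiff G s,
  forall s, `|Im s| < Y -> cabs (G s) <= W & per_even G].

Lemma fin_eventually (I : finType) (P : I -> nat -> Prop) :
  (forall i, exists n0, forall n, (n0 <= n)%N -> P i n) ->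
  exists n0, forall n, (n0 <= n)%N -> forall i, P i n.
Proof.
move=> h; have [f hf] := choice h; exists (\max_i f i) => n hn i.
by apply: hf; apply: leq_trans hn; exact: leq_bigmax.
Qed.

(** The polynomial is a Fejer mean with coefficients computed on the line Im t = - b. There e^(-ikt)
    has modulus e^(-kb) and |G| <= W, which gives the pointwise bound, and [grid_bessel] on the same
    line gives the square-sum bound. *)
Lemma strip_approx (Y W b : R) G (I : finType) (s : I -> C) (e : R) :
  strip_fun Y W G -> 0 <= b -> b < Y -> (forall i, `|Im (s i)| <= b) -> 0 < e ->
  exists n (a : nat -> C), [/\ forall k, cabs (a k) <= W * expR (- (k%:R * b)),
    \sum_(0 <= k < n) (cabs (a k) * expR (k%:R * b)) ^+ 2 <= W ^+ 2 &
    forall i, cabs (G (s i) - \sum_(0 <= k < n) (wgt k)%:R * a k * ck k (s i)) <= e].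
Proof.
move=> [hd hW [hper heven]] b0 bY hs e0.
have ImR x z : Im (z + x%:C) = Im z by case: z => u v /=; rewrite addr0.
have sY i : `|Im (s i)| < Y by exact: le_lt_trans (hs i) bY.
have W0 : 0 <= W by apply: le_trans (cabs_ge0 (G 0)) (hW _ _); rewrite /= normr0 (le_lt_trans b0).
have e20 : 0 < e / 2 by rewrite divr_gt0.
have [n0 hn0] : exists n0, forall n, (n0 <= n)%N -> forall i N, (n.+1 <= N)%N ->
    cabs (gmean N (fun t => G t * fejer n.+1 (cis (s i - t)) (cis (t - s i))) ((Im (s i)) *i)
      - G (s i)) <= e / 2.
  apply: fin_eventually => i.
  have hWi x : cabs (G (s i + x%:C)) <= W by apply: hW; rewrite ImR.
  have [n0 h] := fejer_approx hper (hd _ (sY i)) hWi e20.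
  by exists n0 => n hn N; apply: h.
have {}hn0 := hn0 n0 (leqnn _); set n := n0.+1 in hn0.
pose F j t := G t * cis (- t) ^+ j.
pose al N j := gmean N (F j) ((- b) *i).
have hF j t : F j (t + (2 * pi)%:C) = F j t.
  by rewrite /F hper opprD cisD [cis (- _%:C)]cisN cis_2pi invr1 mulr1.
have hFd j t : `|Im t| <= b -> cdiff (F j) t.
  move=> ht; apply: cdiffM; first by apply: hd; exact: le_lt_trans bY.
  by apply: cdiffX; exact: cdiff_cisN.
pose M : R := \sum_i (\sum_(0 <= j < n) (cabs (cis (s i) ^+ j) + cabs (cis (- s i) ^+ j)) + 1) + 1.
have Pi0 i : 0 <= \sum_(0 <= j < n) (cabs (cis (s i) ^+ j) + cabs (cis (- s i) ^+ j)).
  by apply: sumr_ge0 => j _; rewrite addr_ge0 ?cabs_ge0.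
have M0 : 0 < M by rewrite ltr_wpDl //; apply: sumr_ge0 => k _; rewrite addr_ge0.
have Mi i : \sum_(0 <= j < n) (cabs (cis (s i) ^+ j) + cabs (cis (- s i) ^+ j)) + 1 <= M.
  rewrite /M (bigD1 i) //= -addrA lerDl addr_ge0 //; apply: sumr_ge0 => k _.
  by rewrite addr_ge0.
pose d := e / 2 / M.
have d0 : 0 < d by rewrite divr_gt0.
(* Both signs of the height occur: the terms with e^(ikt) at height Im (s i) become, by evenness,
   coefficients [F k] at height - Im (s i). The number of grid points is a power of 2 because
   [gmean_shift] rests on bisection. *)
have [N1 hN1] : exists N1, forall m, (N1 <= m)%N -> forall ijs : I * 'I_n * bool,
    cabs (gmean (2 ^ m) (F ijs.1.2) (((-1) ^+ ijs.2 * Im (s ijs.1.1)) *i)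
      - al (2 ^ m)%N ijs.1.2) <= d.
  apply: fin_eventually => -[[i j] sg] /=.
  apply: (@gmean_shift _ _ _ _ b) => //; first exact: hFd.
    by rewrite normrM normr_sign mul1r.
  by rewrite normrN ger0_norm.
have {}hN1 := hN1 (maxn N1 n) (leq_maxl _ _).
have nN : (n <= 2 ^ maxn N1 n)%N.
  by apply: leq_trans (leq_maxr N1 n) (ltnW (ltn_expl _ _)).
move: (2 ^ maxn N1 n)%N nN hN1 => N nN hN1.
have N0 : (0 < N)%N by exact: leq_trans nN.
pose a k := if (k < n)%N then (1 - k%:R / n%:R) * al N k else 0 : C.
have cabs_phi k : (k < n)%N -> cabs (1 - k%:R / n%:R : C) <= 1.
  move=> kn; have -> : 1 - k%:R / n%:R = (1 - k%:R / n%:R : R)%:C :> C.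
    by rewrite rmorphB rmorph1 fmorph_div !rmorph_nat.
  have k0 : 0 <= k%:R / n%:R :> R by rewrite divr_ge0.
  have k1 : k%:R / n%:R <= 1 :> R by rewrite ler_pdivrMr ?ltr0n // mul1r ler_nat ltnW.
  by rewrite cabsR ger0_norm ?subr_ge0 // gerBl.
have al_le k : cabs (al N k) <= W * expR (- (k%:R * b)).
  apply: cabs_gmean => // x; rewrite /F cabsM cabs_cisX; apply: ler_pM; rewrite ?cabs_ge0 ?expR_ge0 //.
    by apply: hW; rewrite ImR /= normrN ger0_norm.
  by rewrite ler_expR /= addr0 opprK.
have a_le k : (k < n)%N -> cabs (a k) <= cabs (al N k).
  by move=> kn; rewrite /a kn cabsM ler_piMl ?cabs_ge0 ?cabs_phi.
exists n, a; split.
- move=> k; have [kn|nk] := ltnP k n; first exact: le_trans (a_le k kn) (al_le k).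
  by rewrite /a ltnNge nk cabs0 mulr_ge0 ?expR_ge0.
(* Multiplied by e^(kb), the coefficient [al N k] has the modulus of the discrete Fourier
   coefficient of the restriction of G to the line. *)
- have := @grid_bessel R N n (fun m => G ((- b) *i + (grid R N m)%:C)) W N0 nN.
  move=> /(_ _) h; apply: le_trans (h _); last first.
    by move=> m; apply: hW; rewrite ImR /= normrN ger0_norm.
  rewrite big_nat [X in _ <= X]big_nat; apply: ler_sum => k /andP[_ kn].
  apply: lerXn2r; rewrite ?nnegrE ?mulr_ge0 ?cabs_ge0 ?expR_ge0 //.
  apply: (@le_trans _ _ (cabs (al N k) * expR (k%:R * b))).
    by rewrite ler_wpM2r ?expR_ge0 ?a_le.
  have -> : al N k = (cis (b *i) ^+ k) * ((\sum_(0 <= m < N)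
      G ((- b) *i + (grid R N m)%:C) * cis (- (grid R N m)%:C) ^+ k) / N%:R).
    rewrite /al /gmean mulrA; congr (_ / _); rewrite mulr_sumr; apply: eq_bigr => m _.
    rewrite /F opprD cisD exprMn mulrCA; congr (_ ^+ _ * _); congr cis.
    by apply/eqP; rewrite eq_complex /= oppr0 opprK !eqxx.
  rewrite cabsM mulrAC cabs_cisX /= -expRD addNr expR0 mul1r //.
move=> i; rewrite cabsB.
have -> : \sum_(0 <= k < n) (wgt k)%:R * a k * ck k (s i) - G (s i) =
  (gmean N (fun t => G t * fejer n (cis (s i - t)) (cis (t - s i))) ((Im (s i)) *i) - G (s i))
  - (gmean N (fun t => G t * fejer n (cis (s i - t)) (cis (t - s i))) ((Im (s i)) *i)
    - \sum_(0 <= k < n) (wgt k)%:R * a k * ck k (s i)) by ring.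
apply: (le_trans (le_cabsB _ _)).
have {}hn0 := hn0 i N nN.
suff : cabs (gmean N (fun t => G t * fejer n (cis (s i - t)) (cis (t - s i))) ((Im (s i)) *i)
    - \sum_(0 <= k < n) (wgt k)%:R * a k * ck k (s i)) <= e / 2 by lra.
have -> : \sum_(0 <= k < n) (wgt k)%:R * a k * ck k (s i) = \sum_(0 <= k < n)
   (1 - k%:R / n%:R) * (cis (s i) ^+ k * al N k + cis (- s i) ^+ k * al N k) - al N 0%N.
  rewrite big_ltn // [X in _ = X - _]big_ltn // [RHS]addrAC; congr (_ + _).
    rewrite /a /wgt /= ck0 mul0r subr0; ring.
  apply: eq_big_nat => k /andP[k0 kn]; rewrite /a kn /wgt k0 /ck /=.
  by field; rewrite ?pnatr_eq0.
have neg k : gmean N (fun t => G t * cis t ^+ k) ((Im (s i)) *i) = gmean N (F k) ((- Im (s i)) *i).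
  have -> : (- Im (s i)) *i = - ((Im (s i)) *i).
    by apply/eqP; rewrite eq_complex /= oppr0 !eqxx.
  apply: etrans (gmean_opp ((Im (s i)) *i) N0 (hF k)); congr gmean; apply/funext => t.
  by rewrite /F heven opprK.
have zero : gmean N G ((Im (s i)) *i) = gmean N (F 0%N) ((Im (s i)) *i).
  by congr gmean; apply/funext => t; rewrite /F expr0 mulr1.
pose y sg : C := ((-1) ^+ (sg : bool) * Im (s i)) *i.
have y0 : (Im (s i)) *i = y false by rewrite /y expr0 mul1r.
have y1 : (- Im (s i)) *i = y true by rewrite /y expr1 mulN1r.
have -> : gmean N (fun t => G t * fejer n (cis (s i - t)) (cis (t - s i))) ((Im (s i)) *i) =
    \sum_(0 <= j < n) (1 - j%:R / n%:R) *
      (cis (s i) ^+ j * gmean N (F j) (y false) + cis (- s i) ^+ j * gmean N (F j) (y true))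
    - gmean N (F 0%N) (y false).
  apply: (etrans (gmean_fejer N G (s i) _ (ltn0Sn n0))).
  apply: (congr2 (fun u v : C => u - v)).
    apply: eq_bigr => j _.
    apply: (congr2 (fun u v : C => _ * (_ * u + _ * v))).
      exact: (congr1 (gmean N (F j)) y0).
    exact: etrans (neg j) (congr1 (gmean N (F j)) y1).
  exact: etrans zero (congr1 (gmean N (F 0%N)) y0).
have -> : \sum_(0 <= j < n) (1 - j%:R / n%:R) *
      (cis (s i) ^+ j * gmean N (F j) (y false) + cis (- s i) ^+ j * gmean N (F j) (y true))
    - gmean N (F 0%N) (y false)
    - (\sum_(0 <= k < n) (1 - k%:R / n%:R) *
      (cis (s i) ^+ k * al N k + cis (- s i) ^+ k * al N k) - al N 0%N) =
  \sum_(0 <= j < n) (1 - j%:R / n%:R) *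
      (cis (s i) ^+ j * (gmean N (F j) (y false) - al N j)
       + cis (- s i) ^+ j * (gmean N (F j) (y true) - al N j))
    - (gmean N (F 0%N) (y false) - al N 0%N).
  have -> : forall a b c d : C, a - b - (c - d) = (a - c) - (b - d) by move=> *; ring.
  have dist (c u v X Y' A : C) : c * (u * X + v * Y') - c * (u * A + v * A) =
    c * (u * (X - A) + v * (Y' - A)) by ring.
  by rewrite -sumrB; congr (_ - _); apply: eq_bigr => j _; exact: dist.
have hD j sg : (j < n)%N -> cabs (gmean N (F j) (y sg) - al N j) <= d.
  by move=> jn; have := hN1 (i, Ordinal jn, sg).
apply: (le_trans (le_cabsB _ _)).
apply: (@le_trans _ _ (d * (\sum_(0 <= j < n)
    (cabs (cis (s i) ^+ j) + cabs (cis (- s i) ^+ j)) + 1))); last first.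
  have -> : e / 2 = d * M by rewrite /d divfK // gt_eqF.
  by rewrite ler_pM2l.
rewrite mulrDr mulr1; apply: lerD; last exact: hD.
apply: (le_trans (cabs_sum _ _ _)); rewrite mulr_sumr.
rewrite big_nat [X in _ <= X]big_nat; apply: ler_sum => j /andP[_ jn].
rewrite cabsM; apply: (@le_trans _ _ (1 * cabs (cis (s i) ^+ j * (gmean N (F j) (y false) - al N j)
       + cis (- s i) ^+ j * (gmean N (F j) (y true) - al N j)))).
  by apply: ler_wpM2r; rewrite ?cabs_ge0 ?cabs_phi.
have comb (u v A B : C) : cabs A <= d -> cabs B <= d ->
    cabs (u * A + v * B) <= d * (cabs u + cabs v).
  move=> hA hB; apply: (le_trans (le_cabsD _ _)); rewrite !cabsM mulrDr.
  by apply: lerD; rewrite mulrC; apply: ler_wpM2r; rewrite ?cabs_ge0.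
by rewrite mul1r; apply: comb; exact: hD.
Qed.

Section Functional.
Variables (Y W b : R) (G : C -> C) (I : finType) (c s : I -> C).
Hypotheses (hG : strip_fun Y W G) (b0 : 0 <= b) (bY : b < Y).
Hypothesis hs : forall i, `|Im (s i)| <= b.

Let lam k := \sum_i c i * ck k (s i).

(** The functional is a finite combination of point evaluations, so replacing G by its cosine
    polynomial costs arbitrarily little; what remains is a pairing of coefficients with the values
    [lam k] on cosines. *)
Let lam_approx (K : R) :
  (forall n (a : nat -> C), (forall k, cabs (a k) <= W * expR (- (k%:R * b))) ->
    \sum_(0 <= k < n) (cabs (a k) * expR (k%:R * b)) ^+ 2 <= W ^+ 2 ->
    \sum_(0 <= k < n) (wgt k)%:R * cabs (a k) * cabs (lam k) <= K) ->
  cabs (\sum_i c i * G (s i)) <= K.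
Proof.
move=> hK; apply/ler_addgt0Pr => e e0.
pose S := \sum_i cabs (c i) + 1.
have S0 : 0 < S by rewrite ltr_wpDl // sumr_ge0 // => i _; rewrite cabs_ge0.
have [n [a [h1 h2 h3]]] := strip_approx hG b0 bY hs (divr_gt0 e0 S0).
have -> : \sum_i c i * G (s i) = \sum_(0 <= k < n) (wgt k)%:R * a k * lam k
    + \sum_i c i * (G (s i) - \sum_(0 <= k < n) (wgt k)%:R * a k * ck k (s i)).
  under [X in _ = X + _]eq_bigr do rewrite /lam mulr_sumr.
  rewrite exchange_big -big_split; apply: eq_bigr => i _ /=.
  rewrite mulrBr mulr_sumr.
  under [X in _ = X + _]eq_bigr do rewrite mulrCA.
  by rewrite addrC subrK.
apply: (le_trans (le_cabsD _ _)); apply: lerD.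
  apply: le_trans (hK n a h1 h2); apply: (le_trans (cabs_sum _ _ _)).
  by apply: ler_sum => k _; rewrite !cabsM cabs_nat.
apply: (le_trans (cabs_sum _ _ _)).
apply: (@le_trans _ _ (\sum_i cabs (c i) * (e / S))).
  by apply: ler_sum => i _; rewrite cabsM ler_wpM2l ?cabs_ge0.
rewrite -mulr_suml mulrCA -[X in _ <= X]mulr1; apply: ler_wpM2l; first exact: ltW.
by rewrite ler_pdivrMr // mul1r lerDl.
Qed.

Let W0 : 0 <= W.
Proof.
by have [_ h _] := hG; apply: le_trans (cabs_ge0 (G 0)) (h _ _); rewrite /= normr0 (le_lt_trans b0).
Qed.

Lemma strip_functional_l1 (M : R) :
  (forall n, \sum_(0 <= k < n) (wgt k)%:R * expR (- (k%:R * b)) * cabs (lam k) <= M) ->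
  cabs (\sum_i c i * G (s i)) <= M * W.
Proof.
move=> hM; apply: lam_approx => n a ha _; rewrite mulrC.
apply: (@le_trans _ _ (W * \sum_(0 <= k < n) (wgt k)%:R * expR (- (k%:R * b)) * cabs (lam k))).
  rewrite mulr_sumr; apply: ler_sum => k _; rewrite mulrA; apply: ler_wpM2r.
    exact: cabs_ge0.
  by rewrite mulrCA ler_wpM2l.
exact: ler_wpM2l.
Qed.

(** Cauchy-Schwarz against the Bessel bound on the coefficients. Unlike [strip_functional_l1] it
    asks only for square sums of the values on cosines. *)
Lemma strip_functional_l2 (M : R) : 0 <= M ->
  (forall n, \sum_(0 <= k < n) ((wgt k)%:R * expR (- (k%:R * b)) * cabs (lam k)) ^+ 2 <= M ^+ 2) ->
  cabs (\sum_i c i * G (s i)) <= M * W.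
Proof.
move=> M0 hM; apply: lam_approx => n a _ ha.
rewrite -[X in X <= _]ger0_norm; last first.
  by apply: sumr_ge0 => k _; rewrite !mulr_ge0 ?cabs_ge0.
rewrite -[X in _ <= X]ger0_norm ?mulr_ge0 // -ler_sqr ?nnegrE //.
rewrite !real_normK ?num_real //.
have -> : \sum_(0 <= k < n) (wgt k)%:R * cabs (a k) * cabs (lam k) =
    \sum_(k < n) (cabs (a k) * expR (k%:R * b)) * ((wgt k)%:R * expR (- (k%:R * b)) * cabs (lam k)).
  rewrite big_mkord; apply: eq_bigr => k _.
  rewrite expRN; field; exact: lt0r_neq0 (expR_gt0 _).
apply: (le_trans (cauchy_schwarz _ _)).
rewrite exprMn [M ^+ 2 * _]mulrC; apply: ler_pM.
- by apply: sumr_ge0 => k _; exact: sqr_ge0.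
- by apply: sumr_ge0 => k _; exact: sqr_ge0.
- by have := ha; rewrite big_mkord.
- by have := hM n; rewrite big_mkord.
Qed.

End Functional.

End StripApprox.

(** * Tensor products of functionals *)

Section Tensor.
Variables (R : realType) (d : nat).
Local Notation C := R[i].
Implicit Types (F : ('I_d -> C) -> C) (th : 'I_d -> C) (j l : 'I_d).

Definition upd th j (s : C) : 'I_d -> C := fun l => if l == j then s else th l.

Lemma upd_id th j : upd th j (th j) = th.
Proof. by apply/funext => l; rewrite /upd; case: eqP => [->|]. Qed.

Lemma upd_upd th j s t : upd (upd th j s) j t = upd th j t.
Proof. by apply/funext => l; rewrite /upd; case: eqP. Qed.

Lemma updC th j l s t : j != l -> upd (upd th j s) l t = upd (upd th l t) j s.
Proof.
move=> jl; apply/funext => k; rewrite /upd.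
by have [->|//] := eqVneq k l; rewrite eq_sym (negbTE jl).
Qed.

(** Holomorphy is recorded separately in each angle: this is the property that one-variable
    functionals preserve. *)
Definition box_fun (Y : 'I_d -> R) (W : R) F := forall th j,
  (forall l, `|Im (th l)| < Y l) -> strip_fun (Y j) W (fun s => F (upd th j s)).

Lemma upd_box (Y : 'I_d -> R) th j s :
  (forall l, `|Im (th l)| < Y l) -> `|Im s| < Y j -> forall l, `|Im (upd th j s l)| < Y l.
Proof. by move=> h hs l; rewrite /upd; case: eqP => [->|]. Qed.

Variable I : finType.
Implicit Types (c s : I -> C).

Definition functional_bound (Y : R) c s (K : R) := forall (W : R) G,
  strip_fun Y W G -> cabs (\sum_i c i * G (s i)) <= K * W.

Definition coord_op j c s F th := \sum_i c i * F (upd th j (s i)).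

Lemma cdiff_sum (r : seq I) (G : I -> C -> C) t :
  (forall i, cdiff (G i) t) -> cdiff (fun u => \sum_(i <- r) G i u) t.
Proof.
move=> h; elim: r => [|i r IH].
  by under eq_fun do rewrite big_nil; exact: cdiff_cst.
by under eq_fun do rewrite big_cons; apply: cdiffD.
Qed.

(** In angle j the result is constant; in any other angle it is a finite combination of strip
    functions, and its bound comes from applying the functional with that angle frozen. *)
Lemma coord_op_box (Y : 'I_d -> R) W K j c s F :
  box_fun Y W F -> (forall i, `|Im (s i)| < Y j) -> functional_bound (Y j) c s K ->
  box_fun Y (K * W) (coord_op j c s F).
Proof.
move=> hF hs hK th l hth.
have hbd th' : (forall l, `|Im (th' l)| < Y l) -> cabs (coord_op j c s F th') <= K * W.
  by move=> h; apply: (hK W (fun t => F (upd th' j t))); exact: hF.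
have [->|lj] := eqVneq l j.
  have -> : (fun t => coord_op j c s F (upd th j t)) = fun=> coord_op j c s F th.
    by apply/funext => t; apply: eq_bigr => i _; rewrite upd_upd.
  by split=> [t _|t _|]; [exact: cdiff_cst|exact: hbd|split].
have hi i : strip_fun (Y l) W (fun t => F (upd (upd th j (s i)) l t)).
  by apply: hF; apply: upd_box.
have eqi t : coord_op j c s F (upd th l t) = \sum_i c i * F (upd (upd th j (s i)) l t).
  by apply: eq_bigr => i _; rewrite updC.
split=> [t ht|t ht|].
- rewrite (funext eqi); apply: cdiff_sum => i; apply: cdiffM; first exact: cdiff_cst.
  by have [h _ _] := hi i; exact: h.
- by apply: hbd; apply: upd_box.
- split=> t; rewrite !eqi; apply: eq_bigr => i _; congr (_ * _);
    by have [_ _ [h1 h2]] := hi i; rewrite ?h1 ?h2.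
Qed.

Variables (c s : 'I_d -> I -> C).

(* Partially applied tensor products; in [seq_opE] their multi-indices are the
   total ones that agree with a fixed [k0] outside [r]. *)
Definition seq_op (r : seq 'I_d) F := foldr (fun j H => coord_op j (c j) (s j) H) F r.

Lemma seq_op_box (Y K : 'I_d -> R) W F r :
  box_fun Y W F -> (forall j i, `|Im (s j i)| < Y j) ->
  (forall j, functional_bound (Y j) (c j) (s j) (K j)) ->
  box_fun Y ((\prod_(j <- r) K j) * W) (seq_op r F).
Proof.
move=> hF hs hK; elim: r => [|j r IH]; first by rewrite big_nil mul1r.
by rewrite big_cons -mulrA; apply: coord_op_box.
Qed.

Lemma seq_opE F (k0 : {ffun 'I_d -> I}) r th : uniq r -> seq_op r F th =
  \sum_(k : {ffun 'I_d -> I} | [forall j, (j \notin r) ==> (k j == k0 j)])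
    (\prod_(j <- r) c j (k j)) * F (fun j => if j \in r then s j (k j) else th j).
Proof.
elim: r k0 th => [|j r IH] k0 th /=.
  move=> _; rewrite (big_pred1 k0) => [|k]; first by rewrite big_nil mul1r.
  by rewrite /=; apply/forallP/eqP => [h|-> l //]; apply/ffunP => l; apply/eqP; exact: h.
case/andP => jr ur; rewrite [RHS](partition_big (fun k : {ffun 'I_d -> I} => k j) xpredT) //=.
rewrite /coord_op; apply: eq_bigr => i _.
(* The reference index is altered to i at j, so that the multi-indices left by the induction
   hypothesis are those with value i at j. *)
rewrite (IH [ffun l => if l == j then i else k0 l]) // mulr_sumr; apply: eq_big => [k|k hk].
  apply/forallP/andP => [h|[/forallP h /eqP ki] l].
    split; last by have := implyP (h j) jr; rewrite ffunE eqxx.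
    apply/forallP => l; rewrite inE negb_or; apply/implyP => /andP[lj lr].
    by have := implyP (h l) lr; rewrite ffunE (negbTE lj).
  apply/implyP => lr; rewrite ffunE; have [->|lj] := eqVneq l j; first by rewrite ki.
  by apply: (implyP (h l)); rewrite inE negb_or lj.
have kj : k j = i.
  by have /eqP := implyP (forallP hk j) jr; rewrite ffunE eqxx.
rewrite big_cons kj mulrA; congr (_ * _); congr F; apply/funext => l.
rewrite inE /upd; have [->|lj] := eqVneq l j; last by [].
by rewrite (negbTE jr) kj.
Qed.

Lemma seq_op_enum F (k0 : {ffun 'I_d -> I}) th : seq_op (enum 'I_d) F th =
  \sum_(k : {ffun 'I_d -> I}) (\prod_j c j (k j)) * F (fun j => s j (k j)).
Proof.
rewrite (seq_opE F k0) ?enum_uniq //; apply: eq_big => [k|k _].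
  by apply/forallP => l; rewrite mem_enum.
rewrite big_enum /=; congr (_ * _); congr F; apply/funext => l.
by rewrite mem_enum.
Qed.

Lemma tensor_bound (Y K : 'I_d -> R) W F : (0 < d)%N -> (0 < #|I|)%N ->
  box_fun Y W F -> (forall j, 0 < Y j) -> (forall j i, `|Im (s j i)| < Y j) ->
  (forall j, functional_bound (Y j) (c j) (s j) (K j)) ->
  cabs (\sum_(k : {ffun 'I_d -> I}) (\prod_j c j (k j)) * F (fun j => s j (k j)))
    <= (\prod_j K j) * W.
Proof.
move=> d0 /card_gt0P[i0 _] hF Y0 hs hK.
rewrite -(seq_op_enum F [ffun=> i0] (fun=> 0)).
have := @seq_op_box Y K W F (enum 'I_d) hF hs hK (fun=> 0) (Ordinal d0).
case=> [l|_ h _]; first by rewrite /= normr0.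
have := h 0; rewrite (upd_id (fun=> 0)) /= normr0 big_enum => /(_ (Y0 _)); apply.
Qed.

(** Evaluations are exchanged for functionals one angle at a time. Each exchange costs eta times the
    bound (1 + eta)^m W of the partial product, and these costs add up to (1 + eta)^size - 1. *)
Lemma seq_op_approx (Y : 'I_d -> R) (eta W : R) F ths r th : 0 <= eta ->
  box_fun Y W F -> (forall j i, `|Im (s j i)| < Y j) -> (forall j, `|Im (ths j)| < Y j) ->
  (forall j W G, strip_fun (Y j) W G ->
     cabs (\sum_i c j i * G (s j i) - G (ths j)) <= eta * W) ->
  (forall l, `|Im (th l)| < Y l) ->
  cabs (seq_op r F th - F (fun l => if l \in r then ths l else th l))
    <= ((1 + eta) ^+ size r - 1) * W.
Proof.
move=> eta0 hF hs hths hK; elim: r th => [|j r IH] th hth.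
  by rewrite /= subrr cabs0 expr0 subrr mul0r.
have hK1 l : functional_bound (Y l) (c l) (s l) (1 + eta).
  move=> W' G hG; have [_ hb _] := hG.
  have := le_cabsD (\sum_i c l i * G (s l i) - G (ths l)) (G (ths l)).
  rewrite subrK => /le_trans; apply; rewrite mulrDl mul1r addrC lerD ?hK // hb //.
have hH : box_fun Y ((1 + eta) ^+ size r * W) (seq_op r F).
  by have := @seq_op_box Y (fun=> 1 + eta) W F r hF hs hK1; rewrite big_const_seq count_predT iter_mulr_1.
have h1 := hK j _ _ (hH th j hth).
have hth' := upd_box hth (hths j).
have h2 := IH _ hth'.
rewrite (_ : (fun l => if l \in j :: r then ths l else th l) =
   fun l => if l \in r then ths l else upd th j (ths j) l); last first.
  apply/funext => l; rewrite inE /upd; case: eqP => [->|_] //=; by case: ifP.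
rewrite /= -/(seq_op r F) (_ : _ - _ =
   (coord_op j (c j) (s j) (seq_op r F) th - seq_op r F (upd th j (ths j)))
   + (seq_op r F (upd th j (ths j)) - F (fun l => if l \in r then ths l else upd th j (ths j) l)));
  last by ring.
apply: (le_trans (le_cabsD _ _)); have := lerD h1 h2.
rewrite exprS; set a := _ * _; set b := _ * _; set x := (1 + eta) ^+ _.
rewrite (_ : ((1 + eta) * x - 1) * W = eta * (x * W) + (x - 1) * W); last by ring.
by [].
Qed.

Lemma tensor_approx (Y : 'I_d -> R) (eta W : R) F ths : (0 < #|I|)%N -> 0 <= eta ->
  box_fun Y W F -> (forall j i, `|Im (s j i)| < Y j) -> (forall j, `|Im (ths j)| < Y j) ->
  (forall j W G, strip_fun (Y j) W G ->
     cabs (\sum_i c j i * G (s j i) - G (ths j)) <= eta * W) ->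
  cabs (\sum_(k : {ffun 'I_d -> I}) (\prod_j c j (k j)) * F (fun j => s j (k j)) - F ths)
    <= ((1 + eta) ^+ d - 1) * W.
Proof.
move=> /card_gt0P[i0 _] eta0 hF hs hths hK.
have := @seq_op_approx Y eta W F ths (enum 'I_d) ths eta0 hF hs hths hK hths.
rewrite size_enum_ord (seq_op_enum F [ffun=> i0]).
by rewrite (_ : (fun l => _) = ths) //; apply/funext => l; rewrite mem_enum.
Qed.

End Tensor.

(** * Trapezoidal cosine coefficients *)

Section GridFunctional.
Variable R : realType.
Local Notation C := R[i].
Implicit Types (G : C -> C) (x b e : R).

Lemma expR_small b e : 0 < b -> 0 < e ->
  exists n0, forall n, (n0 <= n)%N -> expR (- (n%:R * b)) <= e.
Proof.
move=> b0 e0; exists (Num.bound ((e * b)^-1)) => n hn.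
have h : (e * b)^-1 < n%:R.
  apply: lt_le_trans (archi_boundP _) _; first by rewrite invr_ge0 mulr_ge0 // ltW.
  by rewrite ler_nat.
rewrite expRN invf_ple ?posrE ?expR_gt0 //.
apply: le_trans (expR_ge1Dx _); rewrite ler_wpDl //.
by move: h; rewrite invfM ltr_pdivrMr // => /ltW.
Qed.

Lemma geometric_tail b (l0 l1 : nat) : 0 < b ->
  \sum_(l0 <= l < l1) expR (- (l%:R * b)) <= expR (- (l0%:R * b)) / (1 - expR (- b)).
Proof.
move=> b0; have q1 : expR (- b) < 1 by rewrite expR_lt1 oppr_lt0.
have d0 : 0 < 1 - expR (- b) by rewrite subr_gt0.
have [h|/ltnW h] := leqP l1 l0.
  by rewrite big_geq // divr_ge0 ?expR_ge0 // ltW.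
rewrite ler_pdivlMr //.
suff -> : (\sum_(l0 <= l < l1) expR (- (l%:R * b))) * (1 - expR (- b)) =
   expR (- (l0%:R * b)) - expR (- (l1%:R * b)) by rewrite gerBl expR_ge0.
rewrite -(subnK h); elim: (l1 - l0)%N => [|m IH]; first by rewrite add0n big_geq // mul0r subrr.
rewrite addSn big_nat_recr ?leq_addl //= mulrDl IH -[(m + l0).+1%:R]natr1 mulrDl mul1r.
by rewrite opprD expRD; ring.
Qed.

(** The weight of grid point m in the k-th trapezoidal cosine coefficient, factor [wgt k]
    included. *)
Definition dft (N k : nat) (m : 'I_N) : C :=
  (wgt k)%:R / N%:R * ck k (grid R N m)%:C.

(** The product of the cosines has frequencies k + l and |k - l|, both below N, so the grid sees
    only a zero frequency. *)
Lemma dft_ck (N k l : nat) : (0 < N)%N -> (k + l < N)%N ->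
  \sum_(m < N) dft k m * ck l (grid R N m)%:C = (k == l)%:R.
Proof.
move=> N0 kl; have NC : (N%:R : C) != 0 by rewrite pnatr_eq0 -lt0n.
have kN : (k < N)%N by apply: leq_ltn_trans kl; exact: leq_addr.
have lN : (l < N)%N by apply: leq_ltn_trans kl; exact: leq_addl.
transitivity ((wgt k)%:R / N%:R / 4 * (
    \sum_(0 <= m < N) cis (grid R N m)%:C ^+ (k + l)
  + \sum_(0 <= m < N) cis (- (grid R N m)%:C) ^+ (k + l)
  + \sum_(0 <= m < N) (cis (grid R N m)%:C ^+ k * cis (- (grid R N m)%:C) ^+ l)
  + \sum_(0 <= m < N) (cis (grid R N m)%:C ^+ l * cis (- (grid R N m)%:C) ^+ k))).
  rewrite -!big_split mulr_sumr big_mkord; apply: eq_bigr => m _ /=.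
  by rewrite /dft /ck !exprD; field; rewrite ?NC ?pnatr_eq0.
rewrite grid_sum // grid_sumN // !grid_orth // [l == k]eq_sym /wgt.
have -> : (N %| k + l)%N = (k + l == 0)%N.
  have [->|p] := posnP (k + l)%N; first by rewrite dvdn0.
  by rewrite gtnNdvd.
rewrite addn_eq0; case: (posnP k) => [->|k0] /=.
  case: (posnP l) => [->|l0] /=; last by rewrite (ltn_eqF l0) !addr0 mulr0.
  by field; rewrite ?NC ?pnatr_eq0.
case: ifP => _ /=; last by rewrite !addr0 mulr0.
by field; rewrite ?NC ?pnatr_eq0.
Qed.

Lemma cabs_dft_le (N k l : nat) : (0 < N)%N ->
  cabs (\sum_(m < N) dft k m * ck l (grid R N m)%:C) <= 2.
Proof.
move=> N0; apply: (le_trans (cabs_sum _ _ _)).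
have -> : (2 : R) = \sum_(m < N) (2 / N%:R).
  by rewrite sumr_const card_ord -[_ *+ N]mulr_natr divfK // pnatr_eq0 -lt0n.
apply: ler_sum => m _; rewrite /dft.
have h j : cabs (ck j (grid R N m)%:C) <= 1.
  by apply: (le_trans (cabs_ck _ _)); rewrite /= normr0 mulr0 expR0.
move: (ck k _) (ck l _) (h k) (h l) => u v hu hv.
rewrite !cabsM cabsV !cabs_nat -mulrA.
apply: (@le_trans _ _ (2 / N%:R * 1)); last by rewrite mulr1.
apply: ler_pM; rewrite ?mulr_ge0 ?invr_ge0 ?cabs_ge0 //.
  by apply: ler_wpM2r; rewrite ?invr_ge0 // ler_nat /wgt; case: (0 < k)%N.
by rewrite -[X in _ <= X]mulr1 ler_pM ?cabs_ge0.
Qed.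

(** Below N - n only l = k contributes to the criterion of [strip_functional_l1]. Beyond, aliasing
    is bounded crudely by 4 = 2 * 2, from [wgt] and [cabs_dft_le], times a geometric tail. *)
Lemma dft_bound (N n k : nat) (Y b : R) : (0 < N)%N -> (k < n)%N -> (n <= N)%N ->
  0 < b -> b < Y ->
  functional_bound Y (@dft N k) (fun m => (grid R N m)%:C)
    ((wgt k)%:R * expR (- (k%:R * b)) + 4 * (expR (- ((N - n)%:R * b)) / (1 - expR (- b)))).
Proof.
move=> N0 kn nN b0 bY W G hG.
apply: (strip_functional_l1 hG (ltW b0) bY) => [m|m].
  by rewrite /= normr0 ltW.
pose g l : R := (wgt l)%:R * expR (- (l%:R * b)) *
  cabs (\sum_(i < N) dft k i * ck l (grid R N i)%:C).
suff : \sum_(0 <= l < m) g l <=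
  (wgt k)%:R * expR (- (k%:R * b)) + 4 * (expR (- ((N - n)%:R * b)) / (1 - expR (- b))) by [].
have g0 l : 0 <= g l by rewrite /g !mulr_ge0 ?expR_ge0 ?cabs_ge0.
apply: (@le_trans _ _ (\sum_(0 <= l < (N - n) + m) g l)).
  rewrite [X in _ <= X](big_cat_nat (n := m)) ?leq_addl //= lerDl.
  by apply: sumr_ge0 => l _.
rewrite (big_cat_nat (n := (N - n)%N)) ?leq_addr //=; apply: lerD.
  apply: (@le_trans _ _ (\sum_(0 <= l < N - n) (if l == k then (wgt k)%:R * expR (- (k%:R * b)) else 0))).
    rewrite big_nat [X in _ <= X]big_nat; apply: ler_sum => l /andP[_ lNn].
    rewrite /g dft_ck //; last by lia.
    by rewrite eq_sym; case: eqP => [->|_]; rewrite ?cabs1 ?cabs0 ?mulr1 ?mulr0.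
  have [kN|kN] := ltnP k (N - n).
    rewrite big_mkord (bigD1 (Ordinal kN)) //= eqxx big1 ?addr0 // => l.
    by rewrite -val_eqE /= => /negbTE ->.
  rewrite big_nat big1 ?mulr_ge0 ?expR_ge0 // => l /andP[_ lN].
  by case: eqP => // h; move: lN; rewrite h ltnNge kN.
apply: (@le_trans _ _ (\sum_(N - n <= l < N - n + m) (4 * expR (- (l%:R * b))))).
  apply: ler_sum => l _; rewrite /g mulrAC; apply: ler_wpM2r; first exact: expR_ge0.
  have -> : (4 : R) = 2 * 2 by rewrite -natrM.
  apply: ler_pM => //; rewrite ?cabs_ge0 ?cabs_dft_le //.
  by rewrite ler_nat /wgt; case: (0 < l)%N.
by rewrite -mulr_sumr ler_pM2l // geometric_tail.
Qed.

Lemma big_option (I : finType) (f : option I -> C) :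
  \sum_(o : option I) f o = f None + \sum_(i : I) f (Some i).
Proof.
rewrite (bigD1 None) //=; congr (_ + _).
rewrite (reindex_omap Some id) /=; last by case.
by apply: eq_bigl => i; rewrite eqxx.
Qed.

(** The point th joins the family as [None] with coefficient -1, which turns the difference into a
    single functional. *)
Lemma functional_diff_bound (I : finType) (c s : I -> C) (th : C) (Y b M : R) :
  0 <= b -> b < Y -> (forall i, `|Im (s i)| <= b) -> `|Im th| <= b ->
  (forall n, \sum_(0 <= l < n) (wgt l)%:R * expR (- (l%:R * b)) *
     cabs (\sum_i c i * ck l (s i) - ck l th) <= M) ->
  forall W G, strip_fun Y W G -> cabs (\sum_i c i * G (s i) - G th) <= M * W.
Proof.
move=> b0 bY hs hth hM W G hG.
pose c' (o : option I) := if o is Some i then c i else -1.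
pose s' (o : option I) := if o is Some i then s i else th.
have E (H : C -> C) : \sum_i c i * H (s i) - H th = \sum_o c' o * H (s' o).
  by rewrite big_option /= mulN1r addrC.
rewrite E; apply: (strip_functional_l1 hG b0 bY) => [[i|]|n] //=.
by apply: le_trans (hM n); apply: ler_sum => l _; rewrite E.
Qed.

(** On [ck l] the synthesis is exact for l < n and gives 0 for n <= l < N - n. The first term of the
    bound is thus the truncated tail, the second the aliasing beyond N - n. *)
Lemma dft_synthesis_bound (N n : nat) (Y b rho : R) (th : C) : (0 < n)%N -> (2 * n <= N)%N ->
  0 <= rho -> rho < b -> b < Y -> `|Im th| <= rho ->
  forall W G, strip_fun Y W G ->
  cabs (\sum_(m < N) (\sum_(k < n) ck k th * dft k m) * G (grid R N m)%:C - G th) <=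
    (2 * (expR (- (n%:R * (b - rho))) / (1 - expR (- (b - rho))))
    + 4 * n%:R * expR (n%:R * rho) * (expR (- ((N - n)%:R * b)) / (1 - expR (- b)))) * W.
Proof.
move=> n0 nN rho0 rb bY hth; have N0 : (0 < N)%N by lia.
have b0 : 0 < b by exact: le_lt_trans rb.
apply: functional_diff_bound (ltW b0) bY _ _ _.
- by move=> m; rewrite /= normr0 ltW.
- by apply: le_trans hth _; exact: ltW.
move=> m.
have swap l : \sum_(i < N) (\sum_(k < n) ck k th * dft k i) * ck l (grid R N i)%:C =
    \sum_(k < n) ck k th * \sum_(i < N) dft k i * ck l (grid R N i)%:C.
  under eq_bigr do rewrite mulr_suml.
  rewrite exchange_big; apply: eq_bigr => k _; rewrite mulr_sumr; apply: eq_bigr => i _.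
  by rewrite mulrA.
have ckth l : cabs (ck l th) <= expR (l%:R * rho).
  by apply: (le_trans (cabs_ck _ _)); rewrite ler_expR ler_wpM2l.
pose g l : R := (wgt l)%:R * expR (- (l%:R * b)) *
  cabs (\sum_(i < N) (\sum_(k < n) ck k th * dft k i) * ck l (grid R N i)%:C - ck l th).
suff : \sum_(0 <= l < m) g l <= 2 * (expR (- (n%:R * (b - rho))) / (1 - expR (- (b - rho))))
    + 4 * n%:R * expR (n%:R * rho) * (expR (- ((N - n)%:R * b)) / (1 - expR (- b))) by [].
pose g1 l := 2 * expR (- (l%:R * (b - rho))).
pose g2 l := 4 * n%:R * expR (n%:R * rho) * expR (- (l%:R * b)).
have w2 l : (wgt l)%:R <= 2 :> R by rewrite ler_nat /wgt; case: (0 < l)%N.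
have hlow l : (l < n)%N -> g l = 0.
  move=> ln; rewrite /g swap (bigD1 (Ordinal ln)) //= dft_ck //; last by lia.
  rewrite eqxx mulr1 big1 ?addr0 ?subrr ?cabs0 ?mulr0 // => k.
  rewrite -val_eqE /= => kl; rewrite dft_ck //; last by case: k kl => k /= *; lia.
  by rewrite (negbTE kl) mulr0.
have hmid l : (n <= l)%N -> (l < N - n)%N -> g l <= g1 l.
  move=> nl lN; rewrite /g swap big1 ?sub0r ?cabsN; last first.
    move=> k _; rewrite dft_ck //; last by case: k => k /= *; lia.
    by case: eqP => [h|_]; [case: k h => k /= *; lia|rewrite mulr0].
  rewrite /g1 -mulrA; apply: ler_pM; rewrite ?mulr_ge0 ?expR_ge0 ?cabs_ge0 //.
  rewrite mulrBr opprB expRD mulrC; apply: ler_wpM2r => //; exact: expR_ge0.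
have hhigh l : g l <= g1 l + g2 l.
  have A : cabs (\sum_(i < N) (\sum_(k < n) ck k th * dft k i) * ck l (grid R N i)%:C - ck l th)
      <= n%:R * (expR (n%:R * rho) * 2) + expR (l%:R * rho).
    apply: (le_trans (le_cabsB _ _)); apply: lerD => //.
    rewrite swap; apply: (le_trans (cabs_sum _ _ _)).
    rewrite -[X in X%:R * _]card_ord mulr_natl -sumr_const; apply: ler_sum => k _.
    rewrite cabsM; apply: ler_pM; rewrite ?cabs_ge0 ?cabs_dft_le //.
    apply: (le_trans (ckth _)); rewrite ler_expR ler_wpM2r // ler_nat ltnW //.
  rewrite /g; apply: (@le_trans _ _ (2 * expR (- (l%:R * b)) *
      (n%:R * (expR (n%:R * rho) * 2) + expR (l%:R * rho)))).
    apply: ler_pM; rewrite ?mulr_ge0 ?expR_ge0 ?cabs_ge0 //.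
    by apply: ler_wpM2r; rewrite ?expR_ge0.
  rewrite /g1 /g2 mulrDr addrC; apply: lerD.
    by rewrite -mulrA -expRD mulrBr opprB addrC.
  by rewrite le_eqVlt; apply/orP; left; apply/eqP; ring.
have g10 l : 0 <= g1 l by rewrite /g1 mulr_ge0 ?expR_ge0.
have g20 l : 0 <= g2 l by rewrite /g2 !mulr_ge0 ?expR_ge0.
apply: (@le_trans _ _ (\sum_(0 <= l < m + N) g l)).
  rewrite [X in _ <= X](big_cat_nat (n := m)) ?leq_addr //= lerDl.
  by apply: sumr_ge0 => l _; rewrite /g !mulr_ge0 ?expR_ge0 ?cabs_ge0.
rewrite (big_cat_nat (n := n)) //=; last by lia.
rewrite big_nat big1 ?add0r; last by move=> l /andP[_ ln]; exact: hlow.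
apply: (@le_trans _ _ (\sum_(n <= l < m + N) g1 l + \sum_(N - n <= l < m + N) g2 l)).
  rewrite [X in _ <= X + _](big_cat_nat (n := (N - n)%N)) //=; [|lia|lia].
  rewrite [X in X <= _](big_cat_nat (n := (N - n)%N)) //=; [|lia|lia].
  rewrite -addrA -big_split; apply: lerD; last by apply: ler_sum => l _; exact: hhigh.
  by rewrite big_nat [X in _ <= X]big_nat; apply: ler_sum => l /andP[? ?]; exact: hmid.
rewrite /g1 /g2 -!mulr_sumr; apply: lerD; (apply: ler_wpM2l; last apply: geometric_tail => //).
- by [].
- by rewrite subr_gt0.
- by rewrite !mulr_ge0 ?expR_ge0.
Qed.

End GridFunctional.

(** * Interpolation at the Chebyshev nodes *)

Section Chebyshev.
Variables (R : realType) (K : nat).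
Hypothesis K0 : (0 < K)%N.
Local Notation C := R[i].
Implicit Types (th : C).

Definition node (m : nat) : R := pi * (2 * m + 1)%:R / (2 * K)%:R.

Lemma ccosR (x : R) : ccos x%:C = (cos x)%:C.
Proof.
rewrite ccosE -rmorphN !cisR cosN sinN; apply/eqP; rewrite eq_complex /=.
by apply/andP; split; apply/eqP; field; rewrite ?pnatr_eq0.
Qed.

Lemma ck_real k (x : R) : ck k x%:C = (Re (cis x%:C ^+ k))%:C.
Proof. by rewrite ReJ_add conj_cisX. Qed.

Lemma ccos_node m : ccos (node m)%:C = (cheb_node R K m)%:C.
Proof. exact: ccosR. Qed.

Lemma node_itv m : (m < K)%N -> 0 <= node m <= pi.
Proof.
move=> mK; rewrite /node divr_ge0 ?mulr_ge0 ?pi_ge0 //= ler_pdivrMr ?ltr0n ?muln_gt0 //.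
by rewrite ler_pM2l ?pi_gt0 // ler_nat; lia.
Qed.

Lemma cheb_node_inj (m n : 'I_K) : cheb_node R K m = cheb_node R K n -> m = n.
Proof.
move=> /cos_inj h; apply: ord_inj.
have /h : node m \in `[0, pi] by rewrite in_itv /= node_itv.
move=> {}h; have /h : node n \in `[0, pi] by rewrite in_itv /= node_itv.
have p0 : (pi : R) != 0 by rewrite gt_eqF // pi_gt0.
have k0 : ((2 * K)%:R : R)^-1 != 0 by rewrite invr_eq0 pnatr_eq0; lia.
by move=> /(mulIf k0) /(mulfI p0) /eqP; rewrite eqr_nat => /eqP; lia.
Qed.

Lemma ck_rec k th : ck k.+2 th = 2 * ccos th * ck k.+1 th - ck k th.
Proof.
rewrite ccosE /ck cisN; set z := cis th; have z0 : z != 0 by exact: cis_neq0.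
rewrite !exprS; set zk := z ^+ k; set wk := z^-1 ^+ k.
by field; rewrite ?z0 ?pnatr_eq0.
Qed.

Lemma cheb_poly k : exists p : {poly C}, (size p <= k.+1)%N /\
  forall th, p.[ccos th] = ck k th.
Proof.
suff : (exists p : {poly C}, (size p <= k.+1)%N /\ forall th, p.[ccos th] = ck k th) /\
  (exists p : {poly C}, (size p <= k.+2)%N /\ forall th, p.[ccos th] = ck k.+1 th) by case.
elim: k => [|k [h1 [p [sp hp]]]].
  split; first by exists 1; rewrite size_poly1; split=> // th; rewrite hornerC ck0.
  exists 'X; rewrite size_polyX; split=> // th; by rewrite hornerX ccosE /ck !expr1.
split; first by exists p.
have [q [sq hq]] := h1; exists (2%:P * 'X * p - q); split=> [|th]; last first.
  by rewrite hornerD hornerN !hornerM hornerC hornerX hp hq ck_rec.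
apply: (leq_trans (size_polyD _ _)); rewrite geq_max size_polyN; apply/andP; split; last first.
  by apply: leq_trans sq _; rewrite ltnW.
apply: (leq_trans (size_polyMleq _ _)).
have : (size ((2%:P * 'X)%R : {poly C}) <= 2)%N.
  by rewrite mul_polyC (leq_trans (size_scale_leq _ _)) // size_polyX.
by move=> h2; have := leq_add h2 sp; rewrite !addSn add0n; case: (_ + _)%N.
Qed.

(** The difference of both sides is a polynomial of size at most K that vanishes at K distinct
    nodes. *)
Lemma lagrange_interp (p : {poly C}) (y : C) : (size p <= K)%N ->
  \sum_(m < K) p.[(cheb_node R K m)%:C] * Defs.lagrange m y = p.[y].
Proof.
move=> sp.
pose x (m : 'I_K) := (cheb_node R K m)%:C.
pose L (m : 'I_K) : {poly C} := \prod_(i < K | i != m) ((x m - x i)^-1 *: ('X - (x i)%:P)).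
have LE m z : (L m).[z] = Defs.lagrange m z.
  rewrite /L /Defs.lagrange horner_prod; apply: eq_bigr => i _.
  by rewrite hornerZ hornerXsubC mulrC.
have xinj (m i : 'I_K) : i != m -> x m - x i != 0.
  by apply: contra; rewrite subr_eq0 => /eqP /complexI /cheb_node_inj ->.
have Lx m n : (L m).[x n] = (m == n)%:R.
  rewrite /L horner_prod; case: eqP => [->|/eqP mn].
    by apply: big1 => i im; rewrite hornerZ hornerXsubC mulVf // xinj.
  by rewrite (bigD1 n) 1?eq_sym //= hornerZ hornerXsubC subrr mulr0 mul0r.
have sL m : (size (L m) <= K)%N.
  apply: (leq_trans (size_poly_prod_leq _ _)).
  have : (\sum_(i < K | i != m) size ((x m - x i)^-1 *: ('X - (x i)%:P)) <= \sum_(i < K | i != m) 2)%N.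
    by apply: leq_sum => i _; rewrite (leq_trans (size_scale_leq _ _)) // size_XsubC.
  rewrite sum_nat_const.
  have : (#|[pred i | i != m]| = K.-1)%N by rewrite -[K in RHS]card_ord cardC1.
  move=> hc hs; rewrite leq_subLR; apply: leq_ltn_trans hs _.
  rewrite muln2 -addnn ltn_add2l.
  apply: (@leq_ltn_trans K.-1); first by rewrite -hc.
  by rewrite prednK.
suff h : \sum_(m < K) p.[x m] *: L m = p.
  transitivity (\sum_(m < K) p.[x m] *: L m).[y]; last by rewrite h.
  by rewrite horner_sum; apply: eq_bigr => m _; rewrite hornerZ LE.
apply/eqP; rewrite -subr_eq0; apply/negPn/negP => D0.
have := max_poly_roots D0 (rs := [seq x m | m <- enum 'I_K]).
rewrite size_map size_enum_ord ltnNge; case/(_ _ _)/negP.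
- apply/allP => _ /mapP[n _ ->]; rewrite rootE !hornerE horner_sum (bigD1 n) //= big1.
    by rewrite hornerZ Lx eqxx mulr1 addr0 subrr.
  by move=> m /negbTE mn; rewrite hornerZ Lx mn mulr0.
- rewrite map_inj_uniq ?enum_uniq // => m n /complexI; exact: cheb_node_inj.
apply: (leq_trans (size_polyD _ _)); rewrite geq_max size_polyN sp andbT.
by apply: (leq_trans (size_sum _ _ _)); apply/bigmax_leqP => m _; rewrite (leq_trans (size_scale_leq _ _)).
Qed.

(* The interpolant of [ck l]; [Defs.lagrange] because MathComp has its own
   [lagrange]. *)
Definition alias (l : nat) th : C := \sum_(m < K) Defs.lagrange m (ccos th) * ck l (node m)%:C.

Lemma alias_id l th : (l < K)%N -> alias l th = ck l th.
Proof.
move=> lK; have [p [sp hp]] := cheb_poly l.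
rewrite -hp -(lagrange_interp (ccos th) (leq_trans sp lK)) /alias.
by apply: eq_bigr => m _; rewrite mulrC -ccos_node hp.
Qed.

(** 2 K times a node is an odd multiple of pi. All aliasing follows: at the nodes the cosines of
    frequency 2 K + l and 2 K - l are minus that of frequency l. *)
Lemma cis_node m : cis (node m)%:C ^+ (2 * K) = -1.
Proof.
rewrite -cisM -(rmorph_nat (real_complex R)) -rmorphM.
have -> : (2 * K)%:R * node m = pi + 2 * pi * (m%:Z)%:~R.
  rewrite /node natrD natrM -pmulrn; field; rewrite pnatr_eq0; lia.
rewrite rmorphD; rewrite (@periodic_int _ (@cis R)); last first.
  by move=> s; rewrite cisD cis_2pi mulr1.
by rewrite cisR cospi sinpi; apply/eqP; rewrite eq_complex /= oppr0 !eqxx.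
Qed.

Lemma cis_nodeN m : cis (- (node m)%:C) ^+ (2 * K) = -1.
Proof. by rewrite cisN exprVn cis_node invrN1. Qed.

Lemma alias_shift l th : alias (2 * K + l) th = - alias l th.
Proof.
rewrite /alias -sumrN; apply: eq_bigr => m _.
by rewrite /ck !(exprD _ (2 * K) l) cis_node cis_nodeN; ring.
Qed.

Lemma alias_reflect l th : (l <= 2 * K)%N -> alias (2 * K - l) th = - alias l th.
Proof.
move=> lK; rewrite /alias -sumrN; apply: eq_bigr => m _.
have h (z : C) : z != 0 -> z ^+ (2 * K) = -1 -> z ^+ (2 * K - l) = - z^-1 ^+ l.
  move=> z0 zK; have zl : z ^+ l != 0 by rewrite expf_neq0.
  by apply: (mulIf zl); rewrite -exprD subnK // zK mulNr -exprMn mulVf // expr1n.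
rewrite /ck (h _ (cis_neq0 _) (cis_node m)) (h _ (cis_neq0 _) (cis_nodeN m)).
by rewrite cisN invrK; ring.
Qed.

(** K is the fixed point of the reflection, which changes the sign. *)
Lemma alias_K th : alias K th = 0.
Proof.
have := alias_reflect th (leq_pmull K (ltn0Sn 1)).
rewrite (_ : 2 * K - K = K)%N; last by lia.
by move/eqP; rewrite -addr_eq0 -mulr2n mulrn_eq0 => /eqP.
Qed.

(** Shift and reflection only lower the frequency, until it is K or below K, where interpolation is
    exact. Hence no Lebesgue constant enters. *)
Lemma cabs_alias l th : cabs (alias l th) <= expR (l%:R * `|Im th|).
Proof.
elim/ltn_ind: l => l IH.
have mono i : (i <= l)%N -> expR (i%:R * `|Im th|) <= expR (l%:R * `|Im th|).
  by move=> il; rewrite ler_expR ler_wpM2r // ler_nat.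
have [lK|Kl] := ltnP l K; first by rewrite alias_id // cabs_ck.
have [l2|l2] := leqP (2 * K) l.
  rewrite -(subnKC l2) alias_shift cabsN subnKC //; apply: le_trans (IH _ _) (mono _ _); lia.
have [e|lK] := eqVneq l K; first by rewrite e alias_K cabs0 expR_ge0.
rewrite -(subKn (ltnW l2)) alias_reflect ?leq_subr // cabsN subKn ?(ltnW l2) //.
by apply: le_trans (IH _ _) (mono _ _); lia.
Qed.

(** The K nodes and their reflections form a translate of the uniform grid of 2 K points, on which
    the characters sum to 0; evenness makes the two halves equal. *)
Lemma node_sum j : (0 < j < 2 * K)%N -> \sum_(m < K) ck j (node m)%:C = 0.
Proof.
move=> /andP[j0 j2].
have full : \sum_(0 <= m < K + K) ck j (node m)%:C = 0.
  have K20 : (0 < K + K)%N by rewrite addn_gt0 K0.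
  have e m : cis (node m)%:C ^+ j = cis (node 0)%:C ^+ j * cis (grid R (K + K) m)%:C ^+ j.
    rewrite -exprMn -cisD -rmorphD; congr (cis _%:C ^+ _); rewrite /node /grid.
    by rewrite !natrD !natrM; field; rewrite -natrD pnatr_eq0; lia.
  have eN m : cis (- (node m)%:C) ^+ j = cis (- (node 0)%:C) ^+ j * cis (- (grid R (K + K) m)%:C) ^+ j.
    by rewrite !cisN !exprVn e invfM.
  have nd : (K + K %| j)%N = false by rewrite gtnNdvd // addnn -mul2n.
  rewrite /ck -mulr_suml big_split /=.
  under eq_bigr do rewrite e.
  under [X in _ + X]eq_bigr do rewrite eN.
  by rewrite -!mulr_sumr grid_sum // grid_sumN // nd !mulr0 addr0 mul0r.
rewrite sum_natDD in full.
have sym : \sum_(0 <= m < K) ck j (node (m + K))%:C = \sum_(0 <= m < K) ck j (node m)%:C.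
  rewrite big_nat_rev /=; apply: eq_big_nat => m /andP[_ mK].
  rewrite -[RHS]ckN /ck opprK.
  have -> : (node (0 + K - m.+1 + K))%:C = - (node m)%:C + (2 * pi)%:C.
    rewrite -rmorphN -rmorphD; congr (_%:C); rewrite /node.
    have -> : (2 * (0 + K - m.+1 + K) + 1 = 2 * (2 * K) - (2 * m + 1))%N by lia.
    rewrite natrB; last by lia.
    by rewrite natrM; field; rewrite pnatr_eq0; lia.
  by rewrite opprD !cisD [cis (- (2 * pi)%:C)]cisN cis_2pi invr1 !mulr1 opprK.
move: full; rewrite sym -mulr2n => /eqP; rewrite mulrn_eq0 /= => /eqP; by rewrite big_mkord.
Qed.

Lemma node_orth (k l : 'I_K) :
  \sum_(m < K) (wgt k)%:R / K%:R * ck k (node m)%:C * ck l (node m)%:C = (k == l)%:R.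
Proof.
have KC : (K%:R : C) != 0 by rewrite pnatr_eq0 -lt0n.
wlog kl : k l / (l <= k)%N => [hw|].
  have [|/ltnW lk] := leqP l k; first exact: hw.
  have [->|kl] := eqVneq k l; first by have := hw l l (leqnn l); rewrite eqxx.
  have := hw l k lk; rewrite eq_sym (negbTE kl) => h0.
  have w0 : (wgt l)%:R / K%:R != 0 :> C by rewrite mulf_neq0 ?invr_eq0 // /wgt pnatr_eq0.
  under eq_bigr do rewrite -mulrA; rewrite -mulr_sumr.
  move: h0; under eq_bigr do rewrite -mulrA; rewrite -mulr_sumr => /eqP.
  rewrite mulf_eq0 (negbTE w0) /= => /eqP h0; rewrite [X in _ * X](_ : _ = 0) ?mulr0 // -[RHS]h0.
  by apply: eq_bigr => m _; rewrite mulrC.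
have prod m : ck k (node m)%:C * ck l (node m)%:C =
    (ck (k + l) (node m)%:C + ck (k - l) (node m)%:C) / 2.
  rewrite /ck !exprD !cisN; set z := cis _; have z0 : z != 0 by exact: cis_neq0.
  have -> : z ^+ k = z ^+ (k - l) * z ^+ l by rewrite -exprD subnK.
  have -> : z^-1 ^+ k = z^-1 ^+ (k - l) * z^-1 ^+ l by rewrite -exprD subnK.
  have zz : z ^+ l * z^-1 ^+ l = 1 by rewrite -exprMn divff // expr1n.
  set a := z ^+ (k - l); set b := z^-1 ^+ (k - l).
  set x := z ^+ l in zz *; set y := z^-1 ^+ l in zz *.
  have -> : (a * x + b * y) / 2 * ((x + y) / 2) =
    (a * x * x + b * y * y + a * (x * y) + b * (x * y)) / 4 by field; rewrite ?pnatr_eq0.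
  by rewrite zz; field; rewrite ?pnatr_eq0.
under eq_bigr do rewrite -mulrA prod.
rewrite -mulr_sumr -mulr_suml big_split /=.
have [e|ne] := eqVneq k l.
  rewrite e subnn; under [X in _ + X]eq_bigr do rewrite ck0.
  rewrite sumr_const card_ord /wgt; have [l0|l0] := posnP l.
    rewrite l0; under eq_bigr do rewrite ck0.
    by rewrite sumr_const card_ord /=; field.
  by rewrite node_sum ?add0r /=; [field; rewrite ?KC ?pnatr_eq0|have := ltn_ord l; lia].
rewrite !node_sum ?addr0 ?mul0r ?mulr0 //; move: ne; rewrite -val_eqE /= => ne;
  have := ltn_ord k; have := ltn_ord l; lia.
Qed.

(** For square matrices a one-sided inverse is two-sided: orthogonality over the nodes becomes
    orthogonality over the frequencies. *)
Lemma node_orth_dual (m n : 'I_K) :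
  \sum_(k < K) (wgt k)%:R / K%:R * ck k (node m)%:C * ck k (node n)%:C = (m == n)%:R.
Proof.
pose A := \matrix_(k < K, m < K) ((wgt k)%:R / K%:R * ck k (node m)%:C : C).
pose B := \matrix_(m < K, k < K) (ck k (node m)%:C : C).
have AB : A *m B = 1%:M.
  apply/matrixP => k l; rewrite !mxE -(node_orth k l).
  by apply: eq_bigr => i _; rewrite !mxE.
have := congr1 (fun M : 'M[C]_(K, K) => M n m) (mulmx1C AB); rewrite !mxE eq_sym => <-.
by apply: eq_bigr => k _; rewrite !mxE mulrC.
Qed.

(** A Parseval identity: the Lagrange values at th are the discrete cosine transform of the numbers
    [ck k th], because interpolation reproduces these for k < K. *)
Lemma lagrange_l2 th : K%:R * \sum_(m < K) cabs (Defs.lagrange m (ccos th)) ^+ 2 =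
  \sum_(k < K) (wgt k)%:R * cabs (ck k th) ^+ 2 :> R.
Proof.
have KR : (K%:R : R) != 0 by rewrite pnatr_eq0 -lt0n.
have cE (m : 'I_K) : Defs.lagrange m (ccos th) =
    \sum_(k < K) (wgt k)%:R / K%:R * ck k (node m)%:C * ck k th.
  transitivity (\sum_(n < K) Defs.lagrange n (ccos th) * (n == m)%:R).
    rewrite (bigD1 m) //= eqxx mulr1 big1 ?addr0 // => n /negbTE ->; by rewrite mulr0.
  under eq_bigr do rewrite -node_orth_dual mulr_sumr.
  rewrite exchange_big; apply: eq_bigr => k _ /=.
  transitivity ((wgt k)%:R / K%:R * ck k (node m)%:C * alias k th); last by rewrite alias_id.
  have rearr (a b u v : C) : a * (b * u * v) = b * v * (a * u) by ring.
  by rewrite /alias mulr_sumr; apply: eq_bigr => n _; exact: rearr.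
apply: complexI; rewrite !rmorphM /= rmorph_nat !rmorph_sum /=.
transitivity (K%:R * \sum_(m < K) Defs.lagrange m (ccos th) * ((Defs.lagrange m (ccos th))^*)%C).
  by congr (_ * _); apply: eq_bigr => m _; exact: sqr_cabsJ.
have ckreal k m : ((ck k (node m)%:C)^*)%C = ck k (node m)%:C by rewrite ck_real conjc_real.
have cJ (m : 'I_K) : ((Defs.lagrange m (ccos th))^*)%C =
    \sum_(k < K) (wgt k)%:R / K%:R * ck k (node m)%:C * ((ck k th)^*)%C.
  have coJ k : (((wgt k)%:R / K%:R)^*)%C = (wgt k)%:R / K%:R :> C.
    by rewrite fmorph_div !rmorph_nat.
  rewrite cE rmorph_sum; apply: eq_bigr => k _.
  have conjM3 (x y z : C) : ((x * y * z)^*)%C = (x^*)%C * (y^*)%C * (z^*)%C.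
    by rewrite !rmorphM.
  by rewrite -[RHS](congr1 (fun u => u * _) (congr2 *%R (coJ k) (ckreal k m))); exact: conjM3.
transitivity (\sum_(m < K) \sum_(k < K) K%:R * (Defs.lagrange m (ccos th) *
    ((wgt k)%:R / K%:R * ck k (node m)%:C * ((ck k th)^*)%C))).
  rewrite mulr_sumr; apply: eq_bigr => m _; rewrite -mulr_sumr -mulr_sumr.
  congr (_ * (_ * _)); exact: cJ.
rewrite exchange_big; apply: eq_bigr => k _ /=.
transitivity ((wgt k)%:R * (ck k th * ((ck k th)^*)%C)); last first.
  by rewrite -sqr_cabsJ [RHS]rmorphM rmorph_nat.
transitivity ((wgt k)%:R * (alias k th * ((ck k th)^*)%C)); last by rewrite alias_id.
rewrite /alias mulr_suml mulr_sumr; apply: eq_bigr => m _.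
have rearr (n a b u v : C) : n != 0 -> n * (a * (b / n * u * v)) = b * (a * u * v).
  by move=> n0; field.
by apply: rearr; rewrite pnatr_eq0 -lt0n.
Qed.

End Chebyshev.

(** * Norm of interpolation in one variable *)

Section NodeNorm.
Variables (R : realType) (K : nat).
Hypothesis K0 : (0 < K)%N.
Local Notation C := R[i].

Lemma sum_rev1 (f : nat -> R) : \sum_(1 <= k < K) f (K - k)%N = \sum_(1 <= k < K) f k.
Proof.
rewrite big_nat_rev /=; apply: eq_big_nat => k /andP[k0 kK]; congr f; lia.
Qed.

(* Pairing k with K - k: (1 - x^k) (1 - x^(K - k)) >= 0. *)
Lemma sum_pow_le (x : R) : 0 <= x -> \sum_(1 <= k < K) x ^+ k <= (K%:R - 1) * (1 + x ^+ K) / 2.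
Proof.
move=> x0; rewrite ler_pdivlMr // mulr_natr mulr2n -{1}(sum_rev1 (fun k => x ^+ k)) -big_split /=.
have -> : (K%:R - 1) * (1 + x ^+ K) = \sum_(1 <= k < K) (1 + x ^+ K).
  by rewrite sumr_const_nat -[RHS]mulr_natl natrB.
rewrite big_nat [X in _ <= X]big_nat; apply: ler_sum => k /andP[_ kK].
have -> : x ^+ K = x ^+ (K - k) * x ^+ k by rewrite -exprD subnK // ltnW.
have [x1|x1] := leP x 1.
  have := exprn_ile1 (K - k) x0 x1; have := exprn_ile1 k x0 x1; nra.
have := exprn_ege1 (K - k) (ltW x1); have := exprn_ege1 k (ltW x1); nra.
Qed.

Lemma cabs_ck_sqr k (th : C) : 4 * cabs (ck k th) ^+ 2 <=
  expR (2 * `|Im th|) ^+ k + expR (- (2 * `|Im th|)) ^+ k + 2.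
Proof.
set rho := `|Im th|.
have h := cabs_ck_le k th; rewrite -/rho in h.
have e1 : expR (2 * rho) ^+ k = expR (k%:R * rho) ^+ 2.
  by rewrite -!expRM_natl; congr expR; ring.
have e2 : expR (- (2 * rho)) ^+ k = expR (- (k%:R * rho)) ^+ 2.
  by rewrite -!expRM_natl; congr expR; ring.
have e3 : expR (k%:R * rho) * expR (- (k%:R * rho)) = 1 by rewrite -expRD subrr expR0.
have h2 : cabs (ck k th) ^+ 2 <= ((expR (k%:R * rho) + expR (- (k%:R * rho))) / 2) ^+ 2.
  by apply: lerXn2r; rewrite ?nnegrE ?cabs_ge0 // divr_ge0 // addr_ge0 ?expR_ge0.
rewrite e1 e2; move: h2 e3; set a := expR _; set b := expR _; nra.
Qed.

(* Bounds the squared norm of interpolation followed by evaluation in one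
   variable; the estimates for small and for large [`|Im th|] cross at
   [expR (2 * `|Im th|) ^+ K = 7]. *)
Definition node_norm2 : R := 11 / 10 + 7 / 2 * (K%:R - 1).

Lemma node_norm2_ge1 : 1 <= node_norm2.
Proof.
have : 1 <= K%:R :> R by rewrite ler1n.
by rewrite /node_norm2; lra.
Qed.

(** Cauchy-Schwarz and [lagrange_l2] leave 1 + sum (u^k / 2 + 3 / 2). With u^K <= 7, [sum_pow_le]
    bounds this by 1 + (2 + 3 / 2) (K - 1), the source of the slope 7 / 2. *)
Lemma node_norm_small (th : C) : expR (2 * `|Im th|) ^+ K <= 7 ->
  (\sum_(m < K) cabs (Defs.lagrange m (ccos th))) ^+ 2 <= node_norm2.
Proof.
set u := expR _ => u7; have u0 : 0 <= u by exact: expR_ge0.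
have := cauchy_schwarz (fun m : 'I_K => cabs (Defs.lagrange m (ccos th))) (fun=> 1).
under eq_bigr do rewrite mulr1.
move=> /le_trans; apply.
under [X in _ * X]eq_bigr do rewrite expr1n.
rewrite sumr_const card_ord mulrC lagrange_l2 //.
have v1 k : expR (- (2 * `|Im th|)) ^+ k <= 1.
  by apply: exprn_ile1; rewrite ?expR_ge0 // expR_le1 oppr_le0 mulr_ge0.
rewrite -(big_mkord xpredT (fun k => (wgt k)%:R * cabs (ck k th) ^+ 2)) big_ltn // ck0.
rewrite cabs1 expr1n mulr1 /=.
apply: (@le_trans _ _ (1 + \sum_(1 <= k < K) (u ^+ k / 2 + 3 / 2))).
  rewrite lerD2l big_nat [X in _ <= X]big_nat; apply: ler_sum => k /andP[k0 _].
  have := cabs_ck_sqr k th; have := v1 k; rewrite -/u /wgt k0 /=; lra.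
rewrite big_split /= -mulr_suml sumr_const_nat -[_ *+ (K - 1)]mulr_natr natrB //.
have := sum_pow_le u0; have : 1 <= K%:R :> R by rewrite ler1n.
rewrite /node_norm2; set S := \sum_(_ <= _ < _) _; set x := u ^+ K in u7 *.
move: (K%:R) => k k1 hS; nra.
Qed.

(** Up to sign, [alias] has period 2 K in the frequency, so the sum is a geometric series of blocks
    with ratio r = v^(2K) <= 1 / 49. One block is estimated by exactness below K and reflection
    above. *)
Lemma node_norm_large (th : C) : 7 <= expR (2 * `|Im th|) ^+ K -> forall n,
  \sum_(0 <= l < n) ((wgt l)%:R * expR (- (l%:R * `|Im th|)) * cabs (alias K l th)) ^+ 2
    <= node_norm2.
Proof.
move=> u7 n; set rho := `|Im th|; set u := expR _ in u7.
pose v := expR (- (2 * rho)).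
have v0 : 0 < v by exact: expR_gt0.
have v1 : v <= 1 by rewrite expR_le1 oppr_le0 mulr_ge0 // normr_ge0.
have uv k : u ^+ k * v ^+ k = 1 by rewrite -exprMn -expRD subrr expR0 expr1n.
pose h l := 4 * v ^+ l * cabs (alias K l th) ^+ 2.
have h0 l : 0 <= h l by rewrite /h !mulr_ge0 ?exprn_ge0 ?cabs_ge0 // ltW.
have qh l : ((wgt l)%:R * expR (- (l%:R * rho)) * cabs (alias K l th)) ^+ 2 =
    (wgt l)%:R ^+ 2 / 4 * h l.
  rewrite !exprMn /h; have -> : v ^+ l = expR (- (l%:R * rho)) ^+ 2.
    by rewrite /v -!expRM_natl; congr expR; ring.
  by field.
have hshift l : h (2 * K + l)%N = v ^+ (2 * K) * h l.
  by rewrite /h alias_shift // cabsN exprD; ring.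
pose X := \sum_(0 <= l < 2 * K) h l.
pose r := v ^+ (2 * K).
have vK : v ^+ K <= 1 / 7.
  have := uv K; have : 0 < v ^+ K by rewrite exprn_gt0.
  move: u7; set a := u ^+ K; set b := v ^+ K; nra.
have vK0 : 0 < v ^+ K by rewrite exprn_gt0.
have rE : r = v ^+ K ^+ 2 by rewrite /r mulnC exprM.
have r49 : r <= 1 / 49 by rewrite rE expr2; nra.
have r0 : 0 <= r by rewrite rE sqr_ge0.
have X0 : 0 <= X by apply: sumr_ge0.
have Sq q : (1 - r) * \sum_(0 <= l < 2 * K * q) h l <= X.
  elim: q => [|q IH]; first by rewrite muln0 big_geq // mulr0.
  rewrite mulnS (big_cat_nat (n := (2 * K)%N)) ?leq_addr //=.
  rewrite -{2}[(2 * K)%N]add0n big_addn [(2 * K + _ - _)%N]addKn -/X.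
  have -> : \sum_(0 <= i < 2 * K * q) h (i + 2 * K)%N = r * \sum_(0 <= i < 2 * K * q) h i.
    by rewrite mulr_sumr; apply: eq_bigr => l _; rewrite addnC hshift.
  move: IH; set S := \sum_(_ <= _ < _) _; nra.
have K1 : 1 <= K%:R :> R by rewrite ler1n.
(* 164 / 49 collects 1 + 8/7 + 25/49 from the lower half and (1 + 8 + 25) / 49 from the upper one.
   Division by 1 - r >= 48 / 49 then gives 4 * 49/48 - 3 <= 11 / 10 and 164 / 48 <= 7 / 2; the 3 is
   subtracted because [wgt 0] is 1. *)
have Xle : X <= 4 + (K%:R - 1) * (164 / 49).
  have hlow k : (k < K)%N -> h k <= (1 + v ^+ k) ^+ 2.
    move=> kK; rewrite /h alias_id //; have := cabs_ck_sqr k th; rewrite -/rho -/u -/v.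
    have := uv k; have : 0 < v ^+ k by rewrite exprn_gt0.
    set a := u ^+ k; set b := v ^+ k; set y := cabs _ ^+ 2 => b0 ab hy.
    by have := ler_wpM2l (ltW b0) hy; rewrite expr2; nra.
  have hhigh k : (k < K)%N -> h (2 * K - k)%N <= (v ^+ (K - k) + v ^+ K) ^+ 2.
    move=> kK; rewrite /h alias_reflect //; last by lia.
    rewrite cabsN alias_id //; have := cabs_ck_sqr k th; rewrite -/rho -/u -/v.
    have e1 : v ^+ K = v ^+ (K - k) * v ^+ k by rewrite -exprD subnK // ltnW.
    have e2 : v ^+ (2 * K - k) = v ^+ (K - k) * v ^+ K.
      by rewrite -exprD; congr (_ ^+ _); lia.
    rewrite e2 e1.
    have := uv k; have : 0 < v ^+ k by rewrite exprn_gt0.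
    have : 0 < v ^+ (K - k) by rewrite exprn_gt0.
    set a := u ^+ k; set b := v ^+ k; set y := cabs _ ^+ 2; set w := v ^+ (K - k) => w0 b0 ab hy.
    have := ler_wpM2l (ltW (mulr_gt0 (mulr_gt0 w0 w0) b0)) hy.
    have -> : w * w * b * (a + b + 2) = w * w * (a * b) + w * w * b * b + 2 * w * w * b by ring.
    by rewrite ab; lra.
  have -> : X = h 0%N + \sum_(1 <= k < K) h k + h K + \sum_(1 <= k < K) h (2 * K - k)%N.
    rewrite /X (big_cat_nat (n := K)) //=; last by lia.
    rewrite [X in X + _]big_ltn // [X in _ + X]big_ltn; last by lia.
    rewrite -!addrA; do 3!congr (_ + _).
    rewrite -(sum_rev1 (fun k => h (2 * K - k)%N)).
    rewrite -{1}[K.+1]addn1 addnC big_addn [RHS](_ : _ = \sum_(1 <= k < K) h (k + K)%N).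
      by rewrite (_ : 2 * K - K = K)%N //; lia.
    by apply: eq_big_nat => k /andP[_ kK]; congr h; lia.
  have hK : h K = 0 by rewrite /h alias_K // cabs0 expr2 !mulr0.
  have hz : h 0%N = 4 by rewrite /h alias_id // ck0 cabs1 expr0 expr1n !mulr1.
  have s1 : \sum_(1 <= k < K) h k <= \sum_(1 <= k < K) (1 + v ^+ k) ^+ 2.
    by rewrite big_nat [X in _ <= X]big_nat; apply: ler_sum => k /andP[_]; exact: hlow.
  have s2 : \sum_(1 <= k < K) h (2 * K - k)%N <= \sum_(1 <= k < K) (v ^+ k + v ^+ K) ^+ 2.
    rewrite -[X in _ <= X](sum_rev1 (fun k => (v ^+ k + v ^+ K) ^+ 2)).
    by rewrite big_nat [X in _ <= X]big_nat; apply: ler_sum => k /andP[_]; exact: hhigh.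
  have p1 := sum_pow_le (ltW v0); have p2 := sum_pow_le (sqr_ge0 v).
  have cst (c : R) : \sum_(1 <= k < K) c = (K%:R - 1) * c.
    by rewrite sumr_const_nat -[LHS]mulr_natl natrB.
  have e1 : \sum_(1 <= k < K) (1 + v ^+ k) ^+ 2 =
     (K%:R - 1) + 2 * \sum_(1 <= k < K) v ^+ k + \sum_(1 <= k < K) (v ^+ 2) ^+ k.
    rewrite -[X in X + _ + _]mulr1 -cst mulr_sumr -!big_split; apply: eq_bigr => k _ /=.
    by rewrite (exprAC v 2 k); ring.
  have e2 : \sum_(1 <= k < K) (v ^+ k + v ^+ K) ^+ 2 =
     (K%:R - 1) * (v ^+ K) ^+ 2 + 2 * v ^+ K * \sum_(1 <= k < K) v ^+ k
       + \sum_(1 <= k < K) (v ^+ 2) ^+ k.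
    rewrite -cst mulr_sumr -!big_split; apply: eq_bigr => k _ /=.
    by rewrite (exprAC v 2 k); ring.
  rewrite hK hz.
  move: p2; rewrite -exprM -/r => p2; rewrite e1 in s1; rewrite e2 -rE in s2.
  move: s1 s2 p1 p2 vK vK0 r49 r0.
  set A := \sum_(_ <= _ < _) h _; set B := \sum_(_ <= _ < _) h _.
  set S1 := \sum_(_ <= _ < _) v ^+ _; set S2 := \sum_(_ <= _ < _) (v ^+ 2) ^+ _.
  move: (K%:R) (v ^+ K) K1 => k w k1 a1 a2 p1 p2 w1 w0 r1 rr0.
  have q1 : S1 <= (k - 1) * (4 / 7) by nra.
  have q2 : S2 <= (k - 1) * (25 / 49) by nra.
  have q3 : 2 * w * S1 <= (k - 1) * (8 / 49).
    apply: (@le_trans _ _ (2 * w * ((k - 1) * (4 / 7)))); first by rewrite ler_wpM2l // mulr_ge0 // ltW.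
    have : 0 <= k - 1 by rewrite subr_ge0.
    by nra.
  have q4 : (k - 1) * r <= (k - 1) * (1 / 49) by rewrite ler_wpM2l // subr_ge0.
  lra.
have [->|n0] := posnP n; first by rewrite big_geq // (le_trans _ node_norm2_ge1).
have nq : (n <= 2 * K * n)%N by rewrite leq_pmull // muln_gt0.
apply: (@le_trans _ _ (\sum_(0 <= l < 2 * K * n) h l - 3)).
  apply: (@le_trans _ _ (\sum_(0 <= l < n) h l - 3)); last first.
    by rewrite lerD2r [X in _ <= X](big_cat_nat (n := n)) //= lerDl sumr_ge0.
  rewrite big_ltn // [X in _ <= X - _]big_ltn // qh.
  have -> : h 0%N = 4 by rewrite /h alias_id // ck0 cabs1 expr0 expr1n !mulr1.
  apply: (@le_trans _ _ (1 + \sum_(1 <= l < n) h l)); last by lra.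
  apply: lerD; first by rewrite /wgt /= expr1n; lra.
  apply: ler_sum => l _; rewrite qh; apply: ler_piMl => //.
  by rewrite /wgt; case: (0 < l)%N => /=; lra.
have := Sq n; set S := \sum_(_ <= _ < _) _ => hS.
rewrite /node_norm2.
have : (1 - r) * S <= 4 + (K%:R - 1) * (164 / 49) by exact: le_trans Xle.
have S0 : 0 <= S by apply: sumr_ge0.
move: (K%:R) K1 => k k1 hh; nra.
Qed.

Lemma node_functional_bound (Y : R) (th : C) : `|Im th| < Y ->
  functional_bound Y (fun m : 'I_K => Defs.lagrange m (ccos th)) (fun m => (node R K m)%:C)
    (Num.sqrt node_norm2).
Proof.
move=> thY W G hG; have [_ hW _] := hG.
have Y0 : 0 < Y by apply: le_lt_trans thY.
have W0 : 0 <= W by apply: le_trans (cabs_ge0 (G 0)) (hW _ _); rewrite /= normr0.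
have N0 : 0 <= node_norm2 by apply: le_trans node_norm2_ge1.
have [u7|u7] := leP (expR (2 * `|Im th|) ^+ K) 7.
  have h := node_norm_small u7.
  apply: (@le_trans _ _ ((\sum_(m < K) cabs (Defs.lagrange m (ccos th))) * W)).
    apply: (le_trans (cabs_sum _ _ _)); rewrite mulr_suml; apply: ler_sum => m _.
    by rewrite cabsM ler_wpM2l ?cabs_ge0 // hW //= normr0.
  apply: ler_wpM2r => //; rewrite -[X in X <= _]ger0_norm; last first.
    by apply: sumr_ge0 => m _; exact: cabs_ge0.
  by rewrite -sqrtr_sqr ler_sqrt.
apply: (strip_functional_l2 hG (normr_ge0 (Im th)) thY); rewrite ?sqrtr_ge0 //.
  by move=> m; rewrite /= normr0.
move=> n; rewrite sqr_sqrtr //; exact: node_norm_large (ltW u7) n.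
Qed.

End NodeNorm.

(** * The error sum and the error function *)

Section Counting.
Variables (R : realType) (d n : nat).
Implicit Types (k : {ffun 'I_d -> 'I_n}).

Definition maxidx k : nat := \max_j (k j : nat).

Lemma card_maxidx_le m : (m < n)%N -> #|[pred k | (maxidx k <= m)%N]| = (m.+1 ^ d)%N.
Proof.
move=> mn; transitivity #|ffun_on [pred i : 'I_n | (i <= m)%N] : pred {ffun 'I_d -> 'I_n}|.
  apply: eq_card => k; rewrite !inE.
  by apply/bigmax_leqP/ffun_onP => h j; [exact: h|move=> _; exact: h].
rewrite card_ffun_on card_ord; congr (_ ^ _)%N.
transitivity #|codom (widen_ord (mn : (m.+1 <= n)%N))|; last first.
  by rewrite card_codom ?card_ord // => i j /(congr1 val) h; apply: val_inj.
apply: eq_card => i; rewrite !inE; apply/idP/codomP => [im|[j ->]]; last by case: j.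
by exists (Ordinal (im : (i < m.+1)%N)); apply: val_inj.
Qed.

Lemma card_maxidx m : (0 < m)%N -> (m < n)%N ->
  #|[pred k | maxidx k == m]|%:R = m.+1%:R ^+ d - m%:R ^+ d :> R.
Proof.
case: m => // m _ mn.
rewrite -!natrX -(card_maxidx_le mn) -(card_maxidx_le (ltnW mn)).
apply/eqP; rewrite eq_sym subr_eq -natrD eqr_nat; apply/eqP.
rewrite -(cardID [pred k | maxidx k == m.+1]); congr addn; apply: eq_card => k; rewrite !inE.
  by case: eqP => [->|_]; rewrite ?andbF // leqnn.
by rewrite [in RHS]leqNgt; case: eqP => [->|]; rewrite /= ?ltnSn ?andbF //; lia.
Qed.

Lemma sum_maxidx (K : nat) (f : nat -> R) : (0 < K)%N ->
  \sum_(k : {ffun 'I_d -> 'I_n} | (K <= maxidx k)%N) f (maxidx k) =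
  \sum_(K <= m < n) (m.+1%:R ^+ d - m%:R ^+ d) * f m.
Proof.
move=> K0.
have maxn k : (K <= maxidx k)%N -> (maxidx k < n)%N.
  move=> hk; have [n0|n0] := posnP n.
    have : (maxidx k <= 0)%N by apply/bigmax_leqP => j _; apply: leq_trans (ltnW (ltn_ord (k j))) _; rewrite n0.
    by move=> /(leq_trans hk); rewrite leqNgt K0.
  by rewrite -(prednK n0) ltnS; apply/bigmax_leqP => j _; rewrite -ltnS prednK.
have [nK|Kn] := leqP n K.
  rewrite [RHS]big_geq // big_pred0 // => k; apply/negbTE/negP => hk.
  by have := maxn k hk; rewrite ltnNge (leq_trans nK).
have n0 : (0 < n)%N by exact: leq_trans Kn.
pose p k : 'I_n := insubd (Ordinal n0) (maxidx k).
rewrite (partition_big p (fun m : 'I_n => (K <= m)%N)) /=; last first.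
  by move=> k hk; rewrite /p val_insubd maxn.
rewrite [RHS](big_nat_widenl K 0) // big_mkord; apply: eq_big => // m Km.
rewrite -card_maxidx ?(leq_trans K0 Km) // mulr_natl -sumr_const.
apply: eq_big => [k|k /andP[hk /eqP <-]]; last by rewrite /p val_insubd maxn.
rewrite !inE; apply/andP/eqP => [[hk /eqP <-]|hk]; first by rewrite /p val_insubd maxn.
have Kk : (K <= maxidx k)%N by rewrite hk.
by split=> //; apply/eqP; apply: val_inj; rewrite /p val_insubd maxn.
Qed.

End Counting.

(** * Comparison of the error sum with E_(d,K) *)

Section Tail.
Variable R : realType.
Implicit Types (a t : R).

(* [expR (- (a * t)) * tailpoly a m t] is the integral of
   [s ^+ m * expR (- (a * s))] over [s >= t]. *)
Fixpoint tailpoly a (m : nat) t : R :=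
  if m is k.+1 then (t ^+ m + m%:R * tailpoly a k t) / a else a^-1.

Lemma is_derive_tailpoly a m t : a != 0 ->
  is_derive t 1 (tailpoly a m) (a * tailpoly a m t - t ^+ m).
Proof.
move=> a0; elim: m => [|m IH].
  by rewrite /= divff // expr0 subrr; exact: is_derive_cst.
have -> : a * tailpoly a m.+1 t - t ^+ m.+1 = m.+1%:R * tailpoly a m t by rewrite /=; field.
have -> : tailpoly a m.+1 = a^-1 \*: ((@id R) ^+ m.+1 + m.+1%:R \*: tailpoly a m).
  by apply/funext => u; rewrite !fctE /= mulrC.
by apply: is_derive_eq; rewrite /GRing.scale /=; field.
Qed.

Lemma tailpoly_ge0 a m t : 0 < a -> 0 <= t -> 0 <= tailpoly a m t.
Proof.
move=> a0 t0; elim: m => [|m IH] /=; first by rewrite invr_ge0 ltW.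
by rewrite divr_ge0 ?(ltW a0) // addr_ge0 ?exprn_ge0 // mulr_ge0.
Qed.

(** The integral of d s^(d-1) e^(-a(s-1)) over s >= t. The shift by 1 makes the exponential at least
    e^(-na) on [n, n + 1]. *)
Definition tail d a t : R := expR (- (a * (t - 1))) * (d%:R * tailpoly a d.-1 t).

(** By the mean value theorem: tail + e^(-na) t^d has nonpositive derivative on [n, n + 1], which
    compares the summand with the integral over that interval. *)
Lemma tail_step d a (n : nat) : (0 < d)%N -> 0 < a ->
  (n.+1%:R ^+ d - n%:R ^+ d) * expR (- (n%:R * a)) <= tail d a n%:R - tail d a n.+1%:R.
Proof.
case: d => // d _ a0; have an0 : a != 0 by rewrite gt_eqF.
pose c := expR (- (n%:R * a)).
pose f : R -> R := fun t => tail d.+1 a t + c *: t ^+ d.+1.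
pose df t := d.+1%:R * t ^+ d * (c - expR (- (a * (t - 1)))).
have fd t : is_derive t 1 f (df t).
  have he : is_derive t 1 (fun u => expR (- (a * (u - 1)))) (- a * expR (- (a * (t - 1)))).
    have -> : (fun u => expR (- (a * (u - 1)))) = expR \o ((- a) \*: (@id R - cst 1)).
      by apply/funext => u; rewrite /= !fctE /GRing.scale /= mulNr.
    apply: is_derive_eq; rewrite /GRing.scale /= ?fctE subr0 mulr1.
    by rewrite -[- a *: (t - 1)]/(- a * (t - 1)) mulNr mulrC.
  have ht := is_derive_tailpoly d t an0.
  have -> : f = (fun u => expR (- (a * (u - 1)))) * (d.+1%:R \*: tailpoly a d) + c \*: (@id R) ^+ d.+1.
    by apply/funext => u; rewrite !fctE.
  apply: is_derive_eq; rewrite /df /GRing.scale /= ?fctE.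
  by rewrite -[_ *: tailpoly a d t]/(d.+1%:R * tailpoly a d t); ring.
have nn : n%:R <= n.+1%:R :> R by rewrite ler_nat.
have [u un] : exists2 u, u \in `[n%:R, n.+1%:R : R] & f n.+1%:R - f n%:R = df u * (n.+1%:R - n%:R).
  apply: MVT_segment => //.
  apply: continuous_subspaceT => x; apply: differentiable_continuous.
  by apply/derivable1_diffP; case: (fd x).
rewrite (_ : n.+1%:R - n%:R = 1) ?mulr1 => [hf|]; last by rewrite -[n.+1%:R]natr1; ring.
have : df u <= 0.
  move: un; rewrite in_itv /= => /andP[u1 u2].
  have u0 : 0 <= u by apply: le_trans u1.
  rewrite /df mulr_ge0_le0 ?mulr_ge0 ?exprn_ge0 // subr_le0 /c ler_expR lerN2 [a * _]mulrC.
  by rewrite ler_wpM2r ?(ltW a0) // lerBlDr natr1.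
rewrite -hf /f /GRing.scale /= /c; lra.
Qed.

Lemma sum_tail d a (K n : nat) : (0 < d)%N -> 0 < a ->
  \sum_(K <= m < n) (m.+1%:R ^+ d - m%:R ^+ d) * expR (- (m%:R * a)) <= tail d a K%:R.
Proof.
move=> d0 a0; have tail0 m : 0 <= tail d a m%:R.
  by rewrite /tail mulr_ge0 ?expR_ge0 // mulr_ge0 // tailpoly_ge0.
have [nK|/ltnW Kn] := leqP n K; first by rewrite big_geq.
apply: (@le_trans _ _ (\sum_(K <= m < n) (tail d a m%:R - tail d a m.+1%:R))).
  by apply: ler_sum => m _; exact: tail_step.
rewrite -[X in X <= _]opprK -sumrN (eq_bigr (fun m => tail d a m.+1%:R - tail d a m%:R)).
  by rewrite telescope_sumr // opprB gerBl.
by move=> m _; rewrite opprB.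
Qed.

(** For m <= a K the recursion multiplies earlier terms by factors k / (a K) <= 1 relative to the
    leading one, so m + 1 copies of K^m / a suffice. *)
Lemma tailpoly_le a m (K : R) : 0 < a -> 0 < K -> m%:R <= a * K ->
  tailpoly a m K <= m.+1%:R * K ^+ m / a.
Proof.
move=> a0 K0; elim: m => [|m IH] hm; first by rewrite /= expr0 mulr1 mul1r.
have {}IH : tailpoly a m K <= m.+1%:R * K ^+ m / a.
  by apply: IH; apply: le_trans hm; rewrite ler_nat.
rewrite [X in X <= _]/= ler_wpM2r ?invr_ge0 ?(ltW a0) //.
have hT : tailpoly a m K <= K ^+ m.+1.
  apply: (le_trans IH); rewrite ler_pdivrMr //.
  rewrite (_ : K ^+ m.+1 * a = (a * K) * K ^+ m); last by rewrite exprS; ring.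
  by rewrite ler_wpM2r // exprn_ge0 // ltW.
by rewrite -[m.+2%:R]natr1 mulrDl mul1r addrC lerD2r ler_wpM2l.
Qed.

Lemma expRN2_ge : 1 / 8 <= expR (-2) :> R.
Proof.
(* The bound 1 + t <= e^t at t = -1/16, squared five times; the fractions are rounded down to keep
   them short. *)
have -> : expR (-2) = expR (- (1 / 16)) ^+ 32 :> R by rewrite -expRM_natl; congr expR; lra.
have h : 15 / 16 <= expR (- (1 / 16)) :> R by apply: le_trans (expR_ge1Dx _); lra.
set x := expR _ in h *.
have -> : x ^+ 32 = (((((x ^+ 2) ^+ 2) ^+ 2) ^+ 2) ^+ 2) by rewrite -!exprM.
have sq (y z : R) : 0 <= z -> z <= y -> z ^+ 2 <= y ^+ 2.
  by move=> z0 zy; apply: lerXn2r; rewrite ?nnegrE // (le_trans z0).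
have h1 : 29 / 33 <= x ^+ 2.
  by apply: le_trans (sq _ _ _ h); [rewrite expr2|]; lra.
have h2 : 44 / 57 <= (x ^+ 2) ^+ 2.
  by apply: le_trans (sq _ _ _ h1); [rewrite expr2|]; lra.
have h3 : 28 / 47 <= ((x ^+ 2) ^+ 2) ^+ 2.
  by apply: le_trans (sq _ _ _ h2); [rewrite expr2|]; lra.
have h4 : 11 / 31 <= (((x ^+ 2) ^+ 2) ^+ 2) ^+ 2.
  by apply: le_trans (sq _ _ _ h3); [rewrite expr2|]; lra.
by apply: le_trans (sq _ _ _ h4); [rewrite expr2|]; lra.
Qed.

(** The right side is 4 K^2 e^(-2) e^(2/K). With e^(-2) >= 1 / 8 and e^(2/K) = (e^y)^4, y = 1 / (2
    K), binomial expansion to second order in y suffices. *)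
Lemma node_norm2_le (K : nat) : (0 < K)%N ->
  node_norm2 R K <= (2 * K%:R * expR (- ((K%:R - 1) / K%:R))) ^+ 2.
Proof.
move=> K0; have k0 : 0 < K%:R :> R by rewrite ltr0n.
rewrite exprMn exprMn -expRM_natl.
have -> : 2 * - ((K%:R - 1) / K%:R) = -2 + 4 * (1 / (2 * K%:R)) :> R.
  by field; rewrite gt_eqF.
rewrite expRD expRM_natl.
have h : 1 + 1 / (2 * K%:R) <= expR (1 / (2 * K%:R)) :> R by exact: expR_ge1Dx.
have h2 := expRN2_ge.
have y0 : 0 < 1 / (2 * K%:R) :> R by rewrite divr_gt0 // mulr_gt0.
have ky : K%:R * (1 / (2 * K%:R)) = 1 / 2 :> R by field; rewrite gt_eqF.
set y := 1 / (2 * K%:R) in h y0 ky *.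
have h3 : 1 + 4 * y + 6 * y ^+ 2 <= expR y ^+ 4.
  apply: (@le_trans _ _ ((1 + y) ^+ 4)).
    have -> : (1 + y) ^+ 4 = 1 + 4 * y + 6 * y ^+ 2 + 4 * y ^+ 3 + y ^+ 4 by ring.
    by rewrite -[X in _ <= X]addrA lerDl addr_ge0 ?mulr_ge0 ?exprn_ge0 // ltW.
  by apply: lerXn2r; rewrite ?nnegrE ?expR_ge0 // addr_ge0 // ltW.
have h4 : 1 / 8 * (1 + 4 * y + 6 * y ^+ 2) <= expR (-2) * expR y ^+ 4.
  apply: ler_pM => //; rewrite !addr_ge0 ?mulr_ge0 ?exprn_ge0 //; exact: ltW.
apply: (@le_trans _ _ (4 * K%:R ^+ 2 * (1 / 8 * (1 + 4 * y + 6 * y ^+ 2)))); last first.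
  rewrite (_ : 2 ^+ 2 = 4 :> R); last by rewrite -natrX.
  by rewrite ler_wpM2l // mulr_ge0 // exprn_ge0 // ltW.
have -> : 4 * K%:R ^+ 2 * (1 / 8 * (1 + 4 * y + 6 * y ^+ 2)) =
  1 / 2 * (K%:R ^+ 2 + 4 * K%:R * (K%:R * y) + 6 * (K%:R * y) ^+ 2) by field.
(* The remaining difference is half of (K - 5/2)^2 + 1/20, so there is little room in the
   constants. *)
rewrite ky /node_norm2; have := sqr_ge0 (K%:R - 5 / 2 : R); move: (K%:R) => k; nra.
Qed.

(** Since x < d / K, the exponential in M^d is at most e^(-(K-1)x). The rest, the 2 of 1 + N^d <= 2
    M^d and one surplus K, is absorbed by e d^2 / x because K x < d. *)
Lemma err_large_index (d K : nat) (x : R) : (4 <= d)%N -> (0 < K)%N -> 0 < x ->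
  K%:R * x < d%:R - 1 ->
  1 + Num.sqrt (node_norm2 R K) ^+ d <= err d K x.
Proof.
move=> d4 K0 x0 Kx; have k0 : 0 < K%:R :> R by rewrite ltr0n.
have errE : err d K x = 2 ^+ d * expR (1 - (K%:R - 1) * x) * (d%:R ^+ 2 * K%:R ^+ d.-1 / x).
  by case: d d4 {Kx} => [|[|[|[|d]]]].
pose M : R := 2 * K%:R * expR (- ((K%:R - 1) / K%:R)).
have M0 : 0 <= M by rewrite /M !mulr_ge0 ?expR_ge0 // ltW.
set N := Num.sqrt _.
have NM : N <= M.
  by rewrite -[M]ger0_norm // -sqrtr_sqr ler_wsqrtr // node_norm2_le.
have N1 : 1 <= N by rewrite -sqrtr1 ler_wsqrtr // node_norm2_ge1.
have : 1 + N ^+ d <= 2 * M ^+ d.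
  have : N ^+ d <= M ^+ d by apply: lerXn2r; rewrite ?nnegrE // sqrtr_ge0.
  have := exprn_ege1 d N1; lra.
move=> /le_trans; apply; rewrite errE.
have dp : (0 < d)%N by lia.
have d0 : 0 < d%:R :> R by rewrite ltr0n.
have -> : M ^+ d = 2 ^+ d * (K%:R * K%:R ^+ d.-1 * expR (- ((K%:R - 1) * (d%:R / K%:R)))).
  rewrite /M !exprMn -expRM_natl -exprS prednK // mulrA; congr (_ * expR _).
  by field; rewrite gt_eqF.
have K1 : 0 <= K%:R - 1 :> R by rewrite subr_ge0 ler1n.
have h1 : expR (- ((K%:R - 1) * (d%:R / K%:R))) <= expR (- ((K%:R - 1) * x)).
  rewrite ler_expR lerN2 ler_wpM2l // ler_pdivlMr // mulrC; lra.
have h2 : 2 * K%:R <= expR 1 * (d%:R ^+ 2 / x) :> R.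
  rewrite mulrA ler_pdivlMr //.
  have e2 : 2 <= expR 1 :> R by apply: le_trans (expR_ge1Dx _); lra.
  apply: (@le_trans _ _ (2 * d%:R ^+ 2)); last by rewrite ler_wpM2r ?sqr_ge0.
  have : 1 <= d%:R :> R by rewrite ler1n.
  move: (d%:R) Kx => dd Kx dd1; rewrite -mulrA ler_pM2l // expr2; nra.
rewrite mulrCA [expR (1 - _)]expRD -!mulrA; apply: ler_wpM2l; first by rewrite exprn_ge0.
rewrite (_ : 2 * _ = (2 * K%:R) * (K%:R ^+ d.-1 * expR (- ((K%:R - 1) * (d%:R / K%:R))))); last by ring.
rewrite (_ : expR 1 * _ = expR 1 * (d%:R ^+ 2 / x) * (K%:R ^+ d.-1 * expR (- ((K%:R - 1) * x)))); last by ring.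
apply: ler_pM => //.
by rewrite ler_wpM2l // exprn_ge0 // ltW.
Qed.

(** An equality for d = 2, 3, with a factor 2 to spare for d = 1. For d >= 4, [tailpoly_le] supplies
    the second factor d, and one 2 of 2^(d+1) is bounded by the e in the error function. *)
Lemma tail_le_err (d K : nat) (x : R) : (0 < d)%N -> (0 < K)%N -> 0 < x ->
  (d <= 3)%N || (d%:R - 1 <= K%:R * x) ->
  2 ^+ d.+1 * tail d x K%:R <= err d K x.
Proof.
move=> d0 K0 x0 hd; have k0 : 0 < K%:R :> R by rewrite ltr0n.
have xn0 : x != 0 by rewrite gt_eqF.
rewrite /tail [x * _]mulrC; case: d d0 hd => [|[|[|[|d]]]] // _ hd; rewrite /err /=.
- set e := expR _; have : 0 <= e / x by rewrite divr_ge0 ?expR_ge0 // ltW.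
  have -> : 2 ^+ 2 * (e * (1 * x^-1)) = 4 * (e / x) by ring.
  have -> : 8 * e / x = 8 * (e / x) by ring.
  lra.
- by rewrite le_eqVlt; apply/orP; left; apply/eqP; field.
- by rewrite le_eqVlt; apply/orP; left; apply/eqP; field.
have Kd : (d.+3)%:R <= x * K%:R :> R.
  by move: hd; rewrite mulrC -[d.+4%:R]natr1 addrK.
have h := tailpoly_le x0 k0 Kd.
set D : R := d.+4%:R in h *; have D0 : 0 <= D by rewrite /D.
set T := tailpoly x d.+3 K%:R in h; rewrite -[(_ + _) / x]/T.
have e2 : 2 <= expR 1 :> R by apply: le_trans (expR_ge1Dx _); lra.
rewrite expRD; set e := expR (- _); have e0 : 0 <= e by exact: expR_ge0.
have T0 : 0 <= D * K%:R ^+ d.+3 / x by apply: divr_ge0; [apply: mulr_ge0 => //; apply: exprn_ge0; exact: ltW|exact: ltW].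
have P0 : 0 <= 2 ^+ d.+4 * e * D.
  by apply: mulr_ge0 => //; apply: mulr_ge0 => //; exact: exprn_ge0.
apply: (@le_trans _ _ (2 ^+ d.+4 * e * D * (2 * (D * K%:R ^+ d.+3 / x)))).
  rewrite exprS (_ : 2 * 2 ^+ d.+4 * (e * (D * _)) = 2 ^+ d.+4 * e * D * (2 * T)); last by ring.
  by apply: ler_wpM2l => //; rewrite ler_pM2l.
rewrite (_ : 2 ^+ d.+4 * (expR 1 * e) * _ = 2 ^+ d.+4 * e * D * (expR 1 * (D * K%:R ^+ d.+3 / x))); last by ring.
by apply: ler_wpM2l => //; apply: ler_wpM2r.
Qed.

End Tail.

(** * The interpolation error in angle coordinates *)

Section Core.
Variables (R : realType) (d : nat).
Local Notation C := R[i].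
Implicit Types (F : ('I_d -> C) -> C) (th : 'I_d -> C).

Lemma functional_boundW (I : finType) (c s : I -> C) (Y M M' : R) : 0 < Y -> M <= M' ->
  functional_bound Y c s M -> functional_bound Y c s M'.
Proof.
move=> Y0 MM h W G hG; apply: (le_trans (h W G hG)); apply: ler_wpM2r => //.
by have [_ hW _] := hG; apply: le_trans (cabs_ge0 (G 0)) (hW _ _); rewrite /= normr0.
Qed.

Lemma tail_ratio_mono (b b' : R) m : 0 < b -> b <= b' ->
  expR (- (m%:R * b')) / (1 - expR (- b')) <= expR (- (m%:R * b)) / (1 - expR (- b)).
Proof.
move=> b0 bb; have d0 : 0 < 1 - expR (- b) by rewrite subr_gt0 expR_lt1 oppr_lt0.
have h : 1 - expR (- b) <= 1 - expR (- b') by rewrite lerD2l lerN2 ler_expR lerN2.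
apply: ler_pM; rewrite ?expR_ge0 ?invr_ge0 //.
- by apply: le_trans h; exact: ltW.
- by rewrite ler_expR lerN2 ler_wpM2l.
- by rewrite lef_pV2 ?posrE // (lt_le_trans d0).
Qed.

Lemma pow1D_le (eta : R) m : 0 <= eta -> eta <= 1 -> (1 + eta) ^+ m - 1 <= eta * 2 ^+ m.
Proof.
move=> e0 e1; elim: m => [|m IH]; first by rewrite expr0 subrr mulr1.
have h2 : (1 + eta) ^+ m <= 2 ^+ m by apply: lerXn2r; rewrite ?nnegrE ?addr_ge0 //; lra.
rewrite exprS [2 ^+ m.+1]exprSr; move: IH h2; set x := (1 + eta) ^+ m; set y := 2 ^+ m; nra.
Qed.

Definition node_interp (K : nat) F th : C := \sum_(k : {ffun 'I_d -> 'I_K})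
  (\prod_j Defs.lagrange (k j) (ccos (th j))) * F (fun j => (node R K (k j))%:C).

Definition dft_coef (N n : nat) F (l : {ffun 'I_d -> 'I_n}) : C :=
  \sum_(m : {ffun 'I_d -> 'I_N}) (\prod_j dft R (l j) (m j)) * F (fun j => (grid R N (m j))%:C).

(** A cosine polynomial of degree below n in each angle that stands in for F: interpolation acts on
    it termwise, replacing [ck] by [alias]. *)
Definition dft_sum (N n : nat) F (ph : 'I_d -> C) : C :=
  \sum_(l : {ffun 'I_d -> 'I_n}) dft_coef N F l * \prod_j ck (l j) (ph j).

(** Regrouped as a tensor product of one-variable functionals, the form that [tensor_approx]
    takes. *)
Lemma dft_sumE N n F ph : dft_sum N n F ph = \sum_(m : {ffun 'I_d -> 'I_N})
  (\prod_j \sum_(k < n) ck k (ph j) * dft R k (m j)) * F (fun j => (grid R N (m j))%:C).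
Proof.
rewrite /dft_sum /dft_coef; under eq_bigr do rewrite mulr_suml.
rewrite exchange_big; apply: eq_bigr => m _ /=.
rewrite bigA_distr_bigA mulr_suml; apply: eq_bigr => l _.
by rewrite [in RHS]big_split /= mulrAC [X in _ = X * _]mulrC.
Qed.

Lemma node_interp_dft (K N n : nat) F th : node_interp K (dft_sum N n F) th =
  \sum_(l : {ffun 'I_d -> 'I_n}) dft_coef N F l * \prod_j alias K (l j) (th j).
Proof.
rewrite /node_interp /dft_sum; under eq_bigr do rewrite mulr_sumr.
rewrite exchange_big; apply: eq_bigr => l _ /=.
rewrite /alias bigA_distr_bigA mulr_sumr; apply: eq_bigr => k _.
by rewrite [in RHS]big_split mulrCA.
Qed.

(** The Lebesgue sum is a crude factor, applied only to the distance between F and [dft_sum], which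
    can be made arbitrarily small. *)
Lemma node_interp_le (K : nat) F th (e : R) :
  (forall k : {ffun 'I_d -> 'I_K}, cabs (F (fun j => (node R K (k j))%:C)) <= e) ->
  cabs (node_interp K F th) <=
    (\sum_(k : {ffun 'I_d -> 'I_K}) \prod_j cabs (Defs.lagrange (k j) (ccos (th j)))) * e.
Proof.
move=> h; apply: (le_trans (cabs_sum _ _ _)); rewrite mulr_suml; apply: ler_sum => k _.
by rewrite cabsM cabs_prod ler_wpM2l // prodr_ge0 // => j _; exact: cabs_ge0.
Qed.

Lemma node_interpB K F G th :
  node_interp K (fun ph => F ph - G ph) th = node_interp K F th - node_interp K G th.
Proof. by rewrite /node_interp -sumrB; apply: eq_bigr => k _; rewrite mulrBr. Qed.

Lemma interp_norm_bound (K : nat) F th (Y : 'I_d -> R) (W : R) : (0 < d)%N -> (0 < K)%N ->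
  box_fun Y W F -> (forall j, `|Im (th j)| < Y j) ->
  cabs (node_interp K F th) <= Num.sqrt (node_norm2 R K) ^+ d * W.
Proof.
move=> d0 K0 hF hth.
have := @tensor_bound R d 'I_K (fun j m => Defs.lagrange m (ccos (th j)))
  (fun j m => (node R K m)%:C) Y (fun=> Num.sqrt (node_norm2 R K)) W F d0.
rewrite card_ord prodr_const card_ord; apply => //.
- by move=> j; apply: le_lt_trans (hth j).
- by move=> j i; rewrite /= normr0; apply: le_lt_trans (hth j).
- by move=> j; apply: node_functional_bound.
Qed.

Section Estimate.
Variables (F : ('I_d -> C) -> C) (th : 'I_d -> C) (W a dl : R) (K : nat).
Hypotheses (d0 : (0 < d)%N) (K0 : (0 < K)%N) (a0 : 0 < a) (dl0 : 0 < dl).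
Let y j := `|Im (th j)|.
(** The tube is widened by a in direction j0 only. Of the further 2 dl, one dl makes the aliasing
    tails summable and the other keeps the line of evaluation strictly inside. *)
Let shift (j0 j : 'I_d) : R := y j + (if j == j0 then a else 0).
Hypothesis hF : forall j0, box_fun (fun j => shift j0 j + 2 * dl) W F.

Let y0 j : 0 <= y j. Proof. exact: normr_ge0. Qed.

Let shift0 j0 j : 0 <= shift j0 j.
Proof. by rewrite /shift addr_ge0 //; case: ifP => _ //; exact: ltW. Qed.

Let W0 : 0 <= W.
Proof.
pose j0 := Ordinal d0.
have pos j : `|Im (0 : C)| < shift j0 j + 2 * dl by rewrite /= normr0 ltr_wpDl ?shift0 // mulr_gt0.
have [_ h _] := @hF j0 (fun=> 0) j0 pos.
exact: le_trans (cabs_ge0 _) (h 0 (pos j0)).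
Qed.

Let B : R := \sum_j y j + a.

Let shiftB j0 j : shift j0 j <= B.
Proof.
rewrite /shift /B lerD //; last by case: ifP => _ //; exact: ltW.
by rewrite (bigD1 j) //= lerDl sumr_ge0.
Qed.

Let sh2 j0 j : 0 < shift j0 j + 2 * dl.
Proof. by rewrite ltr_wpDl ?shift0 // mulr_gt0. Qed.

Variables (n N : nat).
Hypotheses (n0 : (0 < n)%N) (nN : (2 * n <= N)%N).
(** The aliasing remainder, which vanishes as N grows with n fixed. [tau1] serves frequency 0 and
    [tau2] the positive ones in [dft_coef_le]; [tau3] serves [dft_sum_approx]. *)
Let tau := expR (- ((N - n)%:R * dl)) / (1 - expR (- dl)).
Hypotheses (tau1 : 4 * tau <= 1)
  (tau2 : 4 * tau <= 2 * expR (- (n%:R * B)) * (1 - expR (- dl)))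
  (tau3 : 4 * n%:R * expR (n%:R * B) * tau <= n%:R^-1).

(** The remainder hides in the slack of the factor 2: at frequency 0 between [wgt 0] and 2, at k > 0
    between e^(-k(shift + dl)) and e^(-k shift). *)
Let dft_coef_le j0 (l : {ffun 'I_d -> 'I_n}) :
  cabs (dft_coef N F l) <= (\prod_j (2 * expR (- ((l j)%:R * shift j0 j)))) * W.
Proof.
have N0 : (0 < N)%N by lia.
apply: (@tensor_bound R d 'I_N (fun j m => dft R (l j) m) (fun j m => (grid R N m)%:C)
  (fun j => shift j0 j + 2 * dl)) => //.
- by rewrite card_ord.
- by move=> j i; rewrite /= normr0.
move=> j; have ln := ltn_ord (l j).
have b0 : 0 < shift j0 j + dl by rewrite ltr_wpDl ?shift0.
have bY : shift j0 j + dl < shift j0 j + 2 * dl.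
  by rewrite ltrD2l mulr_natl mulr2n ltrDl.
have nN' : (n <= N)%N by lia.
apply: functional_boundW (sh2 j0 j) _ (dft_bound N0 ln nN' b0 bY).
have ht : expR (- ((N - n)%:R * (shift j0 j + dl))) / (1 - expR (- (shift j0 j + dl))) <= tau.
  by apply: tail_ratio_mono; rewrite // lerDr shift0.
move: (l j : nat) ln ht => k kn; set T := expR _ / _ => ht.
have [->|k0] := posnP k.
  have h4 : 4 * T <= 1 by apply: le_trans tau1; rewrite ler_pM2l.
  by rewrite !mul0r !oppr0 expR0 /wgt /= !mulr1 [2]mulr2n lerD2l.
rewrite /wgt k0 /= mulrDr opprD expRD.
have e1 : expR (- (k%:R * dl)) <= expR (- dl).
  by rewrite ler_expR lerN2 ler_peMl ?ler1n // ltW.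
have e2 : expR (- (n%:R * B)) <= expR (- (k%:R * shift j0 j)).
  rewrite ler_expR lerN2; apply: ler_pM => //; first by rewrite ler_nat ltnW.
have e3 : 0 < 1 - expR (- dl) by rewrite subr_gt0 expR_lt1 oppr_lt0.
have e4 := expR_ge0 (- (n%:R * B)).
move: e1 e2 e3 e4 tau2 ht.
set u := expR (- (k%:R * dl)); set v := expR (- dl); set w := expR (- (n%:R * B)).
set x := expR (- (k%:R * shift j0 j)) => e1 e2 e3 e4 t2 ht.
have : w * (1 - v) <= x * (1 - u).
  by apply: ler_pM => //; [exact: ltW|rewrite lerD2l lerN2].
move=> hw; have h4 : 4 * T <= 2 * w * (1 - v) by apply: le_trans t2; rewrite ler_pM2l.
rewrite -lerBrDl; apply: (le_trans h4); rewrite -mulrA.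
by rewrite (_ : 2 * x - _ = 2 * (x * (1 - u))) ?ler_pM2l //; ring.
Qed.

Let eta := 2 * (expR (- (n%:R * dl)) / (1 - expR (- dl))) + n%:R^-1.

Let eta0 : 0 <= eta.
Proof.
rewrite /eta addr_ge0 ?invr_ge0 // mulr_ge0 // divr_ge0 ?expR_ge0 // ltW //.
by rewrite subr_gt0 expR_lt1 oppr_lt0.
Qed.

Let dft_sum_approx ph : (forall j, `|Im (ph j)| <= y j) ->
  cabs (dft_sum N n F ph - F ph) <= ((1 + eta) ^+ d - 1) * W.
Proof.
move=> hph; rewrite dft_sumE; have N0 : (0 < N)%N by lia.
pose j0 := Ordinal d0.
apply: (@tensor_approx R d 'I_N (fun j m => \sum_(k < n) ck k (ph j) * dft R k m)
  (fun j m => (grid R N m)%:C) (fun j => shift j0 j + 2 * dl)) => //.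
- by rewrite card_ord.
- by move=> j i; rewrite /= normr0.
- move=> j; apply: (le_lt_trans (hph j)); apply: (@le_lt_trans _ _ (shift j0 j)).
    by rewrite /shift lerDl; case: ifP => _ //; exact: ltW.
  by rewrite ltrDl mulr_gt0.
move=> j V G hG.
have b0 : y j < y j + dl by rewrite ltrDl.
have bY : y j + dl < shift j0 j + 2 * dl.
  apply: (@le_lt_trans _ _ (shift j0 j + dl)).
    by rewrite lerD2r /shift lerDl; case: ifP => _ //; exact: ltW.
  by rewrite ltrD2l mulr_natl mulr2n ltrDl.
apply: (le_trans (dft_synthesis_bound n0 nN (y0 j) b0 bY (hph j) hG)).
have V0 : 0 <= V.
  by have [_ hV _] := hG; apply: le_trans (cabs_ge0 (G 0)) (hV _ _); rewrite /= normr0.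
apply: ler_wpM2r => //; rewrite /eta addrAC subrr add0r; apply: lerD => //.
apply: le_trans tau3; apply: ler_pM.
- by rewrite !mulr_ge0 ?expR_ge0.
- rewrite divr_ge0 ?expR_ge0 // subr_ge0 expR_le1 oppr_le0 addr_ge0 //; exact: ltW.
- rewrite ler_wpM2l ?mulr_ge0 // ler_expR ler_wpM2l //.
  by apply: le_trans (shiftB j0 j); rewrite /shift lerDl; case: ifP => _ //; exact: ltW.
- by apply: tail_ratio_mono; rewrite // lerDr.
Qed.

(** With j0 a coordinate of maximal index, the decay e^(-k shift) cancels the growth e^(k y) of the
    cosines in every coordinate, and only e^(-max a) is left. *)
Let alias_error_le (l : {ffun 'I_d -> 'I_n}) :
  cabs (dft_coef N F l * (\prod_j alias K (l j) (th j) - \prod_j ck (l j) (th j)))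
  <= if (K <= maxidx l)%N then 2 ^+ d.+1 * W * expR (- ((maxidx l)%:R * a)) else 0.
Proof.
case: ifPn => [hK|]; last first.
  rewrite -ltnNge => hK; rewrite (eq_bigr (fun j => ck (l j) (th j))) ?subrr ?mulr0 ?cabs0 //.
  by move=> j _; rewrite alias_id //; apply: leq_ltn_trans hK; exact: leq_bigmax.
have [j0 hj0] : exists j0, maxidx l = l j0.
  have : (0 < #|'I_d|)%N by rewrite card_ord.
  by case/(@eq_bigmax_cond _ xpredT (fun j => l j : nat)) => j0 _ e; exists j0.
rewrite cabsM.
pose E := \prod_j expR ((l j)%:R * y j).
have E1 : cabs (\prod_j alias K (l j) (th j) - \prod_j ck (l j) (th j)) <= 2 * E.
  apply: (le_trans (le_cabsB _ _)); rewrite mulr_natl mulr2n; apply: lerD; rewrite cabs_prod;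
    apply: ler_prod => j _; rewrite cabs_ge0 /=; [exact: cabs_alias|exact: cabs_ck].
have E0 : 0 <= E by apply: prodr_ge0 => j _; exact: expR_ge0.
apply: (@le_trans _ _ ((\prod_j (2 * expR (- ((l j)%:R * shift j0 j)))) * W * (2 * E))).
  by apply: ler_pM; rewrite ?cabs_ge0 ?dft_coef_le.
have -> : \prod_j (2 * expR (- ((l j)%:R * shift j0 j))) =
    2 ^+ d * (\prod_j expR (- ((l j)%:R * shift j0 j))).
  by rewrite big_split /= prodr_const card_ord.
have : (\prod_j expR (- ((l j)%:R * shift j0 j))) * E = expR (- ((l j0)%:R * a)).
  rewrite /E -big_split (bigD1 j0) //= big1 ?mulr1 => [|j jj].
    by rewrite -expRD /shift eqxx; congr expR; ring.
  by rewrite -expRD /shift (negbTE jj) addr0 addNr expR0.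
rewrite hj0 exprS => <-; rewrite le_eqVlt; apply/orP; left; apply/eqP; ring.
Qed.

Let Lambda := \sum_(k : {ffun 'I_d -> 'I_K}) \prod_j cabs (Defs.lagrange (k j) (ccos (th j))).

Lemma interp_error_grid : cabs (node_interp K F th - F th) <=
  (Lambda + 1) * (((1 + eta) ^+ d - 1) * W) + 2 ^+ d.+1 * tail d a K%:R * W.
Proof.
have -> : node_interp K F th - F th =
  (dft_sum N n F th - F th) - node_interp K (fun ph => dft_sum N n F ph - F ph) th
  + (node_interp K (dft_sum N n F) th - dft_sum N n F th).
  by rewrite node_interpB; ring.
apply: (le_trans (le_cabsD _ _)); apply: lerD.
  apply: (le_trans (le_cabsB _ _)); rewrite addrC mulrDl mul1r; apply: lerD.
    by apply: node_interp_le => k; apply: dft_sum_approx => j; rewrite /= normr0.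
  exact: dft_sum_approx.
rewrite node_interp_dft /dft_sum -sumrB.
under eq_bigr do rewrite -mulrBr.
apply: (le_trans (cabs_sum _ _ _)).
apply: (le_trans (ler_sum _ (fun l _ => alias_error_le l))).
rewrite -big_mkcond /= -mulr_sumr.
rewrite (@sum_maxidx R d n K (fun m => expR (- (m%:R * a))) K0) mulrAC; apply: ler_wpM2r => //.
by apply: ler_wpM2l; [rewrite exprn_ge0|exact: sum_tail].
Qed.

End Estimate.

(** The parameters are chosen in the order e, [eta1], n, N: the conditions on N involve e^(nB), so n
    must be fixed before. *)
Lemma interp_error_tail F th (W a dl : R) (K : nat) :
  (0 < d)%N -> (0 < K)%N -> 0 < a -> 0 < dl -> 0 <= W ->
  (forall j0, box_fun (fun j => `|Im (th j)| + (if j == j0 then a else 0) + 2 * dl) W F) ->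
  cabs (node_interp K F th - F th) <= 2 ^+ d.+1 * tail d a K%:R * W.
Proof.
move=> d0 K0 a0 dl0 W0 hF; apply/ler_addgt0Pl => e e0.
pose Lambda := \sum_(k : {ffun 'I_d -> 'I_K}) \prod_j cabs (Defs.lagrange (k j) (ccos (th j))).
have L0 : 0 <= Lambda.
  by apply: sumr_ge0 => k _; apply: prodr_ge0 => j _; exact: cabs_ge0.
(* By [pow1D_le] the approximation error is at most eta V; the + 1 keeps V positive when W = 0. *)
pose V := (Lambda + 1) * W * 2 ^+ d + 1.
have V0 : 0 < V by rewrite ltr_wpDl // !mulr_ge0 ?exprn_ge0 // addr_ge0.
pose eta1 := Num.min 1 (e / V).
have eta10 : 0 < eta1 by rewrite lt_min ltr01 divr_gt0.
pose B := \sum_j `|Im (th j)| + a.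
have q0 : 0 < 1 - expR (- dl) by rewrite subr_gt0 expR_lt1 oppr_lt0.
have [n1 hn1] := @expR_small R dl (eta1 / 4 * (1 - expR (- dl))) dl0
  (mulr_gt0 (divr_gt0 eta10 (ltr0Sn R 3)) q0).
pose n2 := (Num.bound (2 / eta1)).+1.
pose n := maxn n1 n2.
have n0 : (0 < n)%N by rewrite leq_max orbT.
have h1 : 2 * (expR (- (n%:R * dl)) / (1 - expR (- dl))) <= eta1 / 2.
  have := hn1 n (leq_maxl _ _); rewrite -ler_pdivrMr // => h; lra.
have h2 : n%:R^-1 <= eta1 / 2.
  rewrite invf_ple ?posrE ?divr_gt0 ?ltr0n // invf_div.
  apply: ltW; apply: lt_le_trans (archi_boundP _) _; first by rewrite divr_ge0 // ltW.
  by rewrite ler_nat; apply: leq_trans (leq_maxr _ _); exact: leqnSn.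
have nr0 : 0 < n%:R :> R by rewrite ltr0n.
pose t1 := Num.min 1 (Num.min (2 * expR (- (n%:R * B)) * (1 - expR (- dl)))
   (n%:R^-1 / (n%:R * expR (n%:R * B)))).
have t10 : 0 < t1.
  by rewrite !lt_min ltr01 !mulr_gt0 ?expR_gt0 ?invr_gt0 // mulr_gt0 ?expR_gt0.
have [m1 hm1] := @expR_small R dl (t1 / 4 * (1 - expR (- dl))) dl0
  (mulr_gt0 (divr_gt0 t10 (ltr0Sn R 3)) q0).
pose N := (n + maxn m1 n)%N.
have ht : 4 * (expR (- ((N - n)%:R * dl)) / (1 - expR (- dl))) <= t1.
  have := hm1 (N - n)%N; rewrite addKn leq_maxl => /(_ isT).
  by rewrite -ler_pdivrMr // => h; lra.
have nN : (2 * n <= N)%N by rewrite mul2n -addnn leq_add2l leq_maxr.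
have := @interp_error_grid F th W a dl K d0 K0 a0 dl0 hF n N n0 nN.
rewrite -/B -/Lambda => /(_ _ _ _)/le_trans; apply.
- by apply: (le_trans ht); rewrite ge_min lexx.
- by apply: (le_trans ht); rewrite !ge_min lexx orbT.
- rewrite -mulrA mulrC -!mulrA [X in _ * (_ * X)]mulrC.
  have : 4 * (expR (- ((N - n)%:R * dl)) / (1 - expR (- dl))) <= n%:R^-1 / (n%:R * expR (n%:R * B)).
    by apply: (le_trans ht); rewrite !ge_min lexx !orbT.
  rewrite ler_pdivlMr ?mulr_gt0 ?expR_gt0 // => h; apply: le_trans h.
  by rewrite le_eqVlt; apply/orP; left; apply/eqP; ring.
rewrite lerD2r; set eta := _ + n%:R^-1.
have e1 : eta <= eta1 by rewrite /eta; lra.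
have ee0 : 0 <= eta by rewrite /eta addr_ge0 ?invr_ge0 // mulr_ge0 // divr_ge0 ?expR_ge0 // ltW.
have e2 : eta <= 1 by apply: (le_trans e1); rewrite ge_min lexx.
have e3 : eta * V <= e.
  by rewrite -ler_pdivlMr //; apply: (le_trans e1); rewrite ge_min lexx orbT.
apply: le_trans e3; rewrite mulrCA.
apply: (@le_trans _ _ (eta * 2 ^+ d * ((Lambda + 1) * W))).
  by apply: ler_wpM2r; rewrite ?pow1D_le // mulr_ge0 // addr_ge0.
rewrite -mulrA; apply: ler_wpM2l => //; rewrite /V mulrC lerDl //.
Qed.

End Core.

(** * Bernstein ellipses and the transfer operator *)

Section PNorm.
Variables (R : realType) (d p : nat).
Hypothesis p0 : (0 < p)%N.
Implicit Types x y : 'rV[R]_d.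

Lemma pnorm_pow x : pnorm p x ^+ p = \sum_j `|x ord0 j| ^+ p.
Proof.
have S0 : 0 <= \sum_j `|x ord0 j| ^+ p by apply: sumr_ge0 => j _; rewrite exprn_ge0.
by rewrite /pnorm -powR_mulrn ?powR_ge0 // -powRrM mulVf ?powRr1 // pnatr_eq0 -lt0n.
Qed.

Lemma pnorm_ge0 x : 0 <= pnorm p x.
Proof. exact: powR_ge0. Qed.

Lemma pnorm_le x (c : R) : 0 <= c -> \sum_j `|x ord0 j| ^+ p <= c ^+ p -> pnorm p x <= c.
Proof. by move=> c0 h; rewrite -(ler_pXn2r p0) ?nnegrE ?pnorm_ge0 // pnorm_pow. Qed.

Lemma ler_pnorm x y : (forall j, `|x ord0 j| <= `|y ord0 j|) -> pnorm p x <= pnorm p y.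
Proof.
move=> h; apply: pnorm_le; rewrite ?pnorm_ge0 // pnorm_pow; apply: ler_sum => j _.
by apply: lerXn2r; rewrite ?nnegrE.
Qed.

Lemma coord_le_pnorm x j : `|x ord0 j| <= pnorm p x.
Proof.
rewrite -(ler_pXn2r p0) ?nnegrE ?pnorm_ge0 // pnorm_pow (bigD1 j) //= lerDl.
by apply: sumr_ge0 => i _; rewrite exprn_ge0.
Qed.

(** Convexity of the m-th power, by induction; it yields the instance of Minkowski's inequality in
    [pnorm_coord_shift]. *)
Lemma pow_increment (s t a : R) m : 0 <= t -> t <= s -> 0 <= a ->
  (t + a) ^+ m - t ^+ m <= (s + a) ^+ m - s ^+ m.
Proof.
move=> t0 ts a0; have s0 := le_trans t0 ts.
elim: m => [|m IH]; first by rewrite !expr0 !subrr.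
have e (u : R) : (u + a) ^+ m.+1 - u ^+ m.+1 = (u + a) * ((u + a) ^+ m - u ^+ m) + a * u ^+ m.
  by rewrite !exprS; ring.
rewrite !e; apply: lerD.
  apply: ler_pM; [by rewrite addr_ge0| |by rewrite lerD2r|exact: IH].
  by rewrite subr_ge0; apply: lerXn2r; rewrite ?nnegrE ?addr_ge0 // lerDl.
by rewrite ler_wpM2l //; apply: lerXn2r; rewrite ?nnegrE.
Qed.

(** Let s be the norm of y. Since y j0 <= s, raising y j0 by a increases the sum of p-th powers by
    at most (s + a)^p - s^p. *)
Lemma pnorm_coord_shift (y : 'I_d -> R) (a : R) j0 : (forall j, 0 <= y j) -> 0 <= a ->
  pnorm p (\row_j (y j + if j == j0 then a else 0)) <= pnorm p (\row_j y j) + a.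
Proof.
move=> y0 a0; set s := pnorm p (\row_j y j).
have s0 : 0 <= s by exact: pnorm_ge0.
apply: pnorm_le; first by rewrite addr_ge0.
have ys : y j0 <= s.
  by have := coord_le_pnorm (\row_j y j) j0; rewrite mxE ger0_norm.
have := pow_increment p (y0 j0) ys a0; rewrite pnorm_pow.
rewrite (bigD1 j0) //= [X in _ -> X <= _](bigD1 j0) //= !mxE eqxx !ger0_norm ?addr_ge0 //.
rewrite [X in _ -> _ + X <= _](eq_bigr (fun i => `|(\row_j y j) ord0 i| ^+ p)).
  by set T := \sum_(_ | _) _; lra.
by move=> j /negbTE jj; rewrite !mxE jj addr0.
Qed.

Lemma pnorm_shift (y : 'I_d -> R) (c : R) : (forall j, 0 <= y j) -> 0 <= c ->
  pnorm p (\row_j (y j + c)) <= pnorm p (\row_j y j) + d%:R * c.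
Proof.
move=> y0 c0.
have : forall r : seq 'I_d, uniq r ->
    pnorm p (\row_j (y j + if j \in r then c else 0)) <= pnorm p (\row_j y j) + (size r)%:R * c.
  elim=> [_|j0 r IH /= /andP[j0r ur]].
    by rewrite mul0r addr0; apply: ler_pnorm => j; rewrite !mxE addr0.
  have := pnorm_coord_shift (y := fun j => y j + if j \in r then c else 0) j0 _ c0.
  rewrite (_ : \row_j _ = \row_j (y j + (if j \in j0 :: r then c else 0))); last first.
    apply/rowP => j; rewrite !mxE inE; case: eqP => [->|_] /=; last by rewrite addr0.
    by rewrite (negbTE j0r) addr0.
  have ge0 j : 0 <= y j + (if j \in r then c else 0) by rewrite addr_ge0 //; case: ifP.
  move=> /(_ ge0)/le_trans; apply.
  by rewrite -[(size r).+1%:R]natr1 mulrDl mul1r addrA lerD2r; exact: IH.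
move=> /(_ (enum 'I_d) (enum_uniq _)); rewrite size_enum_ord.
by rewrite (_ : \row_j _ = \row_j (y j + c)) //; apply/rowP => j; rewrite !mxE mem_enum.
Qed.

End PNorm.

Section Transfer.
Variables (R : realType) (d p : nat).
Local Notation C := R[i].

Definition angle_fun (f : 'rV[C]_d -> C) : ('I_d -> C) -> C := fun ph => f (\row_j ccos (ph j)).

Lemma bernstein_angle (r : R) (ph : 'I_d -> C) : pnorm p (\row_j Im (ph j)) < r ->
  bernstein p r (\row_j ccos (ph j)).
Proof.
move=> h; exists (\row_j Re (ph j)) => //; exists (\row_j Im (ph j)) => //.
by apply/rowP => j; rewrite !mxE; case: (ph j).
Qed.

Lemma cdiff_coord (f : 'rV[C]_d -> C) (z : 'rV[C]_d) j : differentiable f z ->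
  cdiff (fun h => f (h *: delta_mx ord0 j + z)) 0.
Proof.
move=> /(@diff_derivable _ _ _ f z (delta_mx ord0 j)) df.
exists ('D_(delta_mx ord0 j) f z) => e e0.
have e0C : (0 : C) < e%:C by rewrite ltcR.
have /nbhs_ballP[r /= r0 hr] := derivable_approx df e0C.
(* The radius is a positive element of R[i], hence has imaginary part 0. *)
have [r1 r1E] : exists r1 : R, r = r1%:C.
  by move: r0; case: (r) => u v; rewrite ltcE /= => /andP[/eqP -> _]; exists u.
exists r1; first by rewrite -ltcR -r1E.
move=> h hh; have := hr h; rewrite /ball /= sub0r normrN cabsE r1E ltcR => /(_ hh).
rewrite !cabsE -rmorphM lecR scale0r !add0r [h *: 'D_ _ _ _]mulrC; exact.
Qed.

(** Monotonicity of the p-norm puts the box into the ball, and the chain rule applies along each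
    coordinate line; evenness and periodicity are those of the cosine. *)
Lemma angle_fun_box (f : 'rV[C]_d -> C) (Y : 'I_d -> R) (W Rad : R) : (0 < p)%N ->
  holomorphic_on (bernstein p Rad) f -> (forall z, bernstein p Rad z -> cabs (f z) <= W) ->
  (forall j, 0 <= Y j) -> pnorm p (\row_j Y j) < Rad -> box_fun Y W (angle_fun f).
Proof.
move=> p0 hf hW Y0 hY ph j hph.
have inE' ph' : (forall l, `|Im (ph' l)| < Y l) -> bernstein p Rad (\row_l ccos (ph' l)).
  move=> h; apply: bernstein_angle; apply: le_lt_trans hY; apply: ler_pnorm => // l.
  by rewrite !mxE [X in _ <= X]ger0_norm //; exact: ltW.
split=> [s hs|s hs|].
- have := hf _ (inE' _ (upd_box hph hs)); set z := \row_l _ => dz.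
  have -> : (fun t => angle_fun f (upd ph j t)) =
      (fun t => f ((ccos t + - ccos s) *: delta_mx ord0 j + z)).
    apply/funext => t; congr f; apply/rowP => l; rewrite !mxE eqxx /= /upd.
    by case: eqP => _; rewrite ?mulr1 ?mulr0 ?add0r // subrK.
  apply: (@cdiff_comp _ (fun h => f (h *: delta_mx ord0 j + z)) (fun t => ccos t + - ccos s)).
    by apply: cdiffD; [exact: cdiff_ccos|exact: cdiff_cst].
  by rewrite subrr; exact: cdiff_coord.
- by apply: hW; apply: inE'; exact: upd_box.
split=> s; congr f; apply/rowP => l; rewrite !mxE /upd; case: eqP => // _.
  exact: ccosD2pi.
exact: ccosN.
Qed.

Lemma interp_angle (K : nat) (f : 'rV[C]_d -> C) (ph : 'I_d -> C) :
  interp K f (\row_j ccos (ph j)) = node_interp K (angle_fun f) ph.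
Proof.
apply: eq_bigr => k _; rewrite mulrC; congr (_ * _).
  by apply: eq_bigr => j _; rewrite mxE.
by congr f; apply/rowP => j; rewrite !mxE ccos_node.
Qed.

(** A finite subfamily whose sum is within e of s is dominated by the extended sum of the bounds. *)
Lemma has_sum_bound (J : countType) (x : J -> C) (s : C) (b : J -> \bar R) (W : R) :
  has_sum x s -> (forall j, (cabs (x j))%:E <= b j)%E -> (\esum_(j in [set: J]) b j <= W%:E)%E ->
  cabs s <= W.
Proof.
move=> hs hb hW; apply/ler_addgt0Pr => e e0.
have [A hA] := hs e e0; have {}hA := hA A (finmap.fsubset_refl A).
have : cabs (\sum_(j <- finmap.enum_fset A) x j) <= W.
  rewrite -lee_fin; apply: le_trans hW; apply: esum_ge; exists [set` finmap.enum_fset A].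
    by split => //; exact: finite_seq.
  rewrite -fsbig_seq ?finmap.fset_uniq //.
  apply: (@le_trans _ _ (\sum_(j <- finmap.enum_fset A) (cabs (x j))%:E)%E).
    by rewrite sumEFin lee_fin cabs_sum.
  by apply: lee_sum.
have := le_cabsB (\sum_(j <- finmap.enum_fset A) x j) (\sum_(j <- finmap.enum_fset A) x j - s).
rewrite opprB addrCA subrr addr0; move: hA; lra.
Qed.

Lemma le_hnorm (r : R) (phi : 'rV[C]_d -> C) z : 0 < r -> bernstein p r z ->
  ((cabs (phi z))%:E <= hnorm p r phi)%E.
Proof.
move=> r0 hz; apply: ereal_sup_ubound; exists z => //.
by rewrite /hdomain gt_eqF.
Qed.

Lemma transfer_bound (r Rad W : R) (J : countType) (w : J -> 'rV[C]_d -> C)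
    (v : J -> 'rV[C]_d -> 'rV[C]_d) L phi z :
  0 < r -> r < Rad -> (forall j z, bernstein p Rad z -> bernstein p r (v j z)) ->
  (\esum_(j in [set: J]) hnorm p Rad (w j) <= W%:E)%E ->
  is_transfer_operator p r Rad w v L -> Hspace p r phi -> (hnorm p r phi <= 1)%E ->
  bernstein p Rad z -> cabs (L phi z) <= W.
Proof.
move=> r0 rR hv hw hL hphi phi1 hz; have [_ /(_ z hz) hs] := hL phi hphi.
apply: has_sum_bound hs _ hw => j.
apply: le_trans (le_hnorm (w j) (lt_trans r0 rR) hz); rewrite lee_fin cabsM.
rewrite -[X in _ <= X]mulr1; apply: ler_wpM2l; first exact: cabs_ge0.
by rewrite -lee_fin; apply: le_trans phi1; apply: le_hnorm => //; exact: hv.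
Qed.

End Transfer.

(** * Passage to the full gap R - rho and to the operator norm *)

Section Main.
Variables (R : realType).
Local Notation C := R[i].

Lemma cvg_tailpoly m (t x : R) : x != 0 -> (tailpoly a m t @[a --> x]) --> tailpoly x m t.
Proof.
move=> x0; elim: m => [|m IH] /=; first exact: cvgV.
by apply: cvgM; [apply: cvgD; [exact: cvg_cst|apply: cvgM; [exact: cvg_cst|exact: IH]]|exact: cvgV].
Qed.

Lemma cvg_tail d (t x : R) : x != 0 -> (tail d a t @[a --> x]) --> tail d x t.
Proof.
move=> x0; apply: cvgM.
  apply: (@continuous_cvg _ _ _ _ _ _ (@expR R)); first exact: continuous_expR.
  by apply: cvgN; apply: cvgM; [exact: cvg_id|exact: cvg_cst].
by apply: cvgM; [exact: cvg_cst|exact: cvg_tailpoly].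
Qed.

Lemma interp_error_angle (d p K : nat) (f : 'rV[C]_d -> C) (Rad rho W : R) (th : 'I_d -> C) :
  (0 < d)%N -> (0 < p)%N -> (0 < K)%N -> rho < Rad ->
  holomorphic_on (bernstein p Rad) f -> (forall z, bernstein p Rad z -> cabs (f z) <= W) ->
  pnorm p (\row_j `|Im (th j)|) <= rho ->
  cabs (interp K f (\row_j ccos (th j)) - f (\row_j ccos (th j))) <= W * err d K (Rad - rho).
Proof.
move=> d0 p0 K0 rR hf hW hth; set x := Rad - rho; have x0 : 0 < x by rewrite subr_gt0.
have dR0 : 0 < d%:R :> R by rewrite ltr0n.
have fth : cabs (f (\row_j ccos (th j))) <= W.
  apply: hW; apply: bernstein_angle; apply: le_lt_trans rR; apply: le_trans hth.
  by apply: ler_pnorm => // j; rewrite !mxE normr_id.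
have W0 : 0 <= W := le_trans (cabs_ge0 _) fth.
have box (Y : 'I_d -> R) : (forall j, 0 <= Y j) -> pnorm p (\row_j Y j) < Rad ->
    box_fun Y W (angle_fun f) by exact: angle_fun_box.
rewrite interp_angle -[f (\row_j _)]/(angle_fun f th).
have [hlarge|] := boolP ((d <= 3)%N || (d%:R - 1 <= K%:R * x)).
  apply: (@le_trans _ _ (2 ^+ d.+1 * tail d x K%:R * W)); last first.
    by rewrite mulrC; apply: ler_wpM2l => //; exact: tail_le_err.
  (* Each a < x leaves room for the tube inside the ellipse; continuity of [tail] in a gives the
     bound at x itself. *)
  apply: (@cvgr_to_ge R (x^'-) _ R (fun a => 2 ^+ d.+1 * tail d a K%:R * W)).
    apply: cvgM; last exact: cvg_cst.
    apply: cvgM; first exact: cvg_cst.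
    by apply: cvg_at_left_filter; apply: cvg_tail; rewrite gt_eqF.
  near=> a.
  have a0 : 0 < a by near: a; exact: nbhs_left_gt.
  have ax : a < x by near: a; exact: nbhs_left_lt.
  (* Widening all d coordinates by 2 dl costs at most (x - a) / 2 in norm, half of the room. *)
  pose dl := (x - a) / (4 * d%:R).
  have dl0 : 0 < dl by rewrite divr_gt0 ?subr_gt0 // mulr_gt0.
  apply: (interp_error_tail _ _ _ dl0 W0) => // j0.
  have Y0 j : 0 <= `|Im (th j)| + (if j == j0 then a else 0).
    by rewrite addr_ge0 //; case: ifP => // _; exact: ltW.
  apply: box; first by move=> j; apply: addr_ge0 (Y0 j) _; apply: mulr_ge0 (ltW dl0).
  apply: le_lt_trans (pnorm_shift p0 Y0 _) _; first by apply: mulr_ge0 (ltW dl0).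
  have := pnorm_coord_shift p0 j0 (fun j => normr_ge0 (Im (th j))) (ltW a0).
  rewrite (_ : d%:R * (2 * dl) = (x - a) / 2).
    have -> : Rad = rho + x by rewrite /x; ring.
    by move: (pnorm p _) (pnorm p _) hth ax => s1 s2; clear; clearbody x; lra.
  by rewrite /dl; field; rewrite gt_eqF.
rewrite negb_or -ltnNge -ltNge => /andP[d4 Kx].
rewrite -(mulrC (err _ _ _)); apply: (@le_trans _ _ ((1 + Num.sqrt (node_norm2 R K) ^+ d) * W)); last first.
  by apply: ler_wpM2r => //; exact: err_large_index.
apply: le_trans (le_cabsB _ _) _; rewrite mulrDl mul1r addrC lerD //.
pose dl := x / (2 * d%:R); have dl0 : 0 < dl by rewrite divr_gt0 // mulr_gt0.
apply: (@interp_norm_bound _ _ _ _ _ (fun j => `|Im (th j)| + dl)) => //; last first.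
  by move=> j; rewrite ltrDl.
apply: box; first by move=> j; rewrite addr_ge0 // ltW.
apply: le_lt_trans (pnorm_shift p0 (fun j => normr_ge0 (Im (th j))) (ltW dl0)) _.
rewrite (_ : d%:R * dl = x / 2); last by rewrite /dl; field; rewrite gt_eqF.
have -> : Rad = rho + x by rewrite /x; ring.
by move: (pnorm p _) hth x0 => s1; clear; clearbody x; lra.
Unshelve. all: by end_near.
Qed.

(** For rho = 0 the points of the cube are cosines of real angles, with imaginary part of norm 0, so
    the convention for rho = 0 falls under the same angle estimate. *)
Lemma hdomain_angle (d p : nat) (rho : R) (z : 'rV[C]_d) : (0 < p)%N -> hdomain p rho z ->
  exists2 th : 'I_d -> C, z = \row_j ccos (th j) & pnorm p (\row_j `|Im (th j)|) <= rho.
Proof.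
move=> p0; rewrite /hdomain; case: eqP => [->|_].
  move=> [t /= ht <-]; exists (fun j => (acos (t ord0 j))%:C).
    by apply/rowP => j; rewrite !mxE ccosR acosK // in_itv /= ht.
  apply: pnorm_le => //; rewrite big1 ?exprn_ge0 // => j _.
  by rewrite mxE /= !normr0 expr0n gtn_eqF.
move=> [x _ [y /= hy <-]]; exists (fun j => x ord0 j +i* y ord0 j) => //.
by apply: le_trans (ltW hy); apply: ler_pnorm => // j; rewrite mxE normr_id.
Qed.

End Main.

Theorem theorem3p3 (R : realType) (d p : nat) (r Rad : R)
    (J : countType) (w : J -> 'rV[R[i]]_d -> R[i])
    (v : J -> 'rV[R[i]]_d -> 'rV[R[i]]_d) (W : R)
    (L : ('rV[R[i]]_d -> R[i]) -> ('rV[R[i]]_d -> R[i])) :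
  (0 < d)%N -> (0 < p)%N -> 0 < r -> r < Rad ->
  (forall j, Hspace p Rad (w j)) ->
  (forall j, holomorphic_on (bernstein p Rad) (v j)) ->
  (forall j z, bernstein p Rad z -> bernstein p r (v j z)) ->
  (\esum_(j in [set: J]) hnorm p Rad (w j) <= W%:E)%E ->
  is_transfer_operator p r Rad w v L ->
  forall (K : nat) (rho : R), (1 <= K)%N -> 0 <= rho -> rho < Rad ->
    (opnorm p r rho (fun phi => (interp K (L phi) \- L phi)%R)
      <= (W * err d K (Rad - rho))%:E)%E.
Proof.
move=> d0 p0 r0 rR _ _ hv hw hL K rho K0 _ rhoR.
apply: ge_ereal_sup => _ [phi [hphi phi1] <-]; apply: ge_ereal_sup => _ [z /(hdomain_angle p0)[th -> hth] <-].
have [[hol _ _] _] := hL _ hphi; rewrite lee_fin.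
apply: interp_error_angle hth => // z' hz'; exact: transfer_bound hL hphi phi1 hz'.
Qed.
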